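(* Fix an integer $k\ge 2$ and consider the polynomial structural errors-in-variables model $$y = c^{T} z + \beta_0+\beta^T(\xi,\xi^2,\dots,\xi^k)^T + e+\epsilon,\qquad x=\xi+\delta,$$ where $y,\xi,e,\epsilon,\delta,x$ are real random variables, $z$ is a random vector in $\mathbb{R}^q$, and $c\in\mathbb{R}^q$, $\beta_0\in\mathbb{R}$, $\beta\in\mathbb{R}^k$ are nonrandom. Assume: (a) $\xi$, $e$, $z$ and $(\epsilon,\delta)^T$ are independent with finite second moments ($\epsilon$ and $\delta$ may be correlated with each other); (b) $\Sigma_z=\mathbf{Cov}(z)$ is nonsingular and $\sigma_x^2=\mathbf{Var}(x)>0$; (c) $e,\epsilon,\delta$ have zero mean; (d) $\epsilon,\delta,\xi$ are jointly Gaussian. Suppose that $\sigma_{\epsilon\delta}=\mathbf{E}\,\epsilon\delta$ is the only model parameter which is known. Let $(y_i,z_i,\xi_i,e_i,\epsilon_i,x_i,\delta_i)$, $i=0,1,2,\dots$, be independent copies of the model; put $\eta_0=\mathbf{E}[y_0\mid z_0,\xi_0]$ and let $\hat\eta_0=\mathbf{E}[\eta_0\mid z_0,x_0]$ be the best mean predictor. Define $$\tilde\eta_0=\tilde y_0-\sigma_{\epsilon\delta}\,\hat\sigma_x^{-2}(x_0-\hat\mu),$$ where $\tilde y_0$ is the OLS predictor (defined in the context) and $$\hat\mu=\bar x=\frac1n\sum_{i=1}^n x_i,\qquad \hat\sigma_x^2=\frac1{n-1}\sum_{i=1}^n(x_i-\bar x)^2 .$$ Then $\tilde\eta_0$ is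 a strongly consistent estimator of $\hat\eta_0$, i.e. $\tilde\eta_0\to\hat\eta_0$ almost surely as $n\to\infty$, and moreover $$\forall\,\tau>0,\qquad \mathbf{P}\big(|\tilde\eta_0-\hat\eta_0|>\tau\,\big|\,z_0,x_0\big)\to0\quad\text{a.s. as }n\to\infty.$$
   Context: All vectors are columns. For variables $u,v$, $\bar u=\frac1n\sum_{i=1}^n u_i$ (in particular $\overline{x^j}=\frac1n\sum_{i=1}^n x_i^j$) and $S_{uv}=\frac1n\sum_{i=1}^n (u_i-\bar u)(v_i-\bar v)^T$. $A^{+}$ denotes the (Moore–Penrose) pseudo-inverse. With $r=(z^T,x,x^2,\dots,x^k)^T$, the OLS estimators are $$\begin{pmatrix}\hat c\\ \hat\beta_x\end{pmatrix}=S_{rr}^{+}S_{ry},\qquad \hat\beta_{0x}=\bar y-\hat c^T\bar z-\hat\beta_x^T(\overline{x},\overline{x^2},\dots,\overline{x^k})^T ,$$ and the OLS predictor, built from $(y_i,z_i,x_i)$, $i=1,\dots,n$, and $(z_0,x_0)$, is $\tilde y_0=\hat c^Tz_0+\hat\beta_{0x}+\hat\beta_x^T(x_0,x_0^2,\dots,x_0^k)^T$. (For $n\ge2$, $\hat\sigma_x^2>0$ almost surely.) *)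

(* Defs.v *)
From HB Require Import structures.
From mathcomp Require Import all_boot all_order all_algebra finmap.
From mathcomp Require Import all_classical all_reals all_analysis.

Set Implicit Arguments.
Unset Strict Implicit.
Unset Printing Implicit Defensive.

Import Order.TTheory GRing.Theory Num.Theory.
Import numFieldNormedType.Exports.

Local Open Scope classical_set_scope.
Local Open Scope ring_scope.

Definition is_moore_penrose (R : realType) (m n : nat)
    (A : 'M[R]_(m, n)) (B : 'M[R]_(n, m)) : Prop :=
  [/\ A *m B *m A = A, B *m A *m B = B,
      (A *m B)^T = A *m B & (B *m A)^T = B *m A].

Definition pseudo_inverse (R : realType) (m n : nat) (A : 'M[R]_(m, n)) :
    'M[R]_(n, m) :=
  xget 0 [set B | is_moore_penrose A B].

Lemma is_moore_penrose_uniq (R : realType) (m n : nat) (A : 'M[R]_(m, n))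
    (B C : 'M[R]_(n, m)) :
  is_moore_penrose A B -> is_moore_penrose A C -> B = C.
Proof.
move=> [B1 B2 B3 B4] [C1 C2 C3 C4].
have AB_AC : A *m B = A *m C.
  by rewrite -[in LHS]C1 -!mulmxA mulmxA -C3 -B3 -trmx_mul mulmxA B1.
have BA_CA : B *m A = C *m A.
  by rewrite -[in LHS]C1 -(mulmxA A) mulmxA -C4 -B4 -trmx_mul -mulmxA (mulmxA A) B1.
by rewrite -B2 -mulmxA AB_AC mulmxA BA_CA.
Qed.

Lemma row_free_gram_unit (R : realType) (m n : nat) (A : 'M[R]_(m, n)) :
  row_free A -> A *m A^T \in unitmx.
Proof.
move=> freeA; rewrite -row_free_unit; apply/row_freeP.
suff : kermx (A *m A^T) = 0 by move/eqP; rewrite kermx_eq0 => /row_freeP.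
apply/row_matrixP => i; rewrite row0; set u := row i _.
have uG : u *m (A *m A^T) = 0 by apply/sub_kermxP; exact: row_sub.
have := congr1 (mulmx^~ u^T) uG.
rewrite mul0mx -mulmxA -mulmxA -trmx_mul mulmxA => /matrixP /(_ ord0 ord0).
rewrite mxE [RHS]mxE => s0.
have uA0 : u *m A = 0.
  apply/rowP => j; rewrite [RHS]mxE.
  have ge0 l : true -> 0 <= (u *m A) ord0 l * (u *m A)^T l ord0.
    by move=> _; rewrite [_^T _ _]mxE -expr2 sqr_ge0.
  have /eqP := psumr_eq0P ge0 s0 (i := j) isT.
  by rewrite [_^T _ _]mxE -expr2 expf_eq0 => /= /eqP.
by apply: (row_free_inj freeA); rewrite uA0 mul0mx.
Qed.

Lemma pseudo_inverseP (R : realType) (m n : nat) (A : 'M[R]_(m, n)) :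
  is_moore_penrose A (pseudo_inverse A).
Proof.
suff [B ?] : exists B, is_moore_penrose A B.
  by rewrite /pseudo_inverse; case: xgetP => // /(_ B).
have := row_base_free A; have := col_base_full A.
rewrite -[A in is_moore_penrose A](mulmx_base A).
move: (\rank A) (col_base A) (row_base A) => r C F fullC freeF.
have uF : F *m F^T \in unitmx by exact: row_free_gram_unit.
have uC : C^T *m C \in unitmx.
  rewrite -{2}[C]trmxK; apply: row_free_gram_unit.
  by rewrite /row_free mxrank_tr.
pose X := F^T *m invmx (F *m F^T); pose Y := invmx (C^T *m C) *m C^T.
have FX : F *m X = 1%:M by rewrite mulmxA mulmxV.
have YC : Y *m C = 1%:M by rewrite -mulmxA mulVmx.
have AB : C *m F *m (X *m Y) = C *m Y by rewrite -mulmxA (mulmxA F) FX mul1mx.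
have BA : X *m Y *m (C *m F) = X *m F by rewrite -mulmxA (mulmxA Y) YC mul1mx.
exists (X *m Y); split.
- by rewrite AB -mulmxA (mulmxA Y) YC mul1mx.
- by rewrite BA -mulmxA (mulmxA F) FX mul1mx.
- by rewrite AB /Y !trmx_mul trmx_inv trmx_mul trmxK mulmxA.
- by rewrite BA /X !trmx_mul trmx_inv trmx_mul trmxK mulmxA.
Qed.

(* A data sequence is indexed by nat, but the sample of size n consists of the
   entries 1, ..., n; entry 0 is the new observation, at which one predicts. *)

Definition sample_mean (R : realType) (V : lmodType R) (u : nat -> V) (n : nat)
    : V :=
  n%:R^-1 *: \sum_(1 <= i < n.+1) u i.

Definition sample_cov (R : realType) (l m : nat)
    (u : nat -> 'cV[R]_l) (v : nat -> 'cV[R]_m) (n : nat) : 'M[R]_(l, m) :=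
  n%:R^-1 *: \sum_(1 <= i < n.+1)
    ((u i - sample_mean u n) *m (v i - sample_mean v n)^T).

Definition sample_var (R : realType) (x : nat -> R) (n : nat) : R :=
  n.-1%:R^-1 * \sum_(1 <= i < n.+1) (x i - sample_mean (x : nat -> R^o) n) ^+ 2.

Definition dotmx (R : realType) (m : nat) (u v : 'cV[R]_m) : R := (u^T *m v) 0 0.

Definition powers (R : realType) (k : nat) (t : R) : 'cV[R]_k :=
  \col_j t ^+ j.+1.

Definition regressor (R : realType) (q k : nat)
    (z : nat -> 'cV[R]_q) (x : nat -> R) (i : nat) : 'cV[R]_(q + k) :=
  col_mx (z i) (powers k (x i)).

Definition ols_coef (R : realType) (q k : nat)
    (y : nat -> R) (z : nat -> 'cV[R]_q) (x : nat -> R) (n : nat) : 'cV[R]_(q + k) :=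
  pseudo_inverse (sample_cov (regressor k z x) (regressor k z x) n)
    *m sample_cov (regressor k z x) (fun i => (y i)%:M) n.

Definition ols_c (R : realType) (q k : nat)
    (y : nat -> R) (z : nat -> 'cV[R]_q) (x : nat -> R) (n : nat) : 'cV[R]_q :=
  usubmx (ols_coef k y z x n).

Definition ols_beta (R : realType) (q k : nat)
    (y : nat -> R) (z : nat -> 'cV[R]_q) (x : nat -> R) (n : nat) : 'cV[R]_k :=
  dsubmx (ols_coef k y z x n).

Definition ols_beta0 (R : realType) (q k : nat)
    (y : nat -> R) (z : nat -> 'cV[R]_q) (x : nat -> R) (n : nat) : R :=
  sample_mean (y : nat -> R^o) n
  - dotmx (ols_c k y z x n) (sample_mean z n)
  - dotmx (ols_beta k y z x n) (sample_mean (fun i => powers k (x i)) n).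

Definition ols_predictor (R : realType) (q k : nat)
    (y : nat -> R) (z : nat -> 'cV[R]_q) (x : nat -> R) (n : nat) : R :=
  dotmx (ols_c k y z x n) (z 0%N) + ols_beta0 k y z x n
  + dotmx (ols_beta k y z x n) (powers k (x 0%N)).

Definition corrected_predictor (R : realType) (q k : nat)
    (y : nat -> R) (z : nat -> 'cV[R]_q) (x : nat -> R) (n : nat) (s : R) : R :=
  ols_predictor k y z x n
  - s * (sample_var x n)^-1 * (x 0%N - sample_mean (x : nat -> R^o) n).

Definition sigma_of (T : Type) (d' : measure_display) (T' : measurableType d')
    (X : T -> T') : set_system T :=
  preimage_set_system setT X measurable.

Definition mutually_independent (d : measure_display) (T : measurableType d)
    (R : realType) (P : probability T R) (I : choiceType)
    (F : I -> set_system T) : Prop :=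
  forall (J : {fset I}) (A : I -> set T), (forall i, i \in J -> F i (A i)) ->
    P (\bigcap_(i in [set` J]) A i) = (\prod_(i <- J) P (A i))%E.

Definition same_law (d : measure_display) (T : measurableType d)
    (R : realType) (P : probability T R)
    (d' : measure_display) (T' : measurableType d') (X Y : T -> T') : Prop :=
  forall B, measurable B -> P (X @^-1` B) = P (Y @^-1` B).

(* Degenerate normal laws are allowed; they are listed apart because the
   library's [normal_prob m 0] is not the Dirac mass at m. *)
Definition gaussian_law (R : realType) (mu : set R -> \bar R) : Prop :=
  (exists m s : R, s != 0 /\
     forall B, measurable B -> mu B = normal_prob m s B) \/
  (exists m : R, forall B, measurable B -> mu B = dirac m B).

Definition jointly_gaussian (d : measure_display) (T : measurableType d)
    (R : realType) (P : probability T R) (m : nat) (X : T -> m.-tuple R)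
    : Prop :=
  forall a : 'I_m -> R,
    gaussian_law (pushforward P (fun w => \sum_j a j * tnth (X w) j)).

(* Y is a version of E[X | G].  X itself is not required to be integrable. *)
Definition is_cond_expectation (d : measure_display) (T : measurableType d)
    (R : realType) (P : probability T R) (G : set_system T) (X Y : T -> R)
    : Prop :=
  [/\ P.-integrable setT (EFin \o Y),
      preimage_set_system setT Y measurable `<=` G &
      forall A, G A -> (\int[P]_(w in A) (Y w)%:E = \int[P]_(w in A) (X w)%:E)%E].

Definition is_cond_probability (d : measure_display) (T : measurableType d)
    (R : realType) (P : probability T R) (G : set_system T) (E : set T)
    (p : T -> R) : Prop :=
  is_cond_expectation P G \1_E p.

Definition colv (R : realType) (q : nat) (t : q.-tuple R) : 'cV[R]_q :=
  \col_j tnth t j.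

Definition cov_mx (d : measure_display) (T : measurableType d)
    (R : realType) (P : probability T R) (q : nat) (z : T -> q.-tuple R)
    : 'M[R]_q :=
  \matrix_(i, j) fine (covariance P (fun w => tnth (z w) i)
                                    (fun w => tnth (z w) j)).

Record eiv_model (d : measure_display) (T : measurableType d)
    (R : realType) (P : probability T R) (q k : nat)
    (c : 'cV[R]_q) (beta0 : R) (beta : 'cV[R]_k) (sigma_ed : R)
    (y : {RV P >-> R}) (z : {RV P >-> q.-tuple R})
    (xi e eps x delta : {RV P >-> R}) : Prop := EivModel {
  eiv_y : {ae P, forall w, y w =
    dotmx c (colv (z w)) + beta0 + dotmx beta (powers k (xi w)) + e w + eps w};
  eiv_x : {ae P, forall w, x w = xi w + delta w};
  eiv_indep : mutually_independent P
    (tnth [tuple sigma_of xi; sigma_of e; sigma_of z;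
                 sigma_of (fun w => (eps w, delta w))]);
  eiv_L2_xi : (xi : T -> R) \in Lfun P 2%:E;
  eiv_L2_e : (e : T -> R) \in Lfun P 2%:E;
  eiv_L2_z : forall j, (fun w => tnth (z w) j) \in Lfun P 2%:E;
  eiv_L2_eps : (eps : T -> R) \in Lfun P 2%:E;
  eiv_L2_delta : (delta : T -> R) \in Lfun P 2%:E;
  eiv_cov_z : cov_mx P z \in unitmx;
  eiv_var_x : (0 < 'V_P[x])%E;
  eiv_mean_e : ('E_P[e] = 0)%E;
  eiv_mean_eps : ('E_P[eps] = 0)%E;
  eiv_mean_delta : ('E_P[delta] = 0)%E;
  eiv_gauss : jointly_gaussian P (fun w => [tuple eps w; delta w; xi w]);
  eiv_sigma_ed : ('E_P[(eps \* delta)%R] = sigma_ed%:E)%E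
}.

Definition observation (T : Type) (R : realType) (q : nat)
    (y : T -> R) (z : T -> q.-tuple R) (xi e eps x delta : T -> R) (w : T) :=
  (y w, z w, xi w, e w, eps w, x w, delta w).

(* Main.v *)
Require Import Defs.
From HB Require Import structures.
From mathcomp Require Import all_boot all_order all_algebra finmap.
From mathcomp Require Import all_classical all_reals all_analysis.
From mathcomp Require Import measurable_realfun ring lra.
Import Defs.
Import Order.TTheory GRing.Theory Num.Theory.
Import numFieldNormedType.Exports.
Local Open Scope classical_set_scope.
Local Open Scope ring_scope.
Set Implicit Arguments.
Unset Strict Implicit.
Unset Printing Implicit Defensive.

(* Let r = (z, x, ..., x^k), mu = E x and a = sigma_ed / Var x.  Two Gaussian
   facts identify the population regression of y on (1, r).  First, eps -
   a (x - mu) is orthogonal to every power of x: the moments of x + s eps depend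
   on s only through its variance, and one compares the coefficients of s.
   Second, xi - lam x is independent of x for some lam, because the joint density
   factorizes; hence E[xi^j | x] is a polynomial of degree at most j in x.  So for
   suitable b and b0 the residual y - b.r - b0 is centered and orthogonal to r,
   while b.r + b0 - a (x - mu) is E[eta | z, x].  The covariance matrix of r is
   nonsingular, since z and x are independent and a nonzero polynomial vanishes
   at x with probability 0.  The strong law of large numbers, proved by Garsia's
   maximal argument, then makes the OLS coefficients converge to b.

   For the conditional probabilities p_n, the events lie in measurable events F_n
   of which almost surely only finitely many occur.  Decomposing along the first
   index n >= N with p_n > t gives t P(p_n > t for some n >= N) <= P(F_n for some
   n >= N), and the right-hand side tends to 0. *)

(** * Means and independence *)

(** The two Gaussian facts differ in strength because they serve different ends. The limit of least
    squares only sees the covariances of y with r, so for [eps] orthogonality to the powers of x is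
    what matters. The best predictor is a conditional expectation, so the powers of xi must be
    compared with all square-integrable functions of x, indicators included. The correction term
    comes from [eps]: it is part of y and correlated with x through delta, but it is not part of
    eta. Least squares absorbs a (x - mu) into its linear part, and this has to be removed. The
    degree bound keeps the regression in the span of 1, x, ..., x^k, so that the fitted model is
    exact in the limit. Two obstacles shape the details. Only the sum xi + delta is known to have
    positive variance, so the joint density is used after the case of a constant xi or delta has
    been set apart. And the equations for x and y hold almost surely only, so the analysis runs on
    the exact expressions [x'] and [y'] and is transferred at the end. *)

Section mean.
Context d (T : measurableType d) (R : realType) (P : probability T R).
Implicit Types f g : T -> R.

Definition intg f := P.-integrable setT (EFin \o f).

(** Real-valued, so that identities between expectations become ring identities. For integrable [f]
    it is the expectation; [fine] sends infinite values to 0. *)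
Definition mean f : R := fine (\int[P]_w (f w)%:E).

Lemma meanE f : intg f -> (\int[P]_w (f w)%:E = (mean f)%:E)%E.
Proof. by move=> fi; rewrite fineK// integrable_fin_num. Qed.

Lemma intg_meas f : intg f -> measurable_fun setT f.
Proof. by move=> /measurable_int /measurable_EFinP. Qed.

Lemma eq_intg f g : f =1 g -> intg f -> intg g.
Proof. by move=> fg; rewrite (funext fg). Qed.

Lemma eq_mean f g : f =1 g -> mean f = mean g.
Proof. by move=> fg; rewrite (funext fg). Qed.

Lemma intgD f g : intg f -> intg g -> intg (fun w => f w + g w).
Proof. by move=> fi gi; exact: (integrableD measurableT fi gi). Qed.

Lemma intgB f g : intg f -> intg g -> intg (fun w => f w - g w).
Proof. by move=> fi gi; exact: (integrableB measurableT fi gi). Qed.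

Lemma intgZ a f : intg f -> intg (fun w => a * f w).
Proof. by move=> fi; exact: (integrableZl measurableT a fi). Qed.

Lemma intg_cst (a : R) : intg (fun _ => a).
Proof. exact: finite_measure_integrable_cst. Qed.

Lemma intg_sum (I : Type) (s : seq I) (h : I -> T -> R) :
  (forall i, intg (h i)) -> intg (fun w => \sum_(i <- s) h i w).
Proof.
move=> hi; elim: s => [|a s IH].
  by apply: (eq_intg _ (intg_cst 0)) => w; rewrite big_nil.
by apply: (eq_intg _ (intgD (hi a) IH)) => w; rewrite big_cons.
Qed.

Lemma intg_le f g : measurable_fun setT f -> intg g ->
  (forall w, `|f w| <= g w) -> intg f.
Proof.
move=> mf gi fg; apply: (le_integrable measurableT _ _ gi) => /=.
  exact/measurable_EFinP.
by move=> w _; rewrite lee_fin (le_trans (fg w))// ler_norm.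
Qed.

Lemma intg_norm f : intg f -> intg (fun w => `|f w|).
Proof. by move=> fi; exact: (integrable_norm fi). Qed.

Lemma intg_indic f (A : set T) : measurable A -> intg f ->
  intg (fun w => f w * \1_A w).
Proof.
move=> mA fi; apply: (intg_le _ (intg_norm fi)).
  by apply: measurable_funM => //; exact: intg_meas.
move=> w; rewrite normrM ler_piMr// indicE.
by case: (w \in A); rewrite ?normr1 ?normr0.
Qed.

Lemma meanD f g : intg f -> intg g ->
  mean (fun w => f w + g w) = mean f + mean g.
Proof.
move=> fi gi; apply: EFin_inj.
by rewrite -meanE ?EFinD -?meanE//; [exact: integralD_EFin|exact: intgD].
Qed.

Lemma meanZ a f : intg f -> mean (fun w => a * f w) = a * mean f.
Proof.
move=> fi; apply: EFin_inj.
rewrite -meanE ?EFinM -?meanE//; last exact: intgZ.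
by rewrite -(integralZl measurableT fi); apply: eq_integral.
Qed.

Lemma meanB f g : intg f -> intg g ->
  mean (fun w => f w - g w) = mean f - mean g.
Proof.
move=> fi gi; rewrite -mulN1r -(meanZ _ gi) -meanD//; last exact: intgZ.
by apply: eq_mean => w; rewrite mulN1r.
Qed.

Lemma mean_cst a : mean (fun _ => a) = a.
Proof. by rewrite /mean integral_cst//= probability_setT mule1. Qed.

Lemma mean_sum (I : Type) (s : seq I) (h : I -> T -> R) :
  (forall i, intg (h i)) ->
  mean (fun w => \sum_(i <- s) h i w) = \sum_(i <- s) mean (h i).
Proof.
move=> hi; elim: s => [|a s IH].
  by rewrite big_nil -[RHS](mean_cst 0); apply: eq_mean => w; rewrite big_nil.
rewrite big_cons -IH -meanD//; last exact: intg_sum.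
by apply: eq_mean => w; rewrite big_cons.
Qed.

Lemma le_mean f g : intg f -> intg g -> (forall w, f w <= g w) ->
  mean f <= mean g.
Proof.
move=> fi gi fg; rewrite -lee_fin -!meanE//.
by apply: le_integral => // w _; rewrite lee_fin.
Qed.

Lemma mean_indic (A : set T) : measurable A -> P A = (mean \1_A)%:E.
Proof.
move=> mA; rewrite -meanE ?integral_indic ?setIT//.
exact: integrable_indic.
Qed.

Lemma integral_mean f (A : set T) : measurable A -> intg f ->
  (\int[P]_(w in A) (f w)%:E = (mean (fun w => f w * \1_A w))%:E)%E.
Proof.
move=> mA fi; rewrite -meanE; last exact: intg_indic.
rewrite integral_mkcond; apply: eq_integral => w _.
by rewrite patchE indicE; case: ifPn; rewrite ?mulr1 ?mulr0.
Qed.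

Lemma ae_mean f g : measurable_fun setT f -> measurable_fun setT g ->
  {ae P, forall w, f w = g w} -> mean f = mean g.
Proof.
move=> mf mg fg; congr fine; apply: ae_eq_integral => //.
- exact/measurable_EFinP.
- exact/measurable_EFinP.
- by apply: filterS fg => w -> _.
Qed.

Lemma ae_intg f g : measurable_fun setT f ->
  {ae P, forall w, f w = g w} -> intg g -> intg f.
Proof.
move=> mf fg gi; apply/integrableP; split; first exact/measurable_EFinP.
have mg := intg_meas gi.
move/integrableP : gi => [_]; apply: le_lt_trans.
rewrite (@ae_eq_integral _ _ _ _ setT (fun w => `|(EFin \o g) w|%E))//.
- by apply/measurable_EFinP; exact: measurableT_comp.
- by apply/measurable_EFinP; exact: measurableT_comp.
- by apply: filterS fg => w /= -> _.
Qed.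

Lemma mean0_ae f : intg f -> (forall w, 0 <= f w) -> mean f = 0 ->
  {ae P, forall w, f w = 0}.
Proof.
move=> fi f0 ef.
have : ae_eq P setT (EFin \o f) (cst 0%E).
  apply/(ae_eq_integral_abs P measurableT) => /=.
    exact/measurable_EFinP/intg_meas.
  under eq_integral do rewrite ger0_norm//.
  by rewrite meanE// ef.
by apply: filterS => w /(_ I) /= [].
Qed.

Definition intg2 f := measurable_fun setT f /\ intg (fun w => f w ^+ 2).

Lemma intg2_meas f : intg2 f -> measurable_fun setT f.
Proof. by case. Qed.

Lemma eq_intg2 f g : f =1 g -> intg2 f -> intg2 g.
Proof. by move=> fg; rewrite (funext fg). Qed.

(** Both f^2 + g^2 + f g and f^2 + g^2 - f g are nonnegative, so f^2 + g^2 dominates |f g|. *)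
Lemma intg2M f g : intg2 f -> intg2 g -> intg (fun w => f w * g w).
Proof.
move=> [mf fi] [mg gi]; apply: (intg_le _ (intgD fi gi)) => [|w].
  exact: measurable_funM.
rewrite ler_norml; apply/andP; split.
  by have := sqr_ge0 (f w + g w); have := sqr_ge0 (f w); have := sqr_ge0 (g w); nra.
by have := sqr_ge0 (f w - g w); have := sqr_ge0 (f w); have := sqr_ge0 (g w); nra.
Qed.

Lemma intg2_cst a : intg2 (fun _ => a).
Proof. by split => //; exact: intg_cst. Qed.

Lemma intg2_intg f : intg2 f -> intg f.
Proof.
move=> f2; apply: (eq_intg _ (intg2M f2 (intg2_cst 1))) => w.
by rewrite mulr1.
Qed.

Lemma intg2D f g : intg2 f -> intg2 g -> intg2 (fun w => f w + g w).
Proof.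
move=> f2 g2; split; first by apply: measurable_funD; exact: intg2_meas.
have fg := intgZ 2 (intg2M f2 g2).
case: f2 g2 => mf fi [mg gi].
apply: (eq_intg _ (intgD (intgD fi gi) fg)) => w; ring.
Qed.

Lemma intg2Z a f : intg2 f -> intg2 (fun w => a * f w).
Proof.
move=> [mf fi]; split; first exact: measurable_funM.
by apply: (eq_intg _ (intgZ (a ^+ 2) fi)) => w; ring.
Qed.

Lemma intg2B f g : intg2 f -> intg2 g -> intg2 (fun w => f w - g w).
Proof.
move=> f2 /(intg2Z (-1)) g2.
by apply: (eq_intg2 _ (intg2D f2 g2)) => w; rewrite mulN1r.
Qed.

Lemma intg2_sum (I : Type) (s : seq I) (h : I -> T -> R) :
  (forall i, intg2 (h i)) -> intg2 (fun w => \sum_(i <- s) h i w).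
Proof.
move=> hi; elim: s => [|a s IH].
  by apply: (eq_intg2 _ (intg2_cst 0)) => w; rewrite big_nil.
by apply: (eq_intg2 _ (intg2D (hi a) IH)) => w; rewrite big_cons.
Qed.

Lemma ae_intg2 f g : measurable_fun setT f ->
  {ae P, forall w, f w = g w} -> intg2 g -> intg2 f.
Proof.
move=> mf fg [mg gi]; split => //; apply: (ae_intg _ _ gi).
  exact: measurable_funX.
by apply: filterS fg => w ->.
Qed.

Lemma Lfun2_intg2 f : f \in Lfun P 2%:E -> intg2 f.
Proof.
move=> f2; split; last exact: Lfun2_integrable_sqr.
by move: f2; rewrite inE => /andP[]; rewrite inE.
Qed.

End mean.

Definition mfun_of d1 d2 (T1 : measurableType d1) (T2 : measurableType d2)
  (f : T1 -> T2) (mf : measurable_fun setT f) : {mfun T1 >-> T2} :=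
  HB.pack f (isMeasurableFun.Build _ _ _ _ f mf).

Section rectangles.
Context d1 d2 (T1 : measurableType d1) (T2 : measurableType d2) (R : realType).

Let rect : set_system (T1 * T2) :=
  [set A `*` B | A in measurable & B in measurable].

Let rectI : setI_closed rect.
Proof.
move=> _ _ [A mA [B mB <-]] [C mC [D mD <-]].
exists (A `&` C); first exact: measurableI.
by exists (B `&` D); [exact: measurableI|rewrite setXI].
Qed.

(** Rectangles are stable under intersection and generate the product sigma-algebra, so they
    determine a finite measure. *)
Lemma measure_eq_rectangles (m1 m2 : {measure set (T1 * T2) -> \bar R}) :
  (m1 setT < +oo)%E ->
  (forall A B, measurable A -> measurable B -> m1 (A `*` B) = m2 (A `*` B)) ->
  forall D, measurable D -> m1 D = m2 D.
Proof.
move=> fin eqm D mD.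
apply: (measure_unique rect (fun=> setT)) => //.
- exact: measurable_prod_measurableType.
- by move=> _; exists setT => //; exists setT => //; rewrite setXTT.
- by apply/seteqP; split => // x _; exists 0%N.
- by move=> _ [A mA [B mB <-]]; exact: eqm.
Qed.

(** [W] has no sign, so this is not an equality of measures; instead the sets [D] with null integral
    contain the rectangles and form a Dynkin system. The criterion serves both for independence from
    a pair and for conditional expectations given a pair. *)
Lemma mean0_rectangles d (T : measurableType d) (P : probability T R)
    (Z : T -> T1) (X : T -> T2) (W : T -> R) :
  measurable_fun setT Z -> measurable_fun setT X -> intg P W ->
  (forall A B, measurable A -> measurable B ->
     mean P (fun w => W w * (\1_A (Z w) * \1_B (X w))) = 0) ->
  forall D, measurable D -> mean P (fun w => W w * \1_D (Z w, X w)) = 0.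
Proof.
move=> mZ mX Wi W0 D mD.
have mZX : measurable_fun setT (fun w => (Z w, X w)).
  exact: measurable_fun_pair.
pose h := fun w => (Z w, X w).
have mh C : measurable C -> measurable (h @^-1` C).
  by move=> mC; rewrite -[X in measurable X]setTI; exact: mZX.
have WD C : measurable C -> intg P (fun w => W w * \1_C (h w)).
  by move=> mC; apply: (intg_indic (A := h @^-1` C) _ Wi); exact: mh.
have WT : mean P W = 0.
  rewrite -(W0 setT setT measurableT measurableT); apply: eq_mean => w.
  by rewrite !indicT !mulr1.
apply: (@dynkin_induction _ _ rect
    (fun C => mean P (fun w => W w * \1_C (h w)) = 0)).
- exact: measurable_prod_measurableType.
- exact: rectI.
- by rewrite -[RHS]WT; apply: eq_mean => w; rewrite indicT mulr1.
- move=> _ [A mA [B mB <-]] /=; rewrite -(W0 A B mA mB); apply: eq_mean => w.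
  by rewrite !indicE in_setX /=; case: (_ \in A); case: (_ \in B); rewrite /= ?mulr1 ?mulr0.
- move=> C mC C0.
  rewrite -[RHS](subrr 0) -{1}WT -{1}C0 -meanB//; last exact: WD.
  apply: eq_mean => w; rewrite !indicE in_setC.
  by case: (_ \in C); rewrite /= ?mulr1 ?mulr0 ?subrr ?subr0.
- move=> F mF tF F0.
  have mU : measurable (\bigcup_k F k) by exact: bigcup_measurable.
  apply: EFin_inj; rewrite -[LHS](integral_mean (mh _ mU) Wi) preimage_bigcup.
  rewrite integral_bigcup//.
  + rewrite eseries0// => i _ _.
    by rewrite (integral_mean (mh _ (mF i)) Wi); congr EFin; exact: F0.
  + apply/trivIsetP => /= i j _ _ ij; rewrite -preimage_setI.
    by move/trivIsetP : tF => /(_ _ _ I I ij) ->//; rewrite preimage_set0.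
  + by move=> i; exact: mh.
  + apply: integrableS Wi => //; apply: bigcup_measurable => i _; exact: mh.
- by rewrite -measurable_prod_measurableType.
Qed.

End rectangles.

Section independence.
Context d (T : measurableType d) (R : realType) (P : probability T R).

Definition indep2 d1 d2 (T1 : measurableType d1) (T2 : measurableType d2)
    (X : T -> T1) (Y : T -> T2) :=
  forall A B, measurable A -> measurable B ->
    P (X @^-1` A `&` Y @^-1` B) = (P (X @^-1` A) * P (Y @^-1` B))%E.

Lemma indep2_comp d1 d2 d3 d4 (T1 : measurableType d1) (T2 : measurableType d2)
    (T3 : measurableType d3) (T4 : measurableType d4)
    (X : T -> T1) (Y : T -> T2) (f : T1 -> T3) (g : T2 -> T4) :
  measurable_fun setT f -> measurable_fun setT g ->
  indep2 X Y -> indep2 (f \o X) (g \o Y).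
Proof.
move=> mf mg XY A B mA mB; apply: (XY (f @^-1` A) (g @^-1` B)).
  by rewrite -[X in measurable X]setTI; exact: mf.
by rewrite -[X in measurable X]setTI; exact: mg.
Qed.

Lemma indep2_sym d1 d2 (T1 : measurableType d1) (T2 : measurableType d2)
    (X : T -> T1) (Y : T -> T2) : indep2 X Y -> indep2 Y X.
Proof. by move=> XY A B mA mB; rewrite setIC XY// muleC. Qed.

Lemma indep2_law d1 d2 (T1 : measurableType d1) (T2 : measurableType d2)
    (X : {mfun T >-> T1}) (Y : {mfun T >-> T2})
    (XY : {mfun T >-> (T1 * T2)%type}) :
  XY =1 (fun w => (X w, Y w)) -> indep2 X Y -> forall D, measurable D ->
  (distribution P X \x distribution P Y)%E D = distribution P XY D.
Proof.
move=> eXY iXY D mD; apply: product_measure_unique => // A B mA mB.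
transitivity (P (X @^-1` A `&` Y @^-1` B)); last exact: iXY.
by congr (P _); apply/seteqP; split => w /=; rewrite eXY.
Qed.

(** On the product law, Tonelli turns the integral of |x y| into E|X| E|Y|, whence integrability;
    Fubini then factors the mean. *)
Lemma indep2M_mfun (X Y : {mfun T >-> R}) : intg P X -> intg P Y ->
  indep2 X Y -> intg P (fun w => X w * Y w) /\
  mean P (fun w => X w * Y w) = mean P X * mean P Y.
Proof.
move=> Xi Yi iXY.
have mXY : measurable_fun setT (fun w => (X w, Y w)).
  exact: measurable_fun_pair.
pose XY := mfun_of mXY.
have law := @indep2_law _ _ _ _ X Y XY (fun=> erefl) iXY.
have X'i : (distribution P X).-integrable setT (fun x => x%:E).
  by apply: integrable_pushforward => //; exact/measurable_EFinP.
have Y'i : (distribution P Y).-integrable setT (fun x => x%:E).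
  by apply: integrable_pushforward => //; exact/measurable_EFinP.
have mM : measurable_fun setT (fun z : R * R => z.1 * z.2).
  by apply: measurable_funM.
pose F := fun z : R * R => (z.1 * z.2)%:E.
have mF : measurable_fun setT F by exact/measurable_EFinP.
have FXY : (distribution P X \x distribution P Y)%E.-integrable setT F.
  apply/integrable12ltyP => //=.
  under eq_integral do under eq_integral do rewrite /F /= normrM EFinM.
  under eq_integral => x _.
    rewrite (integralZl measurableT (f := fun y : R => `|y|%:E)); last first.
      exact: integrable_norm Y'i.
    over.
  rewrite /=.
  have [fY finY] : exists c, (\int[distribution P Y]_x `|x|%:E)%E = c%:E.
    exists (fine (\int[distribution P Y]_x `|x|%:E)%E).
    by rewrite fineK// integrable_fin_num//; exact: (integrable_norm Y'i).
  rewrite finY (integralZr measurableT (f := fun y : R => `|y|%:E)); last first.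
    exact: integrable_norm X'i.
  apply: lte_mul_pinfty => //.
  - exact: integral_ge0.
  - by apply: integrable_fin_num => //; exact: (integrable_norm X'i).
  - by rewrite ltry.
have eqI G : (\int[distribution P XY]_z G z =
    \int[distribution P X \x distribution P Y]_z G z)%E.
  by apply: eq_measure_integral => A mA _; exact/esym/law.
have FXYd : (distribution P XY).-integrable setT F.
  apply/integrableP; split => //; rewrite eqI.
  by case/integrableP : FXY.
have Fi : intg P (fun w => X w * Y w).
  apply/integrableP; split.
    by apply/measurable_EFinP; exact: measurable_funM.
  case/integrableP : FXYd => _; rewrite ge0_integral_distribution//.
  exact: measurableT_comp.
split => //; apply: EFin_inj; rewrite -meanE//.
transitivity (\int[distribution P XY]_z F z)%E.
  by rewrite integral_distribution.
rewrite eqI -integral12_prod_meas1// /fubini_F /F /=.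
under eq_integral => x _.
  under eq_integral do rewrite EFinM.
  rewrite (integralZl measurableT (f := fun y : R => y%:E))//; over.
rewrite /= (_ : (\int[distribution P Y]_x x%:E)%E = (mean P Y)%:E); last first.
  by rewrite integral_distribution// meanE.
rewrite (integralZr measurableT (f := fun y : R => y%:E))// integral_distribution//=.
by rewrite meanE.
Qed.

Lemma indep2M (X Y : T -> R) : intg P X -> intg P Y -> indep2 X Y ->
  intg P (fun w => X w * Y w) /\
  mean P (fun w => X w * Y w) = mean P X * mean P Y.
Proof.
move=> Xi Yi iXY; have mX := intg_meas Xi; have mY := intg_meas Yi.
exact: (@indep2M_mfun (mfun_of mX) (mfun_of mY)).
Qed.

End independence.

Section independent_events.
Context d (T : measurableType d) (R : realType) (P : probability T R).

Lemma measurable_preimage d' (T' : measurableType d') (X : T -> T') A :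
  measurable_fun setT X -> measurable A -> measurable (X @^-1` A).
Proof. by move=> mX mA; rewrite -[X in measurable X]setTI; exact: mX. Qed.

Lemma mean_dct (f_ : nat -> T -> R) (f g : T -> R) :
  (forall n, measurable_fun setT (f_ n)) -> intg P g ->
  (forall n w, `|f_ n w| <= g w) ->
  (forall w, f_ n w @[n --> \oo] --> f w) ->
  intg P f /\ mean P (f_ n) @[n --> \oo] --> mean P f.
Proof.
move=> mf gi fg cf.
have mf' : measurable_fun setT f.
  by apply: (measurable_fun_cvg mf) => w _; exact: cf.
have fi n : intg P (f_ n) by exact: intg_le (mf n) gi (fg n).
have [|||||fi' _ H] := @dominated_convergence _ _ _ P setT measurableT
  (fun n => EFin \o f_ n) (EFin \o f) (EFin \o g).
- by move=> n; exact/measurable_EFinP.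
- exact/measurable_EFinP.
- by apply: aeW => w _; apply: cvg_EFin; [exact: nearW|exact: cf].
- exact: gi.
- by apply: aeW => w n _; rewrite lee_fin.
split => //.
rewrite (_ : (fun _ => _) = fine \o (fun n => (\int[P]_w (f_ n w)%:E)%E))//.
by apply: fine_cvg; rewrite -meanE.
Qed.

(** The variable 1_E - P(E) is orthogonal to the indicators of rectangles in (X, Y), hence by
    [mean0_rectangles] to those of all measurable sets. *)
Lemma indep_event_pair d1 d2 (T1 : measurableType d1) (T2 : measurableType d2)
    (E : set T) (X : T -> T1) (Y : T -> T2) :
  measurable E -> measurable_fun setT X -> measurable_fun setT Y ->
  (forall A B, measurable A -> measurable B ->
    P (E `&` (X @^-1` A `&` Y @^-1` B)) = (P E * P (X @^-1` A `&` Y @^-1` B))%E) ->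
  forall D, measurable D ->
    P (E `&` [set w | D (X w, Y w)]) = (P E * P [set w | D (X w, Y w)])%E.
Proof.
move=> mE mX mY EXY D mD.
have key F : measurable F ->
  (mean P (fun w => (\1_E w - mean P \1_E) * \1_F w))%:E =
    (P (E `&` F) - P E * P F)%E.
  move=> mF; rewrite !mean_indic//; last exact: measurableI.
  have Ei A : measurable A -> intg P \1_A by move=> mA; exact: integrable_indic.
  rewrite -EFinM -EFinB -meanZ; last exact: Ei.
  rewrite -meanB; last 2 first.
  - by apply: Ei; exact: measurableI.
  - by apply: intgZ; exact: Ei.
  by congr EFin; apply: eq_mean => w; rewrite indicI mulrBl.
have fin F : measurable F -> P F \is a fin_num by move=> mF; rewrite fin_num_measure.
have mXY : measurable_fun setT (fun w => (X w, Y w)) by exact: measurable_fun_pair.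
have mD' : measurable [set w | D (X w, Y w)] by exact: (measurable_preimage mXY).
have : mean P (fun w => (\1_E w - mean P \1_E) * \1_D (X w, Y w)) = 0.
  apply: mean0_rectangles => //.
    apply: intgB; last exact: intg_cst.
    exact: integrable_indic.
  move=> A B mA mB; have mF : measurable (X @^-1` A `&` Y @^-1` B).
    by apply: measurableI; exact: measurable_preimage.
  apply: EFin_inj; rewrite -[RHS](subee (fin _ (measurableI _ _ mE mF))).
  rewrite {2}EXY// -key//; congr EFin; apply: eq_mean => w.
  by rewrite indicI.
move=> D0; have /eqP := key _ mD'; rewrite {}D0 eq_sym.
rewrite sube_eq ?fin//; first by rewrite add0e => /eqP.
exact: measurableI.
Qed.

End independent_events.

(** * Integrals of variables with the same law *)

Section same_law.
Context d1 d2 d' (T1 : measurableType d1) (T2 : measurableType d2)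
  (T' : measurableType d') (R : realType).
Context (P : probability T1 R) (Q : probability T2 R).
Context (X : T1 -> T') (Y : T2 -> T').
Hypotheses (mX : measurable_fun setT X) (mY : measurable_fun setT Y).
Hypothesis XY : forall B, measurable B -> P (X @^-1` B) = Q (Y @^-1` B).

(** The two variables may live on different spaces: later one of them is an affine function on the
    line under N(0, 1). *)
Lemma same_law_integral (f : T' -> \bar R) : measurable_fun setT f ->
  (forall t, 0 <= f t)%E -> (\int[P]_w f (X w) = \int[Q]_w f (Y w))%E.
Proof.
move=> mf f0.
rewrite -(@ge0_integral_distribution _ _ _ _ _ P (mfun_of mX) f)//.
rewrite -(@ge0_integral_distribution _ _ _ _ _ Q (mfun_of mY) f)//.
by apply: eq_measure_integral => A mA _; exact: XY.
Qed.

Lemma same_law_intg (f : T' -> R) : measurable_fun setT f ->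
  intg Q (f \o Y) -> intg P (f \o X).
Proof.
move=> mf /integrableP[_ fi]; apply/integrableP; split.
  by apply/measurable_EFinP; exact: measurableT_comp.
move: fi; rewrite -(same_law_integral (f := fun t => `|(f t)%:E|%E))//.
by apply: measurableT_comp => //; exact/measurable_EFinP.
Qed.

Lemma same_law_mean (f : T' -> R) : measurable_fun setT f ->
  mean P (f \o X) = mean Q (f \o Y).
Proof.
move=> mf; congr fine; rewrite integralE [RHS]integralE; congr (_ - _)%E.
  under eq_integral do rewrite (funepos_comp (EFin \o f) X).
  under [RHS]eq_integral do rewrite (funepos_comp (EFin \o f) Y).
  by apply: (same_law_integral (f := (EFin \o f)^\+%E)) => //; exact/measurable_funepos/measurable_EFinP.
under eq_integral do rewrite (funeneg_comp (EFin \o f) X).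
under [RHS]eq_integral do rewrite (funeneg_comp (EFin \o f) Y).
by apply: (same_law_integral (f := (EFin \o f)^\-%E)) => //; exact/measurable_funeneg/measurable_EFinP.
Qed.

End same_law.

(** * The strong law of large numbers *)

Section maxsum.
Context (R : realType).
Implicit Types (u : nat -> R).

(* The largest of the partial sums u_i + ... + u_(i+n-1), 0 <= n <= N. *)
Fixpoint maxsum u (N i : nat) : R :=
  if N is N'.+1 then Num.max 0 (u i + maxsum u N' i.+1) else 0.

Lemma maxsum_ge0 u N i : 0 <= maxsum u N i.
Proof. by case: N => //= N; rewrite le_max lexx. Qed.

Lemma maxsumS u N i : maxsum u N i <= maxsum u N.+1 i.
Proof.
elim: N i => [|N IH] i; first exact: maxsum_ge0.
by rewrite [leLHS]/= [leRHS]/= ge_max !le_max lexx /= lerD2l IH orbT.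
Qed.

Lemma sum_le_maxsum u N i : \sum_(i <= j < i + N) u j <= maxsum u N i.
Proof.
elim: N i => [|N IH] i; first by rewrite addn0 big_geq.
rewrite /= le_max big_ltn ?addnS ?ltnS ?leq_addr// -addSn lerD2l.
by rewrite IH orbT.
Qed.

Lemma maxsum_le u N i : maxsum u N i <= \sum_(i <= j < i + N) `|u j|.
Proof.
elim: N i => [|N IH] i; first by rewrite addn0 big_geq.
rewrite /= ge_max big_ltn ?addnS ?ltnS ?leq_addr// -addSn.
rewrite lerD ?IH ?ler_norm// andbT addr_ge0// sumr_ge0//.
Qed.

(** With m = M N 1 and v = X 0 the difference is the function [g] of Garsia's argument. This bound
    dominates it; the next two lemmas give its values v for m large and 0 for K large. *)
Lemma posB_diff_le (K m v : R) : 0 <= m ->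
  `|Num.max 0 (Num.max 0 (v + m) - K) - Num.max 0 (m - K)| <= `|v|.
Proof.
move=> m0; rewrite ler_norml /Num.max.
case: (ltP 0 (v + m)) => h1; case: (ltP _ _) => h2; case: (ltP _ _) => h3;
  case: (ger0P v) => h4; apply/andP; split; lra.
Qed.

Lemma posB_diff_big (K m v : R) : 0 <= K -> K + `|v| < m ->
  Num.max 0 (Num.max 0 (v + m) - K) - Num.max 0 (m - K) = v.
Proof.
rewrite /Num.max => K0; case: (ger0P v) => h4 Km;
case: (ltP 0 (v + m)) => h1; case: (ltP _ _) => h2; case: (ltP _ _) => h3; lra.
Qed.

Lemma posB_diff_small (K m v : R) : 0 <= m -> m + `|v| < K ->
  Num.max 0 (Num.max 0 (v + m) - K) - Num.max 0 (m - K) = 0.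
Proof.
rewrite /Num.max => K0; case: (ger0P v) => h4 Km;
case: (ltP 0 (v + m)) => h1; case: (ltP _ _) => h2; case: (ltP _ _) => h3; lra.
Qed.

End maxsum.

Section slln.
Context d (T : measurableType d) (R : realType) (P : probability T R).
Variable X : nat -> T -> R.
Hypothesis mX : forall i, measurable_fun setT (X i).
Hypothesis iX : mutually_independent P (fun i => sigma_of (X i)).
Hypothesis lX : forall i, same_law P (X i) (X 0).

Local Notation M N i := (fun w => maxsum (X^~ w) N i).

Let measurable_maxsum N i : measurable_fun setT (M N i).
Proof.
elim: N i => [|N IH] i //=.
by apply: measurable_maxr => //; exact: measurable_funD.
Qed.

(** The recursion of [maxsum]: M N.+1 i is [step] of the pair (X i, M N i.+1), so laws and
    independence propagate by induction on N. *)
Let step (p : R * R) : R := Num.max 0 (p.1 + p.2).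

Let measurable_step : measurable_fun setT step.
Proof. by apply: measurable_maxr => //; exact: measurable_funD. Qed.

(** Induction on N for all i and J at once. By [indep_event_pair] it is enough to consider
    rectangles in (X i, M N i.+1), and there the event on X i can join the past. *)
Let indep_past N i (J : {fset nat}) (A : nat -> set T) (B : set R) :
  (forall j, j \in J -> (j < i)%N) ->
  (forall j, j \in J -> sigma_of (X j) (A j)) -> measurable B ->
  P ((\bigcap_(j in [set` J]) A j) `&` M N i @^-1` B) =
    ((\prod_(j <- J) P (A j)) * P (M N i @^-1` B))%E.
Proof.
have mA' (K : {fset nat}) (A' : nat -> set T) :
    (forall j, j \in K -> sigma_of (X j) (A' j)) ->
    measurable (\bigcap_(j in [set` K]) A' j).
  move=> KA; rewrite bigcap_fset big_seq.
  elim/big_ind: _ => // [S S'|j jK]; first exact: measurableI.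
  by have [C mC <-] := KA _ jK; rewrite setTI; exact: measurable_preimage.
elim: N i J A B => [|N IH] i J A B Ji JA mB.
  rewrite -iX//; have [B0|B0] := pselect (B 0).
    rewrite (_ : _ @^-1` B = setT) ?probability_setT ?setIT ?mule1//.
    by apply/seteqP; split.
  rewrite (_ : _ @^-1` B = set0) ?measure0 ?setI0 ?measure0 ?mule0//.
  by apply/seteqP; split.
have mD : measurable (step @^-1` B) by exact: measurable_preimage.
rewrite -iX//.
apply: (indep_event_pair (E := \bigcap_(j in [set` J]) A j) (X := X i)
  (Y := M N i.+1) _ _ _ _ mD) => // [|A0 B0 mA0 mB0]; first exact: mA'.
have EJ := iX JA.
have iJ : i \notin J by apply/negP => /Ji; rewrite ltnn.
(* The event on X i is added to the family over J; all indices are then below i.+1, as the induction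
   hypothesis requires. *)
pose A' j := if j == i then X i @^-1` A0 else A j.
have A'J j : j \in (i |` J)%fset -> sigma_of (X j) (A' j).
  rewrite !inE /A'; have [->{j} _|_ /=] := eqVneq j i; last exact: JA.
  by exists A0 => //; rewrite setTI.
have A'lt j : j \in (i |` J)%fset -> (j < i.+1)%N.
  by rewrite !inE => /predU1P[->//|/Ji /ltnW].
have := IH _ _ _ _ A'lt A'J mB0.
have Aeq j : j \in J -> A' j = A j.
  by rewrite /A'; case: eqVneq => // -> ; rewrite (negbTE iJ).
rewrite set_fsetU1 bigcap_setU1 big_fsetU1//= {1 3}/A' eqxx.
have -> : \bigcap_(j in [set` J]) A' j = \bigcap_(j in [set` J]) A j.
  by apply: eq_bigcapr => j /= /Aeq.
rewrite [in RHS](eq_big_seq (fun j => P (A j))) => [|j jJ]; last by rewrite Aeq.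
rewrite EJ setIA [_ `&` X i @^-1` A0]setIC => ->.
(* A second use, with X i as the whole past, splits the probability of the rectangle itself. *)
have := IH i.+1 [fset i]%fset (fun=> X i @^-1` A0) B0.
rewrite set_fset1 bigcap_set1 big_seq_fset1 => ->//; last 2 first.
- by move=> j; rewrite inE => /eqP ->.
- by move=> j; rewrite inE => /eqP ->; exists A0 => //; rewrite setTI.
by rewrite muleCA muleA.
Qed.

Let pair_meas N i : measurable_fun setT (fun w => (X i w, M N i.+1 w)).
Proof. exact: measurable_fun_pair. Qed.

Let indep_now N i : indep2 P (X i) (M N i.+1).
Proof.
move=> A B mA mB.
have := @indep_past N i.+1 [fset i]%fset (fun=> X i @^-1` A) B.
rewrite set_fset1 bigcap_set1 big_seq_fset1; apply => //.
- by move=> j; rewrite inE => /eqP ->.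
- by move=> j; rewrite inE => /eqP ->; exists A => //; rewrite setTI.
Qed.

(** By independence the pairs (X i, M N i.+1) and (X j, M N j.+1) have product laws, with equal
    factors by induction; [step] maps them to the next maxima. *)
Let law_maxsum N i j : same_law P (M N i) (M N j).
Proof.
elim: N i j => [|N IH] i j B mB //.
have mD : measurable (step @^-1` B) by exact: measurable_preimage.
apply: (@measure_eq_rectangles _ _ _ _ _
  (distribution P (mfun_of (pair_meas N i)))
  (distribution P (mfun_of (pair_meas N j)))) mD => [|A C mA mC].
  by rewrite -ge0_fin_numE ?fin_num_measure.
transitivity (P (X i @^-1` A `&` M N i.+1 @^-1` C)) => //.
transitivity (P (X j @^-1` A `&` M N j.+1 @^-1` C)) => //.
by rewrite !indep_now// (IH i.+1 j.+1)// lX// -(lX j).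
Qed.

Hypothesis X0i : intg P (X 0).

Let Xi i : intg P (X i).
Proof. exact: (same_law_intg (mX i) (mX 0) (lX i) (f := id)). Qed.

Let maxsum_intg N i : intg P (M N i).
Proof.
apply: (intg_le (g := fun w => \sum_(i <= j < i + N) `|X j w|)) => // [|w].
  by apply: intg_sum => j; exact: intg_norm.
by rewrite ger0_norm ?maxsum_ge0// maxsum_le.
Qed.

(* Garsia's argument: max 0 (m - K) has a larger mean at m = M N.+1 0 than at
   m = M N 1, which is distributed as M N 0; letting N and then K go to infinity
   gives 0 <= E[X 0; A'], where A' is independent of X 0. *)
Let g (K : R) N w : R :=
  Num.max 0 (M N.+1 0%N w - K) - Num.max 0 (M N 1%N w - K).

Let posB_meas (K : R) : measurable_fun setT (fun m : R => Num.max 0 (m - K)).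
Proof. by apply: measurable_maxr => //; exact: measurable_funB. Qed.

Let posB_intg K N i : intg P (fun w => Num.max 0 (M N i w - K)).
Proof.
apply: (intg_le (g := fun w => `|M N i w - K|)).
- exact: (measurableT_comp (posB_meas K)).
- by apply: intg_norm; apply: intgB => //; exact: intg_cst.
- by move=> w; rewrite /Num.max; case: ltP => h; rewrite ?normr0// ger0_norm// ltW.
Qed.

Let g_mean K N : 0 <= mean P (g K N).
Proof.
rewrite meanB; [|exact: posB_intg|exact: posB_intg].
rewrite subr_ge0.
rewrite -(same_law_mean _ _ (law_maxsum N 0 1) (posB_meas K))//.
apply: le_mean; [exact: posB_intg|exact: posB_intg|move=> w /=].
by rewrite ge_max !le_max lexx /= lerB ?orbT//; exact: maxsumS.
Qed.

(** The event that the sums X 1 + ... + X n are unbounded above. It involves only indices from 1 on,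
    hence its independence of X 0. *)
Let A' := [set w | forall K : nat, exists N, K%:R < M N 1%N w].

Let M_nd w : nondecreasing_seq (fun N => M N 1%N w).
Proof. by apply/nondecreasing_seqP => N; exact: maxsumS. Qed.

Let g_le K N w : `|g K N w| <= `|X 0 w|.
Proof. by apply: posB_diff_le; exact: maxsum_ge0. Qed.

Let not_A' w : ~ A' w -> exists b, forall N, M N 1%N w <= b.
Proof.
move=> /existsNP[K /forallNP KN]; exists K%:R => N.
by rewrite leNgt; apply/negP/KN.
Qed.

Let A'_near w (b : R) : A' w -> \forall N \near \oo, b < M N 1%N w.
Proof.
move=> Aw; have [N KN] := Aw (Num.truncn b).+1.
exists N => // n /= Nn; apply: lt_le_trans (M_nd w Nn); apply: lt_trans KN.
by rewrite truncnS_gt.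
Qed.

Let g_near w K : 0 <= K -> A' w -> \forall N \near \oo, g K N w = X 0 w.
Proof.
move=> K0 Aw; have := A'_near (K + `|X 0 w|) Aw.
by apply: filterS => N h; rewrite /g /= posB_diff_big.
Qed.

Let g_cvg K w : 0 <= K -> cvgn (fun N => g K N w).
Proof.
move=> K0; have [Aw|nAw] := pselect (A' w).
  by apply/cvg_ex; exists (X 0 w); apply: cvg_near_cst; exact: g_near.
have [b Mb] := not_A' nAw.
have cM : cvgn (fun N => M N 1%N w).
  apply: nondecreasing_is_cvgn; first exact: M_nd.
  by exists b => _ [N _ <-].
have cmax (u : nat -> R) : cvgn u -> cvgn (fun N => Num.max 0 (u N)).
  move=> /cvg_ex[l ul]; apply/cvg_ex; exists (Num.max 0 l).
  apply: (cvg_comp _ (Num.max 0) ul).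
  apply: (@continuous_max _ R^o (cst 0) id l); first exact: cvg_cst.
  exact: cvg_id.
have cM' : cvgn (fun N => M N.+1 0%N w).
  by apply: (cmax _ (is_cvgD _ cM)); exact: is_cvg_cst.
by apply: is_cvgB; apply: (cmax _ (is_cvgB _ _)) => //; exact: is_cvg_cst.
Qed.

Let L (K : nat) w := limn (fun N => g K%:R N w).

Let L_le K w : `|L K w| <= `|X 0 w|.
Proof.
have h := @g_cvg K%:R w (ler0n _ _).
rewrite /L -lim_norm//; apply: limr_le; first exact: is_cvg_norm.
by apply: nearW => N; exact: g_le.
Qed.

(** On A' every [L K] is already X 0, since the maxima pass any level; off A' they stay below some
    b, and [L K] vanishes once K exceeds b + |X 0|. The limit in N has to be taken before the one in
    K. *)
Let L_cvg w : L K w @[K --> \oo] --> X 0 w * \1_A' w.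
Proof.
have [Aw|nAw] := pselect (A' w).
  rewrite indicE mem_set// mulr1; apply: cvg_near_cst.
  by apply: nearW => K; apply/cvg_lim => //; apply: cvg_near_cst; exact: g_near.
rewrite indicE memNset// mulr0.
have [b Mb] := not_A' nAw.
apply: cvg_near_cst.
exists (Num.truncn (b + `|X 0 w|)).+1 => // K /= bK.
apply/cvg_lim => //; apply: cvg_near_cst; apply: nearW => N.
rewrite /g /= posB_diff_small//; first exact: maxsum_ge0.
rewrite (le_lt_trans (lerD (Mb N) (lexx _)))//.
by apply: lt_le_trans (truncnS_gt _) _; rewrite ler_nat.
Qed.

Let mean_A'_ge0 : 0 <= mean P (fun w => X 0 w * \1_A' w).
Proof.
have mg K N : measurable_fun setT (g K N).
  by apply: measurable_funB; exact: (measurableT_comp (posB_meas K)).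
have X0n := intg_norm X0i.
have Lm K : measurable_fun setT (L K).
  by apply: (measurable_fun_cvg (mg K%:R)) => w _; exact: g_cvg.
have [_ c1] := mean_dct Lm X0n L_le L_cvg.
have L0 K : 0 <= mean P (L K).
  have [_ c2] := mean_dct (mg K%:R) X0n (g_le K%:R) (fun w => @g_cvg K%:R w (ler0n _ K)).
  rewrite -(cvg_lim _ c2)//; apply: limr_ge; first by apply/cvg_ex; eexists; exact: c2.
  by apply: nearW => N; exact: g_mean.
rewrite -(cvg_lim _ c1)//; apply: limr_ge; first by apply/cvg_ex; eexists; exact: c1.
exact: nearW.
Qed.

Let E_ K N := [set w | K%:R < M N 1%N w].

Let E_meas (K N : nat) : measurable (E_ K N).
Proof.
by rewrite -[E_ K N]setTI; exact: measurable_fun_ltr.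
Qed.

(** A' is the intersection over K of the unions over N of [E_ K N], increasing in N and decreasing
    in K. Each [E_ K N] is independent of X 0, and this double limit carries the product formula
    over to A'; it is applied with V = X 0 and V = 1. *)
Let indic_cvg (V : T -> R) : intg P V ->
  exists a : nat -> R,
    [/\ forall K, mean P (fun w => V w * \1_(E_ K N) w) @[N --> \oo] --> a K,
        a K @[K --> \oo] --> mean P (fun w => V w * \1_A' w) & measurable A'].
Proof.
move=> Vi; have Vn := intg_norm Vi.
have bnd (A : set T) w : `|V w * \1_A w| <= `|V w|.
  by rewrite normrM ler_piMr// indicE; case: (_ \in _); rewrite ?normr1 ?normr0.
pose EK (K : nat) := \bigcup_N E_ K N.
have mEK K : measurable (EK K) by exact: bigcup_measurable.
have A'E : A' = \bigcap_K EK K.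
  apply/seteqP; split => [w Aw K _|w Aw K].
    by have [N] := Aw K; exists N.
  by have [N _] := Aw K I; exists N.
have mV := intg_meas Vi.
exists (fun K => mean P (fun w => V w * \1_(EK K) w)); split.
- move=> K; apply: (mean_dct _ Vn _ _).2 => // [N|w].
    exact: measurable_funM.
  have [[N _ KN]|nE] := pselect (EK K w).
    apply: cvg_near_cst; exists N => // n /= Nn.
    rewrite !indicE !mem_set//; first by exists N.
    exact: (lt_le_trans KN (M_nd w Nn)).
  apply: cvg_near_cst; apply: nearW => N; rewrite !indicE !memNset//.
  by move=> KN; apply: nE; exists N.
- apply: (mean_dct _ Vn _ _).2 => // [K|w].
    exact: measurable_funM.
  have [Aw|nAw] := pselect (A' w).
    apply: cvg_near_cst; apply: nearW => K; rewrite !indicE !mem_set//.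
    by have [N] := Aw K; exists N.
  have [K nK] : exists K, ~ EK K w.
    by apply/existsNP => h; apply: nAw; rewrite A'E => K _.
  apply: cvg_near_cst; exists K => // K' /= KK'; rewrite !indicE !memNset//.
  move=> [N _ h]; apply: nK; exists N => //.
  by apply: le_lt_trans h; rewrite ler_nat.
- by rewrite A'E; exact: bigcapT_measurable.
Qed.

(** Garsia's inequality and independence give 0 <= E[X 0; A'] = E[X 0] P(A'), so a negative mean
    forces P(A') = 0. *)
Lemma partial_sums_bounded : mean P (X 0) < 0 ->
  {ae P, forall w, exists b : R, forall n, \sum_(1 <= i < n.+1) X i w <= b}.
Proof.
move=> m0.
have [a [a1 a2 mA']] := indic_cvg X0i.
have [b [b1 b2 _]] := indic_cvg (intg_cst P 1).
have ab K : a K = mean P (X 0) * b K.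
  apply: (cvg_unique _ (a1 K)) => //.
  rewrite (_ : (fun N => _) = (fun N => mean P (X 0) * mean P (fun w => 1 * \1_(E_ K N) w))).
    by apply: cvgM; [exact: cvg_cst|exact: b1].
  apply/funext => N.
  have mI : measurable_fun setT (\1_[set m : R | K%:R < m] : R -> R).
    apply: measurable_indic; rewrite -[X in measurable X]setTI.
    exact: measurable_fun_ltr.
  have iE : indep2 P (X 0) (\1_[set m : R | K%:R < m] \o M N 1%N : T -> R).
    exact: (indep2_comp (@measurable_id _ R setT) mI (indep_now N 0)).
  have EE : \1_[set m : R | K%:R < m] \o M N 1%N = \1_(E_ K N) :> (T -> R).
    by apply/funext => w.
  rewrite EE in iE.
  have [_ ->] := indep2M X0i (integrable_indic P (E_meas K N)) iE.
  by congr (_ * _); apply: eq_mean => w; rewrite mul1r.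
have {}ab : mean P (fun w => X 0 w * \1_A' w) =
    mean P (X 0) * mean P (fun w => 1 * \1_A' w).
  apply: (cvg_unique _ a2) => //; rewrite (funext ab).
  by apply: cvgM; [exact: cvg_cst|exact: b2].
have PA' : P A' = 0%E.
  rewrite mean_indic//; congr EFin.
  have e1 : mean P (fun w => 1 * \1_A' w) = mean P \1_A'.
    by apply: eq_mean => w; rewrite mul1r.
  have : 0 <= mean P \1_A'.
    by rewrite -lee_fin -mean_indic.
  by have := mean_A'_ge0; rewrite ab e1; nra.
exists A'; split => // w nb; apply: contrapT => /not_A'[b' Mb]; apply: nb.
by exists b' => n; apply: le_trans (Mb n); exact: sum_le_maxsum.
Qed.

End slln.

Section slln_theorem.
Context d (T : measurableType d) (R : realType) (P : probability T R).

Lemma mutually_independent_sub (I : choiceType) (F G : I -> set_system T) :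
  (forall i, F i `<=` G i) -> mutually_independent P G ->
  mutually_independent P F.
Proof. by move=> FG iG J A JA; apply: iG => i /JA; exact: FG. Qed.

Lemma sigma_of_comp d1 d2 (T1 : measurableType d1) (T2 : measurableType d2)
    (X : T -> T1) (f : T1 -> T2) : measurable_fun setT f ->
  sigma_of (f \o X) `<=` sigma_of X.
Proof.
move=> mf _ [B mB <-]; exists (f @^-1` B) => //.
exact: measurable_preimage.
Qed.

Lemma same_law_comp d1 d2 (T1 : measurableType d1) (T2 : measurableType d2)
    (X Y : T -> T1) (f : T1 -> T2) : measurable_fun setT f ->
  same_law P X Y -> same_law P (f \o X) (f \o Y).
Proof. by move=> mf XY B mB; exact: (XY _ (measurable_preimage mf mB)). Qed.

(** The sums of f - (m + 1/(j+1)), whose mean is negative, are bounded above. Countably many j keep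
    the exceptional set null. *)
Let upper_bound d' (T' : measurableType d') (X : nat -> T -> T') (f : T' -> R) :
  (forall i, measurable_fun setT (X i)) ->
  mutually_independent P (fun i => sigma_of (X i)) ->
  (forall i, same_law P (X i) (X 0)) ->
  measurable_fun setT f -> intg P (f \o X 0) ->
  {ae P, forall w, forall j, exists b : R, forall n,
    \sum_(1 <= i < n.+1) f (X i w) <= n%:R * (mean P (f \o X 0) + j.+1%:R^-1) + b}.
Proof.
move=> mX iX lX mf fi; apply: ae_foralln => j.
set m := mean _ _.
pose h t := f t - (m + j.+1%:R^-1).
have mh : measurable_fun setT h by exact: measurable_funB.
have hi : intg P (h \o X 0) by apply: intgB => //; exact: intg_cst.
have [i|||||N [mN N0 hN]] := @partial_sums_bounded _ _ _ P (fun i => h \o X i).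
- exact: measurableT_comp.
- by apply: mutually_independent_sub iX => i; exact: sigma_of_comp.
- by move=> i; exact: same_law_comp.
- exact: hi.
- rewrite meanB//; last exact: intg_cst.
  by rewrite mean_cst -/m opprD addNKr oppr_lt0 invr_gt0.
exists N; split => // w nb; apply: hN => -[b hb]; apply: nb; exists b => n.
have := hb n; rewrite /h /= sumrB sumr_const_nat subSS subn0 -[_ *+ n]mulr_natl.
by rewrite lerBlDl.
Qed.

(** The upper bounds for f and for - f, divided by n, enclose the sample mean. The variables take
    values in an arbitrary space, so that one sequence of observations yields the limits of all
    empirical moments. *)
Theorem strong_law d' (T' : measurableType d') (X : nat -> T -> T') (f : T' -> R) :
  (forall i, measurable_fun setT (X i)) ->
  mutually_independent P (fun i => sigma_of (X i)) ->
  (forall i, same_law P (X i) (X 0)) ->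
  measurable_fun setT f -> intg P (f \o X 0) ->
  {ae P, forall w, sample_mean (fun i => f (X i w) : R^o) n @[n --> \oo] -->
    mean P (f \o X 0)}.
Proof.
move=> mX iX lX mf fi.
have Nfi : intg P ((fun t => - f t) \o X 0).
  by apply: eq_intg (intgZ (-1) fi) => w /=; rewrite mulN1r.
have mN : mean P ((fun t => - f t) \o X 0) = - mean P (f \o X 0).
  rewrite -mulN1r -meanZ//; apply: eq_mean => w /=; by rewrite mulN1r.
have mNf : measurable_fun setT (fun t => - f t).
  by apply: measurableT_comp.
have H1 := upper_bound mX iX lX mf fi.
have H2 := upper_bound mX iX lX mNf Nfi.
apply: filterS2 H1 H2 => w H1 H2.
apply/cvgrPdist_le => eps eps0.
set m := mean P (f \o X 0).
have [j je] : exists j : nat, j.+1%:R^-1 <= eps / 2.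
  exists (Num.truncn (eps / 2)^-1); rewrite invf_ple ?posrE ?divr_gt0//.
  by rewrite ltW// truncnS_gt.
have [b1 B1] := H1 j; have [b2 B2] := H2 j.
(* From this n on the two additive constants, divided by n, contribute at most eps / 2. *)
exists (Num.truncn ((`|b1| + `|b2|) / (eps / 2))).+1 => // n /= bn.
have n0 : 0 < n%:R :> R by rewrite ltr0n (leq_trans _ bn).
have {}bn : `|b1| + `|b2| <= n%:R * (eps / 2).
  rewrite -ler_pdivrMr ?divr_gt0// ltW//.
  by apply: lt_le_trans (truncnS_gt _) _; rewrite ler_nat.
have := B1 n; have := B2 n; rewrite mN sumrN -/m.
rewrite /sample_mean; set S := \sum_(_ <= i < _) _ => h2 h1.
have nj : n%:R * j.+1%:R^-1 <= n%:R * (eps / 2) by rewrite ler_pM2l.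
rewrite -[_ *: _]/(n%:R^-1 * S).
have -> : m - n%:R^-1 * S = (n%:R * m - S) / n%:R.
  by rewrite mulrBl mulrAC mulfV ?gt_eqF// mul1r mulrC.
rewrite normrM normfV (ger0_norm (ler0n _ n)) ler_pdivrMr//.
have := ler_norm b1; have := ler_norm b2.
have := normr_ge0 b1; have := normr_ge0 b2.
have e2 : n%:R * (eps / 2) = eps * n%:R / 2 by rewrite mulrCA mulrA.
rewrite ler_norml; move: h1 h2 nj bn; rewrite !mulrDr mulrN e2.
move: (n%:R * m) (n%:R / _) (eps * _) (S : R) => A B C S'.
by move=> *; apply/andP; split; lra.
Qed.

End slln_theorem.

(** * Gaussian variables *)

Section density.
Context d (T : measurableType d) (R : realType).
Local Open Scope ereal_scope.
Import HBNNSimple.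

(** True for simple functions by linearity, then for f by monotone convergence on both sides. *)
Lemma ge0_integral_density (mu nu : {measure set T -> \bar R}) (p : T -> R)
    (f : T -> \bar R) :
  measurable_fun setT p -> (forall x, 0 <= p x)%R ->
  (forall A, measurable A -> nu A = \int[mu]_(x in A) (p x)%:E) ->
  measurable_fun setT f -> (forall x, 0 <= f x) ->
  \int[nu]_x f x = \int[mu]_x (f x * (p x)%:E).
Proof.
move=> mp p0 nuE mf f0.
have mpE : measurable_fun setT (EFin \o p) by exact/measurable_EFinP.
pose f_ := nnsfun_approx measurableT mf.
have cf x : EFin \o f_^~ x @ \oo --> f x by exact: cvg_nnsfun_approx.
transitivity (limn (fun n => \int[nu]_x (f_ n x)%:E)).
  rewrite -monotone_convergence//.
  - by apply: eq_integral => y _; apply/esym/cvg_lim => //; exact: cf.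
  - by move=> n; exact/measurable_EFinP/measurable_funP.
  - by move=> n y _; rewrite lee_fin.
  - by move=> y _ m n mn; rewrite lee_fin; exact/lefP/nd_nnsfun_approx.
rewrite [X in limn X](_ : _ = (fun n => \int[mu]_x ((f_ n x)%:E * (p x)%:E))).
  rewrite -monotone_convergence//; last 3 first.
    - move=> n; apply: emeasurable_funM => //.
      exact/measurable_EFinP/measurable_funP.
    - by move=> n x _ /=; rewrite mule_ge0// lee_fin.
    - move=> x _ m n mn; rewrite lee_wpmul2r ?lee_fin//.
      exact/lefP/nd_nnsfun_approx.
  apply: eq_integral => x _; apply/cvg_lim => //.
  by apply: cvgeZr => //; exact: cf.
apply/funext => n.
have mk r : measurable (f_ n @^-1` [set r]) by [].
transitivity (\sum_(k \in range (f_ n)) k%:E * nu (f_ n @^-1` [set k])).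
  under eq_integral do rewrite fimfunE -fsumEFin//.
  rewrite ge0_integral_fsum//; last 2 first.
  - by move=> y; exact/measurable_EFinP/measurable_funM.
  - by move=> y x _; rewrite nnfun_muleindic_ge0.
  apply: eq_fsbigr => r _; rewrite integralZl_indic_nnsfun// integral_indic//=.
  by rewrite setIT.
rewrite [RHS](eq_integral (fun x => \sum_(k \in range (f_ n))
    ((k * \1_(f_ n @^-1` [set k]) x)%:E * (p x)%:E))); last first.
  move=> x _; rewrite fimfunE -fsumEFin// ge0_mule_fsuml// => k.
  by rewrite nnfun_muleindic_ge0.
rewrite ge0_integral_fsum//; last 2 first.
- by move=> y; apply: emeasurable_funM => //; exact/measurable_EFinP/measurable_funM.
- by move=> y x _; rewrite mule_ge0 ?lee_fin// -lee_fin EFinM nnfun_muleindic_ge0.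
apply: eq_fsbigr => r /[!inE] -[x _ fx].
have r0 : (0 <= r)%R by rewrite -fx.
rewrite nuE// -ge0_integralZl//; last 2 first.
- exact: measurable_funTS.
- by move=> y _; rewrite lee_fin.
rewrite [LHS]integral_mkcond; apply: eq_integral => y _.
by rewrite patchE indicE; case: ifPn => yr; rewrite ?mulr1 ?mulr0 ?mul0e.
Qed.

End density.

Definition image_measure d1 d2 (T1 : measurableType d1) (T2 : measurableType d2)
    (R : realType) (mu : {measure set T1 -> \bar R}) (f : T1 -> T2)
    (mf : measurable_fun setT f) : {measure set T2 -> \bar R} :=
  measure_function_pushforward__canonical__measure_function_Measure mu mf.

Section lebesgue_affine.
Context (R : realType).
Notation lambda := (@lebesgue_measure R).

(** Lebesgue measure is determined by its values on half-open intervals. For a < 0 the preimage of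
    such an interval is closed on the other side, with the same length. *)
Lemma lebesgue_affine (a b : R) (A : set R) : a != 0 -> measurable A ->
  lambda A = (`|a|%:E * lambda ((fun x => (a * x + b)%R) @^-1` A))%E.
Proof.
move=> a0 mA.
have mh : @measurable_fun _ _ (measurableTypeR R) (measurableTypeR R) setT
    (fun x : R => a * x + b).
  by apply: measurable_funD => //; exact: measurable_funM.
pose c : {nonneg R} := NngNum (normr_ge0 a).
rewrite -[RHS]/(mscale c (image_measure lambda mh) A).
refine (@lebesgue_measure_unique R (mscale c (image_measure lambda mh)) _ A mA).
move=> X [[x y] _ <-{X}].
rewrite lebesgue_measure_itv/= lte_fin.
rewrite -[RHS]/(`|a|%:E * lambda ((fun x0 : R => a * x0 + b)%R @^-1` `]x, y]%classic))%E.
have [a_gt0|a_lt0] := ltrP 0 a.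
  have -> : (fun x0 : R => a * x0 + b) @^-1` `]x, y] =
      `](x - b) / a, (y - b) / a]%classic.
    apply/seteqP; split => t /=; rewrite !in_itv/= ltr_pdivrMr// ler_pdivlMr//;
    by rewrite ltrBlDr lerBrDr mulrC.
  rewrite lebesgue_measure_itv/= lte_fin ltr_pM2r ?invr_gt0// ltrD2r.
  case: ifPn => xy; last by rewrite mule0.
  by rewrite -EFinB -EFinB -EFinM gtr0_norm//; congr EFin; field.
have {}a_lt0 : a < 0 by rewrite lt_neqAle a0.
have -> : (fun x0 : R => a * x0 + b) @^-1` `]x, y] =
    `[(y - b) / a, (x - b) / a[%classic.
  apply/seteqP; split => t /=; rewrite !in_itv/= ltr_ndivlMr// ler_ndivrMr//;
  by rewrite ltrBlDr lerBrDr mulrC andbC.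
rewrite lebesgue_measure_itv/= lte_fin ltr_nM2r ?invr_lt0// ltrD2r.
case: ifPn => xy; last by rewrite mule0.
by rewrite -EFinB -EFinB -EFinM ltr0_norm//; congr EFin; field.
Qed.

Lemma ge0_integral_lebesgue_affine (a b : R) (f : R -> \bar R) : a != 0 ->
  measurable_fun setT f -> (forall x, 0 <= f x)%E ->
  (\int[lambda]_x f x = `|a|%:E * \int[lambda]_x f (a * x + b)%R)%E.
Proof.
move=> a0 mf f0.
have mh : @measurable_fun _ _ (measurableTypeR R) (measurableTypeR R) setT
    (fun x : R => a * x + b).
  by apply: measurable_funD => //; exact: measurable_funM.
pose c : {nonneg R} := NngNum (normr_ge0 a).
rewrite (eq_measure_integral (mscale c (image_measure lambda mh))); last first.
  by move=> A mA _; exact: lebesgue_affine.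
rewrite ge0_integral_mscale//; congr (_ * _)%E.
by rewrite ge0_integral_pushforward.
Qed.

End lebesgue_affine.

Section gaussian.
Context (R : realType).
Notation lambda := (@lebesgue_measure R).
Notation N01 := (@normal_prob R 0 1).

Lemma normal_pdf_affine (m s z : R) : s != 0 ->
  `|s| * normal_pdf m s (s * z + m) = normal_pdf 0 1 z.
Proof.
move=> s0; rewrite !normal_pdfE ?oner_eq0// /normal_peak mulrA; congr (_ * _).
  rewrite -mulrnAr sqrtrM ?sqr_ge0// sqrtr_sqr invfM mulrA mulfV ?normr_eq0//.
  by rewrite expr1n !mul1r.
by rewrite /normal_fun; congr expR; field.
Qed.

Let normal_probE (m s : R) (B : set R) :
  normal_prob m s B = (\int[lambda]_x (normal_pdf m s x * \1_B x)%:E)%E.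
Proof.
rewrite /normal_prob integral_mkcond; apply: eq_integral => x _.
by rewrite patchE indicE; case: ifPn; rewrite ?mulr1 ?mulr0.
Qed.

Lemma normal_prob_affine (m s : R) (B : set R) : s != 0 -> measurable B ->
  normal_prob m s B = N01 ((fun z => s * z + m) @^-1` B).
Proof.
move=> s0 mB.
have mf : measurable_fun setT (fun x => normal_pdf m s x * \1_B x).
  by apply: measurable_funM => //; exact: measurable_normal_pdf.
have f0 x : 0 <= normal_pdf m s x * \1_B x.
  by rewrite mulr_ge0 ?normal_pdf_ge0.
have mh : measurable_fun setT (fun x : R => s * x + m).
  by apply: measurable_funD => //; exact: measurable_funM.
rewrite !normal_probE (ge0_integral_lebesgue_affine m s0); last 2 first.
- exact/measurable_EFinP.
- by move=> x; rewrite lee_fin.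
rewrite -ge0_integralZl//; last 2 first.
- by apply/measurable_EFinP; exact: (measurableT_comp mf mh).
- by move=> x _; rewrite lee_fin.
by apply: eq_integral => z _; rewrite -EFinM mulrA normal_pdf_affine.
Qed.

(** Reflection is the affine map of scale -1, and the density depends on the scale through its
    square only. *)
Lemma normal_probN (B : set R) : measurable B ->
  N01 ((fun z => - z) @^-1` B) = N01 B.
Proof.
move=> mB; transitivity (normal_prob 0 (-1) B); last first.
  rewrite /normal_prob; apply: eq_integral => x _; congr EFin.
  by rewrite !normal_pdfE ?oner_eq0 ?oppr_eq0 ?oner_eq0// /normal_peak /normal_fun sqrrN.
have n1 : -1 != 0 :> R by rewrite oppr_eq0 oner_eq0.
rewrite (@normal_prob_affine 0 (-1) B n1 mB).
rewrite (_ : (fun z : R => -1 * z + 0) = (fun z => - z))//.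
by apply/funext => z; rewrite mulN1r addr0.
Qed.

Lemma ge0_integral_normal (m s : R) (f : R -> \bar R) :
  measurable_fun setT f -> (forall x, 0 <= f x)%E ->
  (\int[normal_prob m s]_x f x = \int[lambda]_x (f x * (normal_pdf m s x)%:E))%E.
Proof.
move=> mf f0; apply: ge0_integral_density => //.
- exact: measurable_normal_pdf.
- exact: normal_pdf_ge0.
Qed.

(** Completing the square: the exponential weight shifts the mean to a, which makes exp (a z)
    integrable under N(0, 1). *)
Lemma expR_normal_pdf (a z : R) :
  expR (a * z) * normal_pdf 0 1 z = expR (a ^+ 2 / 2) * normal_pdf a 1 z.
Proof.
rewrite !normal_pdfE ?oner_eq0// !(mulrCA (expR _)); congr (_ * _).
by rewrite /normal_fun -!expRD; congr expR; field.
Qed.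

Lemma normal_expR_intg (a : R) : intg N01 (fun z => expR (a * z)).
Proof.
have me : measurable_fun setT (fun z : R => expR (a * z)).
  by apply: measurableT_comp => //; exact: measurable_funM.
apply/integrableP; split; first exact/measurable_EFinP.
rewrite ge0_integral_normal//; last by do 2 apply: measurableT_comp => //.
under eq_integral do rewrite /= ger0_norm ?expR_ge0// -EFinM expR_normal_pdf EFinM.
rewrite ge0_integralZl//.
- by rewrite integral_normal_pdf mule1 ltry.
- apply/measurable_EFinP; exact: measurable_normal_pdf.
- by move=> x _; rewrite lee_fin normal_pdf_ge0.
Qed.

(** From |z|^n <= n! exp |z| <= n! (exp z + exp (- z)). *)
Lemma normal_power_intg n : intg N01 (fun z => z ^+ n).
Proof.
apply: (@intg_le _ _ _ N01 _ (fun z => n`!%:R * (expR (1 * z) + expR (-1 * z)))).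
- exact: measurable_funX.
- by apply: intgZ; apply: intgD; exact: normal_expR_intg.
move=> z; rewrite normrX.
have := expR_ge1Dxn n.-1 (normr_ge0 z).
case: n => [|n] /= h.
  rewrite expr0 fact0 mul1r.
  have [z0|z0] := leP 0 z.
    by rewrite !mul1r -[leLHS]addr0 lerD ?expR_ge0// -expR0 ler_expR.
  have ez : 1 <= expR (-1 * z) by rewrite mulN1r -expR0 ler_expR oppr_ge0 ltW.
  by rewrite !mul1r -[leLHS]add0r lerD ?expR_ge0.
have h1 : `|z| ^+ n.+1 <= n.+1`!%:R * expR `|z|.
  rewrite -ler_pdivrMl ?ltr0n ?fact_gt0// mulrC.
  by apply: le_trans h; rewrite lerDr.
apply: (le_trans h1); rewrite ler_pM2l ?ltr0n ?fact_gt0//.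
by case: ger0P => z0; rewrite mul1r mulN1r ?lerDl ?lerDr expR_ge0.
Qed.

Definition std_moment n := mean N01 (fun z : R => z ^+ n).

Lemma std_moment_odd n : odd n -> std_moment n = 0.
Proof.
move=> on; have mN : measurable_fun setT (fun z : R => - z) by exact: measurableT_comp.
have := @same_law_mean _ _ _ _ _ _ _ N01 N01 (fun z : R => - z) id mN
  (@measurable_id _ _ _) normal_probN (fun z => z ^+ n) (measurable_funX n (@measurable_id _ _ _)).
rewrite -[RHS]/(std_moment n) (_ : mean _ _ = - std_moment n).
  by move/eqP; rewrite eq_sym -addr_eq0 -mulr2n mulrn_eq0 /= => /eqP.
rewrite /std_moment -mulN1r -meanZ; last exact: normal_power_intg.
by apply: eq_mean => z /=; rewrite exprNn -signr_odd on.
Qed.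

Lemma normal_prob_set1 (z : R) : N01 [set z] = 0%E.
Proof.
have := @normal_prob_dominates R 0 1; move/null_content_dominatesP.
by apply; [exact: measurable_set1|exact: lebesgue_measure_set1].
Qed.

(** A null second moment would concentrate N(0, 1) on the point 0, which has probability 0. The
    moment is used as a divisor that recovers s^2 from a variance. *)
Lemma std_moment2_gt0 : 0 < std_moment 2.
Proof.
rewrite lt_neqAle; apply/andP; split; last first.
  rewrite -(@mean_cst _ _ _ N01 0); apply: le_mean => [||z].
  - exact: intg_cst.
  - exact: normal_power_intg.
  - exact: sqr_ge0.
apply/eqP => /esym e0.
have [N [mN N0 hN]] := mean0_ae (normal_power_intg 2) (fun z => sqr_ge0 z) e0.
have : (N01 setT <= N01 (N `|` [set (0 : R)%R]))%E.
  apply: le_measure; rewrite ?inE//; first exact: measurableU.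
  move=> z _; have [->|z0] := eqVneq z 0; [by right|left].
  by apply: hN => /= /eqP; rewrite sqrf_eq0 (negbTE z0).
apply/negP; rewrite -ltNge probability_setT.
have m0 : measurable ([set (0 : R)] : set (measurableTypeR R)) by exact: measurable_set1.
have h : (N01 (N `|` [set (0 : R)%R]) <= N01 N + N01 [set (0 : R)%R])%E.
  exact: measureU2.
by apply: (le_lt_trans h); rewrite N0 normal_prob_set1 adde0 lte01.
Qed.

End gaussian.

Section gaussian_variables.
Context d (T : measurableType d) (R : realType) (P : probability T R).
Notation N01 := (normal_prob 0 1 : probability (measurableTypeR R) R).
Implicit Types X Y : T -> R.

(* Dirac masses are included: they are the case s = 0. *)
Definition gaussian X := exists m s, forall B, measurable B ->
  P (X @^-1` B) = N01 ((fun z => s * z + m) @^-1` B).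

Lemma gaussian_lawP X : gaussian_law (pushforward P X) -> gaussian X.
Proof.
case=> [[m [s [s0 lX]]]|[m lX]].
  exists m, s => B mB; transitivity (normal_prob m s B); first exact: lX.
  exact: normal_prob_affine.
exists m, 0 => B mB; rewrite [LHS]lX// diracE.
have [Bm|Bm] := boolP (m \in B).
  rewrite (_ : _ @^-1` _ = setT) ?probability_setT//.
  apply/seteqP; split => // z _ /=; rewrite mul0r add0r; exact: set_mem.
rewrite (_ : _ @^-1` _ = set0) ?measure0//.
apply/seteqP; split => // z /=; rewrite mul0r add0r => /mem_set.
by rewrite (negbTE Bm).
Qed.

Lemma gaussian_affine X a b : gaussian X -> gaussian (fun w => a * X w + b).
Proof.
move=> [m [s lX]]; exists (a * m + b), (a * s) => B mB.
have mh : measurable_fun setT (fun x : R => a * x + b).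
  by apply: measurable_funD => //; exact: measurable_funM.
rewrite (lX _ (measurable_preimage mh mB)); congr (N01 _).
by apply/seteqP; split => z /=; rewrite mulrDr mulrA addrA.
Qed.

Let measurable_aff (s m : R) :
  @measurable_fun _ _ (measurableTypeR R) R setT (fun z : R => s * z + m).
Proof. by apply: measurable_funD => //; exact: measurable_funM. Qed.

Section moments.
Variables (X : T -> R) (m s : R).
Hypothesis mX : measurable_fun setT X.
Hypothesis lX : forall B, measurable B ->
  P (X @^-1` B) = N01 ((fun z => s * z + m) @^-1` B).

Let power_term n i : intg N01 (fun z => (m ^+ (n - i) * s ^+ i *+ 'C(n, i)) * z ^+ i).
Proof. by apply: intgZ; exact: normal_power_intg. Qed.

Let powerE n : (fun x => x ^+ n) \o (fun z => s * z + m) =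
  fun z => \sum_(i <- index_enum 'I_n.+1) (m ^+ (n - i) * s ^+ i *+ 'C(n, i)) * z ^+ i.
Proof.
apply/funext => z /=; rewrite addrC exprDn; apply: eq_bigr => i _.
by rewrite exprMn mulrnAl mulrA.
Qed.

Lemma gaussian_power_intg n : intg P (fun w => X w ^+ n).
Proof.
apply: (same_law_intg mX (measurable_aff s m) lX (f := fun x => x ^+ n)).
  exact: measurable_funX.
rewrite powerE; apply: intg_sum => i; exact: power_term.
Qed.

(* The odd moments of N(0, 1) vanish, so the moments of N(m, s^2) are polynomials
   in s^2; hence the halved exponent. *)
Definition moment_poly (a : R) n : {poly R} := \sum_(i < n.+1)
  (a ^+ (n - i) * std_moment R i *+ 'C(n, i)) *: 'X^(i./2).

Lemma gaussian_moment n : mean P (fun w => X w ^+ n) = (moment_poly m n).[s ^+ 2].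
Proof.
have mXn : measurable_fun setT (fun x : R => x ^+ n) by exact: measurable_funX.
rewrite -[LHS]/(mean P ((fun x => x ^+ n) \o X)).
rewrite (same_law_mean mX (measurable_aff s m) lX mXn).
rewrite powerE mean_sum; last by move=> i; exact: power_term.
rewrite /moment_poly horner_sum; apply: eq_bigr => i _.
rewrite meanZ; last exact: normal_power_intg.
rewrite -/(std_moment R i) hornerZ hornerXn -exprM mul2n.
have [oi|ei] := boolP (odd i); first by rewrite std_moment_odd// !mulr0 mul0rn mul0r.
rewrite even_halfK// !mulrnAl; congr (_ *+ _); ring.
Qed.

Lemma gaussian_mean : mean P X = m.
Proof.
have g1 : std_moment R 1 = 0 by exact: std_moment_odd.
have g0 : std_moment R 0 = 1.
  by rewrite /std_moment (eq_mean _ (g := fun=> 1)) ?mean_cst.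
have := gaussian_moment 1; rewrite /moment_poly !big_ord_recl big_ord0 /=.
rewrite -[bump 0 0]/1%N g1 g0 mulr0 mul0rn scale0r !addr0 subn0 expr1 mulr1.
rewrite bin0 mulr1n hornerZ hornerXn expr0 mulr1 => <-.
by apply: eq_mean => w; rewrite expr1.
Qed.

Lemma gaussian_variance :
  mean P (fun w => (X w - m) ^+ 2) = s ^+ 2 * std_moment R 2.
Proof.
have mX2 : measurable_fun setT (fun x : R => (x - m) ^+ 2).
  by apply: measurable_funX; exact: measurable_funB.
rewrite -[LHS]/(mean P ((fun x => (x - m) ^+ 2) \o X)).
rewrite (same_law_mean mX (measurable_aff s m) lX mX2) -meanZ; last first.
  exact: normal_power_intg.
by apply: eq_mean => z /=; rewrite addrK exprMn.
Qed.

End moments.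

Lemma gaussian_intg X n : measurable_fun setT X -> gaussian X ->
  intg P (fun w => X w ^+ n).
Proof. by move=> mX [m [s lX]]; exact: gaussian_power_intg lX n. Qed.

Lemma gaussian_intg2 X n : measurable_fun setT X -> gaussian X ->
  intg2 P (fun w => X w ^+ n).
Proof.
move=> mX gX; split; first exact: measurable_funX.
by apply: (eq_intg _ (gaussian_intg (n * 2) mX gX)) => w; rewrite exprM.
Qed.

(** The parameters m and s are eliminated: moments are expressed through the mean and the variance,
    which can be followed along the family X + s Y. *)
Lemma gaussian_moments X : measurable_fun setT X -> gaussian X ->
  forall n, mean P (fun w => X w ^+ n) = (moment_poly (mean P X) n).[
    mean P (fun w => (X w - mean P X) ^+ 2) / std_moment R 2].
Proof.
move=> mX [m [s lX]] n.
rewrite (gaussian_mean mX lX) (gaussian_variance mX lX) (gaussian_moment mX lX).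
by rewrite mulfK// gt_eqF// std_moment2_gt0.
Qed.

Lemma gaussian_atomless X a : measurable_fun setT X -> gaussian X ->
  mean P (fun w => (X w - mean P X) ^+ 2) != 0 -> P (X @^-1` [set a]) = 0%E.
Proof.
move=> mX [m [s lX]]; rewrite (gaussian_mean mX lX) (gaussian_variance mX lX).
rewrite mulf_eq0 negb_or sqrf_eq0 => /andP[s0 _]; rewrite lX//.
rewrite (_ : _ @^-1` _ = [set (a - m) / s]); first exact: normal_prob_set1.
apply/seteqP; split => z /=; first by move=> <-; rewrite addrK mulrC mulKf.
by move=> ->; rewrite mulrC divfK// subrK.
Qed.

End gaussian_variables.

(** The difference vanishes at the distinct points 0, 1, 2, ..., as many of them as its size. *)
Lemma poly_eq_horner (R : realType) (p q : {poly R}) :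
  (forall x, p.[x] = q.[x]) -> p = q.
Proof.
move=> pq; apply/eqP; rewrite -subr_eq0; apply/eqP.
apply: (@roots_geq_poly_eq0 _ _ [seq i%:R | i <- iota 0 (size (p - q))]).
- by apply/allP => x _; rewrite /root hornerD hornerN pq subrr.
- by rewrite map_inj_uniq ?iota_uniq// => i j /eqP; rewrite eqr_nat => /eqP.
- by rewrite size_map size_iota.
Qed.

(** * Regression on a Gaussian variable *)

Section gaussian_regression.
Context d (T : measurableType d) (R : realType) (P : probability T R).
Variables X Y : T -> R.
Hypotheses (mX : measurable_fun setT X) (mY : measurable_fun setT Y).
Hypotheses (gX : gaussian P X) (gY : gaussian P Y).
Hypothesis gXY : forall s, gaussian P (fun w => X w + s * Y w).
Hypothesis Y0 : mean P Y = 0.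

Let powXY a b : intg P (fun w => X w ^+ a * Y w ^+ b).
Proof. by apply: intg2M; exact: gaussian_intg2. Qed.

Let Xi : intg P X.
Proof. by apply: (eq_intg _ (gaussian_intg 1 mX gX)). Qed.

Let Yi : intg P Y.
Proof. by apply: (eq_intg _ (gaussian_intg 1 mY gY)). Qed.

(* The coefficients of s in E (X + s Y)^(n+1), the right-hand side coming from the
   variance v + 2 s E(X Y) + s^2 E(Y^2) of X + s Y. *)
Lemma gaussian_cross_moment n :
  mean P (fun w => X w ^+ n * Y w) *+ n.+1 =
  (moment_poly (mean P X) n.+1)^`().[
     mean P (fun w => (X w - mean P X) ^+ 2) / std_moment R 2]
  * (2 * mean P (fun w => X w * Y w) / std_moment R 2).
Proof.
set mu := mean P X; set v := mean P (fun w => (X w - mu) ^+ 2); set g2 := std_moment R 2.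
set kap := mean P (fun w => X w * Y w).
pose A : {poly R} := \sum_(i < n.+2)
  (mean P (fun w => X w ^+ (n.+1 - i) * Y w ^+ i) *+ 'C(n.+1, i)) *: 'X^i.
pose vY := mean P (fun w => Y w ^+ 2).
(* The variance of X + s Y divided by the second moment of N(0, 1), as a polynomial in s. *)
pose Q : {poly R} := (v / g2)%:P + (2 * kap / g2) *: 'X + (vY / g2) *: 'X^2.
pose B : {poly R} := moment_poly mu n.+1 \Po Q.
have AB : A = B.
  apply: poly_eq_horner => s.
  transitivity (mean P (fun w => (X w + s * Y w) ^+ n.+1)).
    rewrite /A horner_sum.
    rewrite (eq_mean _ (g := fun w => \sum_(i <- index_enum 'I_n.+2)
      (s ^+ i *+ 'C(n.+1, i)) * (X w ^+ (n.+1 - i) * Y w ^+ i))); last first.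
      move=> w; rewrite exprDn; apply: eq_bigr => i _.
      by rewrite exprMn mulrnAl mulrCA.
    rewrite mean_sum => [|i]; last exact: intgZ.
    apply: eq_bigr => i _; rewrite meanZ// hornerZ hornerXn.
    by rewrite !mulrnAl mulrC.
  have mXY : measurable_fun setT (fun w => X w + s * Y w).
    by apply: measurable_funD => //; exact: measurable_funM.
  rewrite (gaussian_moments mXY (gXY s)) /B horner_comp.
  have -> : mean P (fun w => X w + s * Y w) = mu.
    by rewrite meanD ?meanZ ?Y0 ?mulr0 ?addr0//; exact: intgZ.
  congr (_.[_]); rewrite /Q !hornerD hornerC !hornerZ hornerX hornerXn.
  rewrite (eq_mean _ (g := fun w => (X w - mu) ^+ 2 +
     ((2 * s) * (X w * Y w - mu * Y w) + s ^+ 2 * Y w ^+ 2))); last first.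
    by move=> w; ring.
  have XYi : intg P (fun w => X w * Y w) by apply: (eq_intg _ (powXY 1 1)).
  have Y2i : intg P (fun w => Y w ^+ 2) by exact: gaussian_intg.
  have Xmi : intg P (fun w => (X w - mu) ^+ 2).
    have gXm : gaussian P (fun w => 1 * X w - mu) by exact: gaussian_affine.
    apply: (eq_intg _ (gaussian_intg 2 _ gXm)) => [w|]; first by rewrite mul1r.
    by apply: measurable_funB => //; exact: measurable_funM.
  have i1 := intgZ mu Yi; have i2 := intgZ (2 * s) (intgB XYi i1).
  have i3 := intgZ (s ^+ 2) Y2i.
  rewrite meanD//; last exact: intgD.
  rewrite meanD// meanZ; last exact: intgB.
  rewrite meanB// !meanZ// Y0 -/v -/kap -/vY; ring.
(* The derivative at 0 reads off the coefficient of s; on the right the chain rule produces the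
   factor 2 E(X Y) / g2. *)
have : A^`().[0] = B^`().[0] by rewrite AB.
rewrite /B deriv_comp hornerM horner_comp.
have -> : Q.[0] = v / g2.
  by rewrite /Q !hornerD hornerC !hornerZ hornerX hornerXn expr0n /= !mulr0 !addr0.
have -> : Q^`().[0] = 2 * kap / g2.
  rewrite horner_coef0 coef_deriv mulr1n /Q !coefD coefC !coefZ coefX coefXn /=.
  by rewrite mulr1 mulr0 addr0 add0r.
move=> <-; rewrite horner_coef0 coef_deriv /A coef_sum mulr1n.
rewrite (bigD1 (inord 1)) //= big1 => [|i i1].
  rewrite coefZ coefXn inordK// eqxx mulr1 addr0 subn1 bin1 /=.
  by congr (_ *+ _); apply: eq_mean => w; rewrite expr1.
rewrite coefZ coefXn; case: eqP => [e1|_]; last by rewrite mulr0.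
by move: i1; rewrite -val_eqE /= inordK// -e1 eqxx.
Qed.

End gaussian_regression.

(** Orthogonality of Y - (E(X Y) / Var X) (X - mu) to X^n, with the denominator cleared. The
    variable X - mu is itself admissible as Y, with E(X (X - mu)) = Var X, and comparing the two
    cases eliminates the moment polynomial. *)
Lemma gaussian_regression d (T : measurableType d) (R : realType)
    (P : probability T R) (X Y : T -> R) n :
  measurable_fun setT X -> measurable_fun setT Y ->
  gaussian P X -> gaussian P Y ->
  (forall s, gaussian P (fun w => X w + s * Y w)) -> mean P Y = 0 ->
  mean P (fun w => X w ^+ n * Y w) * mean P (fun w => (X w - mean P X) ^+ 2) =
  mean P (fun w => X w * Y w) * mean P (fun w => X w ^+ n * (X w - mean P X)).
Proof.
move=> mX mY gX gY gXY Y0; set mu := mean P X.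
have Xi : intg P X by apply: (eq_intg _ (gaussian_intg 1 mX gX)).
have mXm : measurable_fun setT (fun w => X w - mu) by exact: measurable_funB.
have gXm : gaussian P (fun w => X w - mu).
  have := gaussian_affine 1 (- mu) gX.
  by under eq_fun do rewrite mul1r.
have gXXm s : gaussian P (fun w => X w + s * (X w - mu)).
  rewrite (_ : (fun w => _) = (fun w => (1 + s) * X w + - (s * mu))).
    exact: gaussian_affine.
  by apply/funext => w; ring.
have Xm0 : mean P (fun w => X w - mu) = 0.
  by rewrite meanB ?mean_cst ?subrr//; exact: intg_cst.
(* The cross moments with Y and with X - mu share the factor D below. *)
have e1 := gaussian_cross_moment mX mY gX gY gXY Y0 n.
have e2 := gaussian_cross_moment mX mXm gX gXm gXXm Xm0 n.
have e3 : mean P (fun w => X w * (X w - mu)) = mean P (fun w => (X w - mu) ^+ 2).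
  have X2 : intg P (fun w => X w * (X w - mu)).
    have := intgB (gaussian_intg 2 mX gX) (intgZ mu Xi).
    by apply: eq_intg => w; ring.
  rewrite [RHS](eq_mean _ (g := fun w => X w * (X w - mu) - mu * (X w - mu))).
    rewrite meanB//; last by apply: intgZ; apply: intgB => //; exact: intg_cst.
    rewrite meanZ; last by apply: intgB => //; exact: intg_cst.
    by rewrite Xm0 mulr0 subr0.
  by move=> w; ring.
move: e1 e2; rewrite -/mu e3.
set a := mean P _; set b := mean P _; set v := mean P _; set k := mean P _.
set D := _.[_] => e1 e2.
have n0 : n.+1%:R != 0 :> R by rewrite pnatr_eq0.
apply: (mulfI n0); rewrite mulrA [_ * a]mulr_natl e1 [RHS]mulrCA [_ * k]mulr_natl e2.
ring.
Qed.

(** [lam] is the regression coefficient of X on X + Y. It satisfies lam / s1^2 = (1 - lam) / s2^2,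
    exactly the condition under which the cross term r x disappears from the exponent. *)
Lemma normal_pdf_split (R : realType) (m1 s1 m2 s2 : R) :
  s1 != 0 -> s2 != 0 ->
  let lam := s1 ^+ 2 / (s1 ^+ 2 + s2 ^+ 2) in
  exists al be : R -> R,
    [/\ measurable_fun setT al, measurable_fun setT be,
      forall r, 0 <= al r, forall x, 0 <= be x &
      forall r x, normal_pdf m1 s1 (r + lam * x)
        * normal_pdf m2 s2 (x - (r + lam * x)) = al r * be x].
Proof.
move=> s10 s20 lam.
have S0 : s1 ^+ 2 + s2 ^+ 2 != 0.
  by rewrite paddr_eq0 ?sqr_ge0// !sqrf_eq0 (negbTE s10).
(* [a] is the exponent at x = 0 and [b] the exponent at r = 0, less the constant [a 0] counted in
   both. *)
pose a r := - (r - m1) ^+ 2 / (s1 ^+ 2 *+ 2) - (r + m2) ^+ 2 / (s2 ^+ 2 *+ 2).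
pose b x := - (lam * x - m1) ^+ 2 / (s1 ^+ 2 *+ 2)
            - (x - lam * x - m2) ^+ 2 / (s2 ^+ 2 *+ 2) - a 0.
have ma : measurable_fun setT a.
  apply: measurable_funB; apply: measurable_funM => //.
    apply: measurableT_comp => //; apply: measurable_funX.
    exact: measurable_funB.
  apply: measurable_funX; exact: measurable_funD.
have mb : measurable_fun setT b.
  apply: measurable_funB => //; apply: measurable_funB; apply: measurable_funM => //.
    apply: measurableT_comp => //; apply: measurable_funX.
    by apply: measurable_funB => //; exact: measurable_funM.
  apply: measurable_funX; apply: measurable_funB => //; apply: measurable_funB => //.
exists (fun r => expR (a r)),
  (fun x => normal_peak s1 * normal_peak s2 * expR (b x)); split.
- exact: measurableT_comp.
- by apply: measurable_funM => //; exact: measurableT_comp.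
- by move=> r; exact: expR_ge0.
- by move=> x; rewrite !mulr_ge0 ?normal_peak_ge0 ?expR_ge0.
move=> r x; rewrite !normal_pdfE// /normal_fun mulrACA [RHS]mulrCA.
congr (_ * _); rewrite -!expRD; congr expR.
rewrite /b /a /lam; field.
by rewrite S0 s10 s20.
Qed.

Section independent_gaussians.
Context d (T : measurableType d) (R : realType) (P : probability T R).
Notation lambda := (@lebesgue_measure R).
Variables X Y : T -> R.
Hypotheses (mX : measurable_fun setT X) (mY : measurable_fun setT Y).
Hypothesis iXY : indep2 P X Y.

Section nondegenerate.
Variables m1 s1 m2 s2 : R.
Hypotheses (s10 : s1 != 0) (s20 : s2 != 0).
Hypothesis lX : forall B, measurable B -> P (X @^-1` B) = normal_prob m1 s1 B.
Hypothesis lY : forall B, measurable B -> P (Y @^-1` B) = normal_prob m2 s2 B.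

Let integral_law (Z : T -> R) m s (f : R -> \bar R) : measurable_fun setT Z ->
  (forall B, measurable B -> P (Z @^-1` B) = normal_prob m s B) ->
  measurable_fun setT f -> (forall x, 0 <= f x)%E ->
  (\int[P]_w f (Z w) = \int[lambda]_x (f x * (normal_pdf m s x)%:E))%E.
Proof.
move=> mZ lZ mf f0; rewrite -ge0_integral_normal//.
apply: (@same_law_integral _ _ _ _ _ _ _ P
  (normal_prob m s : probability (measurableTypeR R) R) Z id) => //.
Qed.

Lemma integral_indep_normal (F : R * R -> \bar R) : measurable_fun setT F ->
  (forall z, 0 <= F z)%E ->
  (\int[P]_w F (X w, Y w) = \int[lambda]_u
     ((\int[lambda]_t (F (u, t) * (normal_pdf m2 s2 t)%:E))
      * (normal_pdf m1 s1 u)%:E))%E.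
Proof.
move=> mF F0.
have mXY : measurable_fun setT (fun w => (X w, Y w)) by exact: measurable_fun_pair.
pose X' := mfun_of mX; pose Y' := mfun_of mY; pose XY := mfun_of mXY.
have law := @indep2_law _ _ _ P _ _ _ _ X' Y' XY (fun=> erefl) iXY.
transitivity (\int[distribution P XY]_z F z)%E.
  by rewrite ge0_integral_distribution.
transitivity (\int[distribution P X' \x distribution P Y']_z F z)%E.
  by apply: eq_measure_integral => A mA _; exact/esym/law.
rewrite fubini_tonelli1//.
have mG : measurable_fun setT (fubini_F (distribution P Y') F).
  exact: measurable_fun_fubini_tonelli_F.
have G0 u : (0 <= fubini_F (distribution P Y') F u)%E by exact: integral_ge0.
rewrite ge0_integral_distribution// (integral_law mX lX mG G0).
apply: eq_integral => u _; congr (_ * _)%E.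
have mFu : measurable_fun setT (fun t => F (u, t)) by exact: measurable_fun_pair2.
rewrite /fubini_F (@ge0_integral_distribution _ _ _ _ _ P Y' (fun t => F (u, t)))//.
exact: (integral_law mY lY mFu).
Qed.

Let lam := s1 ^+ 2 / (s1 ^+ 2 + s2 ^+ 2).

(** Two translations under the Lebesgue integral bring the density of (X, Y) into the variables x =
    X + Y and r = X - lam x, where it is the product [al r * be x]. *)
Lemma indep_normal_split_nondegenerate :
  indep2 P (fun w => X w - lam * (X w + Y w)) (fun w => X w + Y w).
Proof.
have [al [be [mal mbe al0 be0 albe]]] := normal_pdf_split m1 m2 s10 s20.
pose I A := (\int[lambda]_r (\1_A r * al r)%:E)%E.
pose J B := (\int[lambda]_x (\1_B x * be x)%:E)%E.
have mS : measurable_fun setT (fun w => X w + Y w) by exact: measurable_funD.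
have mrho : measurable_fun setT (fun w => X w - lam * (X w + Y w)).
  by apply: measurable_funB => //; exact: measurable_funM.
(* The factors [I] and [J] are not probabilities: al and be are known only up to reciprocal
   constants. *)
have key A B : measurable A -> measurable B ->
    P ((fun w => X w - lam * (X w + Y w)) @^-1` A `&` (fun w => X w + Y w) @^-1` B)
    = (I A * J B)%E.
  move=> mA mB.
  have mIA : measurable_fun setT (\1_A : R -> R) by exact: measurable_indic.
  have mIB : measurable_fun setT (\1_B : R -> R) by exact: measurable_indic.
  pose H (u x : R) : R := \1_A (u - lam * x) * \1_B x.
  have H0 u x : 0 <= H u x by rewrite mulr_ge0.
  have mH : measurable_fun setT (fun z : R * R => H z.1 z.2).
    apply: measurable_funM; last exact: measurableT_comp.
    apply: (measurableT_comp mIA); apply: measurable_funB => //.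
    exact: measurable_funM.
  have mHp : measurable_fun setT (fun z : R * R => H z.1 (z.1 + z.2)).
    apply: (measurableT_comp (f := fun z : R * R => H z.1 z.2)
      (g := fun z : R * R => (z.1, z.1 + z.2))) => //.
    by apply: measurable_fun_pair => //; exact: measurable_funD.
  have mp2 : measurable_fun setT (fun z : R * R => normal_pdf m2 s2 (z.2 - z.1)).
    apply: (measurableT_comp (measurable_normal_pdf m2 s2)).
    exact: measurable_funB.
  have mp1 : measurable_fun setT (fun z : R * R => normal_pdf m1 s1 z.1).
    exact: (measurableT_comp (measurable_normal_pdf m1 s1)).
  pose K (z : R * R) : R := H z.1 z.2 * normal_pdf m2 s2 (z.2 - z.1) * normal_pdf m1 s1 z.1.
  have K0 z : 0 <= K z by rewrite !mulr_ge0 ?normal_pdf_ge0.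
  have mK : measurable_fun setT K by do 2 apply: measurable_funM => //.
  transitivity (\int[P]_w (H (X w) (X w + Y w))%:E)%E.
    rewrite -[LHS]mul1e -integral_cst//; last first.
      by apply: measurableI; exact: measurable_preimage.
    rewrite integral_mkcond; apply: eq_integral => w _.
    rewrite patchE /H !indicE in_setI.
    rewrite -[w \in (fun w => X w - lam * (X w + Y w)) @^-1` A]/(_ \in A).
    rewrite -[w \in (fun w => X w + Y w) @^-1` B]/(_ \in B).
    by case: (_ \in A); case: (_ \in B) => /=; rewrite ?mulr1 ?mulr0.
  rewrite (integral_indep_normal (F := fun z => (H z.1 (z.1 + z.2))%:E)); last 2 first.
  - exact/measurable_EFinP.
  - by move=> z; rewrite lee_fin.
  transitivity (\int[lambda]_u \int[lambda]_x (K (u, x))%:E)%E.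
    apply: eq_integral => u _.
    have mHu : measurable_fun setT (fun x => H u x * normal_pdf m2 s2 (x - u)).
      by apply: (measurable_fun_pair2 (f := fun z : R * R => H z.1 z.2 * normal_pdf m2 s2 (z.2 - z.1))); apply: measurable_funM.
    (* Substitution x = u + t at fixed u. *)
    have -> : (\int[lambda]_t ((H u (u + t))%:E * (normal_pdf m2 s2 t)%:E) =
      \int[lambda]_x (H u x * normal_pdf m2 s2 (x - u))%:E)%E.
      rewrite [RHS](ge0_integral_lebesgue_affine u (oner_neq0 R)); last 2 first.
      - exact/measurable_EFinP.
      - by move=> x; rewrite lee_fin mulr_ge0// normal_pdf_ge0.
      rewrite normr1 mul1e; apply: eq_integral => t _.
      by rewrite -EFinM mul1r addrK (addrC t).
    rewrite -ge0_integralZr//.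
    - exact/measurable_EFinP.
    - by move=> x _; rewrite lee_fin mulr_ge0// normal_pdf_ge0.
    - by rewrite lee_fin normal_pdf_ge0.
  transitivity (\int[lambda]_x \int[lambda]_u (K (u, x))%:E)%E.
    apply: (@fubini_tonelli _ _ _ _ _ lambda lambda (EFin \o K)) => [|z].
      exact/measurable_EFinP.
    by rewrite lee_fin.
  have mIal : measurable_fun setT (fun r => \1_A r * al r) by exact: measurable_funM.
  have mIbe : measurable_fun setT (fun r => \1_B r * be r) by exact: measurable_funM.
  transitivity (\int[lambda]_x (I A * (\1_B x * be x)%:E))%E.
    apply: eq_integral => x _.
    (* Substitution u = r + lam x at fixed x, after which the density factorizes. *)
    rewrite (ge0_integral_lebesgue_affine (lam * x) (oner_neq0 R)); last 2 first.
    - by apply/measurable_EFinP; exact: (measurable_fun_pair1 (f := K)).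
    - by move=> u; rewrite lee_fin.
    rewrite normr1 mul1e -ge0_integralZr//; last 3 first.
    - exact/measurable_EFinP.
    - by move=> r _; rewrite lee_fin mulr_ge0.
    - by rewrite lee_fin mulr_ge0.
    apply: eq_integral => r _; rewrite -EFinM; congr EFin.
    rewrite /K /H /= mul1r addrK -mulrA [normal_pdf m2 _ _ * _]mulrC albe.
    by rewrite mulrACA.
  rewrite ge0_integralZl//.
  - exact/measurable_EFinP.
  - by move=> x _; rewrite lee_fin mulr_ge0.
  - by apply: integral_ge0 => r _; rewrite lee_fin mulr_ge0.
(* Total mass 1 supplies the missing normalization: I(A) J(T) and I(T) J(B) are the marginals, and
   their product is I(A) J(B). *)
have IJ : (I setT * J setT = 1)%E.
  by rewrite -key// !preimage_setT setIT probability_setT.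
move=> A B mA mB; rewrite key//.
have := key A setT mA measurableT; rewrite preimage_setT setIT => ->.
have := key setT B measurableT mB; rewrite preimage_setT setTI => ->.
by rewrite -muleA (muleCA (J setT)) (muleA (I setT)) IJ mul1e.
Qed.

End nondegenerate.
End independent_gaussians.

Section gaussian_split.
Context d (T : measurableType d) (R : realType) (P : probability T R).

(** Meant for variables that are almost surely constant, where there is no density to factorize. *)
Lemma indep2_zero_one d1 d2 (T1 : measurableType d1) (T2 : measurableType d2)
    (X : T -> T1) (Y : T -> T2) :
  measurable_fun setT X -> measurable_fun setT Y ->
  (forall A, measurable A -> P (X @^-1` A) = 0%E \/ P (X @^-1` A) = 1%E) ->
  indep2 P X Y.
Proof.
move=> mX mY X01 A B mA mB.
have mXA := measurable_preimage mX mA; have mYB := measurable_preimage mY mB.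
have XA0 C : measurable C -> P (X @^-1` C) = 0%E ->
    P (X @^-1` C `&` Y @^-1` B) = 0%E.
  move=> mC C0; apply/eqP; rewrite eq_le measure_ge0 andbT -C0.
  have mXC := measurable_preimage mX mC.
  by apply: le_measure; rewrite ?inE//; exact: measurableI.
have [A0|A1] := X01 A mA; first by rewrite A0 mul0e; exact: XA0.
rewrite A1 mul1e -[in RHS](setTI (Y @^-1` B)) -(setUv (X @^-1` A)) setIUl measureU.
- rewrite -[~` X @^-1` A]/(X @^-1` (~` A)) [X in (_ + X)%E]XA0 ?adde0//.
    exact: measurableC.
  by have := probability_setC P mXA; rewrite A1 subee.
- exact: measurableI.
- by apply: measurableI => //; exact: measurableC.
- by rewrite setIACA setICr set0I.
Qed.

Let const_zero_one (m : R) (A : set R) : measurable A ->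
  normal_prob 0 1 ((fun z : R => 0 * z + m) @^-1` A) = 0%E \/
  normal_prob 0 1 ((fun z : R => 0 * z + m) @^-1` A) = 1%E.
Proof.
move=> mA; have [Am|Am] := pselect (A m).
  right; rewrite (_ : _ @^-1` _ = setT) ?probability_setT//.
  by apply/seteqP; split => // z _ /=; rewrite mul0r add0r.
left; rewrite (_ : _ @^-1` _ = set0) ?measure0//.
by apply/seteqP; split => // z /=; rewrite mul0r add0r.
Qed.

Lemma gaussian_indep_split (X Y : T -> R) :
  measurable_fun setT X -> measurable_fun setT Y ->
  gaussian P X -> gaussian P Y -> indep2 P X Y -> exists lam : R,
  indep2 P (fun w => X w - lam * (X w + Y w)) (fun w => X w + Y w).
Proof.
move=> mX mY [m1 [s1 l1]] [m2 [s2 l2]] iXY.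
have mS : measurable_fun setT (fun w => X w + Y w) by exact: measurable_funD.
have [s10|s10] := eqVneq s1 0.
  (* X is almost surely constant, and with [lam] = 0 the remainder is X itself. *)
  exists 0; under eq_fun do rewrite mul0r subr0.
  apply: indep2_zero_one => // A mA.
  by rewrite l1// s10; exact: const_zero_one.
have [s20|s20] := eqVneq s2 0.
  (* Y is almost surely constant, and with [lam] = 1 the remainder X - (X + Y) is - Y. *)
  exists 1; rewrite (_ : (fun w => _) = (fun w => - Y w)); last first.
    by apply/funext => w; ring.
  have mN : measurable_fun setT (fun y : R => - y) by exact: measurableT_comp.
  apply: indep2_zero_one => // [|A mA]; first exact: measurableT_comp.
  rewrite -[(fun w => - Y w) @^-1` A]/(Y @^-1` ((fun y => - y) @^-1` A)).
  rewrite (l2 _ (measurable_preimage mN mA)) s20.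
  by apply: const_zero_one; exact: measurable_preimage.
exists (s1 ^+ 2 / (s1 ^+ 2 + s2 ^+ 2)).
have h1 B : measurable B -> P (X @^-1` B) = normal_prob m1 s1 B.
  by move=> mB; rewrite normal_prob_affine//; exact: l1.
have h2 B : measurable B -> P (Y @^-1` B) = normal_prob m2 s2 B.
  by move=> mB; rewrite normal_prob_affine//; exact: l2.
exact: (indep_normal_split_nondegenerate mX mY iXY s10 s20 h1 h2).
Qed.

End gaussian_split.

(** * Least squares *)

Section matrix_entries.
Context (R : realType).

Lemma pseudo_inverse_det n (S : 'M[R]_n) : \det S != 0 ->
  pseudo_inverse S = (\det S)^-1 *: \adj S.
Proof.
move=> dS; have uS : S \in unitmx by rewrite unitmxE unitfE.
apply: is_moore_penrose_uniq (pseudo_inverseP S) _.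
have -> : (\det S)^-1 *: \adj S = invmx S by rewrite /invmx uS.
by split; rewrite ?mulmxV ?mulVmx ?mul1mx ?trmx1.
Qed.

Lemma cvg_sum_fin (I : Type) (s : seq I) (f : I -> nat -> R) (l : I -> R) :
  (forall i, f i n @[n --> \oo] --> l i) ->
  (\sum_(i <- s) f i n) @[n --> \oo] --> \sum_(i <- s) l i.
Proof.
move=> fl; elim: s => [|a s IH].
  by rewrite big_nil; under eq_fun do rewrite big_nil; exact: cvg_cst.
by rewrite big_cons; under eq_fun do rewrite big_cons; exact: cvgD.
Qed.

Lemma cvg_prod_fin (I : Type) (s : seq I) (f : I -> nat -> R) (l : I -> R) :
  (forall i, f i n @[n --> \oo] --> l i) ->
  (\prod_(i <- s) f i n) @[n --> \oo] --> \prod_(i <- s) l i.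
Proof.
move=> fl; elim: s => [|a s IH].
  by rewrite big_nil; under eq_fun do rewrite big_nil; exact: cvg_cst.
by rewrite big_cons; under eq_fun do rewrite big_cons; exact: cvgM.
Qed.

(** Entrywise, because determinants and adjugates are polynomials in the entries, so that sums and
    products of real limits suffice. *)
Definition cvgmx m n (A : nat -> 'M[R]_(m, n)) (L : 'M[R]_(m, n)) :=
  forall i j, A N i j @[N --> \oo] --> L i j.

Lemma cvgmx_det n (A : nat -> 'M[R]_n) L : cvgmx A L ->
  \det (A N) @[N --> \oo] --> \det L.
Proof.
move=> AL; apply: cvg_sum_fin => s; apply: cvgM; first exact: cvg_cst.
by apply: cvg_prod_fin => i; exact: AL.
Qed.

Lemma cvgmx_adj n (A : nat -> 'M[R]_n) L : cvgmx A L ->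
  cvgmx (fun N => \adj (A N)) (\adj L).
Proof.
move=> AL i j; rewrite mxE; under eq_fun do rewrite mxE.
apply: cvgM; first exact: cvg_cst.
apply: cvgmx_det => k l; rewrite !mxE; under eq_fun do rewrite !mxE.
exact: AL.
Qed.

Lemma cvgmx_mul m n p (A : nat -> 'M[R]_(m, n)) (B : nat -> 'M[R]_(n, p)) L M :
  cvgmx A L -> cvgmx B M -> cvgmx (fun N => A N *m B N) (L *m M).
Proof.
move=> AL BM i j; rewrite mxE; under eq_fun do rewrite mxE.
by apply: cvg_sum_fin => k; exact: cvgM.
Qed.

Lemma cvgmx_scale m n (a : nat -> R) (A : nat -> 'M[R]_(m, n)) (l : R) L :
  a N @[N --> \oo] --> l -> cvgmx A L ->
  cvgmx (fun N => a N *: A N) (l *: L).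
Proof.
by move=> al AL i j; rewrite mxE; under eq_fun do rewrite mxE; exact: cvgM.
Qed.

Context d (T : measurableType d).

Definition measmx m n (A : T -> 'M[R]_(m, n)) :=
  forall i j, measurable_fun setT (fun w => A w i j).

Lemma measmx_det n (A : T -> 'M[R]_n) : measmx A ->
  measurable_fun setT (fun w => \det (A w)).
Proof.
move=> mA; apply: measurable_sum => s; apply: measurable_funM => //.
by apply: measurable_prod => i _; exact: mA.
Qed.

Lemma measmx_adj n (A : T -> 'M[R]_n) : measmx A -> measmx (fun w => \adj (A w)).
Proof.
move=> mA i j; under eq_fun do rewrite mxE.
apply: measurable_funM => //; apply: measmx_det => k l.
by under eq_fun do rewrite !mxE; exact: mA.
Qed.

Lemma measmx_mul m n p (A : T -> 'M[R]_(m, n)) (B : T -> 'M[R]_(n, p)) :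
  measmx A -> measmx B -> measmx (fun w => A w *m B w).
Proof.
move=> mA mB i j; under eq_fun do rewrite mxE.
by apply: measurable_sum => k; exact: measurable_funM.
Qed.

Lemma measmx_scale m n (a : T -> R) (A : T -> 'M[R]_(m, n)) :
  measurable_fun setT a -> measmx A -> measmx (fun w => a w *: A w).
Proof.
by move=> ma mA i j; under eq_fun do rewrite mxE; exact: measurable_funM.
Qed.

End matrix_entries.

Section ols.
Context (R : realType) (q k : nat).
Implicit Types (y x : nat -> R) (z : nat -> 'cV[R]_q).

Notation smean u n := (sample_mean (u : nat -> R^o) n).

Lemma sample_meanE (u : nat -> R) n :
  smean u n = n%:R^-1 * \sum_(1 <= i < n.+1) u i.
Proof. by []. Qed.

Lemma sample_mean_mx m p (u : nat -> 'M[R]_(m, p)) n i j :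
  sample_mean u n i j = smean (fun t => u t i j) n.
Proof. by rewrite /sample_mean mxE summxE. Qed.

Lemma sample_covE l m (u : nat -> 'cV[R]_l) (v : nat -> 'cV[R]_m) n i j :
  sample_cov u v n i j = smean (fun t => u t i 0 * v t j 0) n
    - smean (fun t => u t i 0) n * smean (fun t => v t j 0) n.
Proof.
rewrite /sample_cov mxE summxE.
under eq_bigr => t _ do rewrite mxE big_ord1 !mxE !summxE
  -[_ * \sum_(_ <= _ < _) u _ _ _]/(smean (fun t => u t i 0) n)
  -[_ * \sum_(_ <= _ < _) v _ _ _]/(smean (fun t => v t j 0) n).
(* An empty sample has only empty sums, and both sides are 0; otherwise n can be cancelled. *)
case: n => [|n]; first by rewrite !sample_meanE !big_geq// !mulr0 subr0.
have n0 : n.+1%:R != 0 :> R by rewrite pnatr_eq0.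
set a := smean _ _; set b := smean _ _.
have ha : \sum_(1 <= t < n.+2) u t i 0 = n.+1%:R * a by rewrite mulrA mulfV// mul1r.
have hb : \sum_(1 <= t < n.+2) v t j 0 = n.+1%:R * b by rewrite mulrA mulfV// mul1r.
rewrite (eq_bigr (fun t => u t i 0 * v t j 0 + (- a * v t j 0
  + (- b * u t i 0 + a * b)))) => [|t _]; last by ring.
rewrite !big_split /= -!mulr_sumr ha hb sumr_const_nat subSS subn0 sample_meanE.
rewrite -[_ *+ n.+1]mulr_natl; field.
by rewrite addrC natr1.
Qed.

Lemma sample_varE x n : (1 < n)%N ->
  sample_var x n = n%:R / n.-1%:R * (smean (fun t => x t ^+ 2) n - smean x n ^+ 2).
Proof.
move=> n1; have n0 : n%:R != 0 :> R by rewrite pnatr_eq0 -lt0n ltnW.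
have n10 : n.-1%:R != 0 :> R by rewrite pnatr_eq0 -lt0n -ltnS prednK// ltnW.
rewrite /sample_var; set a := smean x n.
have ha : \sum_(1 <= t < n.+1) x t = n%:R * a by rewrite mulrA mulfV// mul1r.
rewrite (eq_bigr (fun t => x t ^+ 2 + ((- 2 * a) * x t + a ^+ 2))) => [|t _]; last by ring.
rewrite !big_split /= -!mulr_sumr ha sumr_const_nat subSS subn0 sample_meanE.
by rewrite -[_ *+ n]mulr_natl; field; rewrite n0 n10.
Qed.

(** The corrected predictor with its coefficient vector left free, so that the least squares
    coefficients can be exchanged for [adj_coef]; the intercept is absorbed by centering the
    regressor. *)
Definition linear_predictor (b : 'cV[R]_(q + k)) y z x n (s : R) : R :=
  dotmx b (regressor k z x 0%N - sample_mean (regressor k z x) n) + smean y n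
  - s * (sample_var x n)^-1 * (x 0%N - smean x n).

Lemma dotmx_col (b : 'cV[R]_(q + k)) (u : 'cV[R]_q) (v : 'cV[R]_k) :
  dotmx b (col_mx u v) = dotmx (usubmx b) u + dotmx (dsubmx b) v.
Proof. by rewrite /dotmx -{1}[b]vsubmxK tr_col_mx mul_row_col mxE. Qed.

Lemma dotmxB m (b u v : 'cV[R]_m) : dotmx b (u - v) = dotmx b u - dotmx b v.
Proof. by rewrite /dotmx mulmxBr !mxE. Qed.

Lemma sample_mean_regressor z x n : sample_mean (regressor k z x) n =
  col_mx (sample_mean z n) (sample_mean (fun i => powers k (x i)) n).
Proof.
rewrite /sample_mean /regressor -scale_col_mx; congr (_ *: _).
elim/big_rec3: _ => [|i a b c _ ->]; first by rewrite col_mx0.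
by rewrite add_col_mx.
Qed.

Lemma corrected_predictorE y z x n s :
  corrected_predictor k y z x n s = linear_predictor (ols_coef k y z x n) y z x n s.
Proof.
rewrite /corrected_predictor /linear_predictor /ols_predictor; congr (_ - _).
rewrite dotmxB sample_mean_regressor /regressor !dotmx_col.
rewrite /ols_beta0 /ols_c /ols_beta; ring.
Qed.

(* Unlike the pseudo-inverse, the adjugate is visibly measurable and continuous. *)
Definition adj_coef y z x n : 'cV[R]_(q + k) :=
  let S := sample_cov (regressor k z x) (regressor k z x) n in
  (\det S)^-1 *: (\adj S *m sample_cov (regressor k z x) (fun i => (y i)%:M) n).

Lemma ols_coef_adj y z x n :
  \det (sample_cov (regressor k z x) (regressor k z x) n) != 0 ->
  ols_coef k y z x n = adj_coef y z x n.
Proof. by move=> dS; rewrite /ols_coef pseudo_inverse_det// -scalemxAl. Qed.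

Lemma cvg_natr_pred : (n%:R / n.-1%:R : R) @[n --> \oo] --> (1 : R).
Proof.
(* The shift avoids the vanishing denominator: (n + 2) / (n + 1) = 1 + 1 / (n + 1). *)
rewrite -(cvg_shiftn 2) /=.
have -> : (fun n => (n + 2)%:R / (n + 2).-1%:R : R) = fun n => 1 + harmonic n.
  apply/funext => n; rewrite addn2 /= /harmonic -[n.+2]addn1 natrD mulrDl.
  by rewrite divff ?pnatr_eq0// mul1r.
have : (1 + harmonic n : R) @[n --> \oo] --> (1 + 0 : R).
  by apply: cvgD; [exact: cvg_cst|exact: cvg_harmonic].
by rewrite addr0.
Qed.

Lemma linear_predictor_cvg (b : nat -> 'cV[R]_(q + k)) y z x s
    (lb : 'cV[R]_(q + k)) (mr : 'cV[R]_(q + k)) (my mx x2 : R) :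
  cvgmx b lb ->
  (forall i, smean (fun t => regressor k z x t i 0) n @[n --> \oo] --> mr i 0) ->
  smean y n @[n --> \oo] --> my ->
  smean x n @[n --> \oo] --> mx ->
  smean (fun t => x t ^+ 2) n @[n --> \oo] --> x2 ->
  x2 - mx ^+ 2 != 0 ->
  linear_predictor (b n) y z x n s @[n --> \oo] -->
    dotmx lb (regressor k z x 0%N - mr) + my
    - s * (x2 - mx ^+ 2)^-1 * (x 0%N - mx).
Proof.
move=> bl rl yl xl x2l v0; apply: cvgB.
  apply: cvgD => //; rewrite /dotmx.
  have bT : cvgmx (fun n => (b n)^T) lb^T.
    by move=> i j; rewrite mxE; under eq_fun do rewrite mxE; exact: bl.
  apply: (cvgmx_mul bT) => i j; rewrite (ord1 j).
  have entryB (u v : 'cV[R]_(q + k)) : (u - v) i 0 = u i 0 - v i 0.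
    by rewrite !mxE.
  rewrite entryB; under eq_fun do rewrite entryB sample_mean_mx.
  by apply: cvgB; [exact: cvg_cst|exact: rl].
apply: cvgM; last by apply: cvgB => //; exact: cvg_cst.
apply: cvgM; first exact: cvg_cst.
apply: cvgV => //.
have <- : 1 * (x2 - mx ^+ 2) = x2 - mx ^+ 2 by rewrite mul1r.
apply: (@cvg_trans _ ((fun n => n%:R / n.-1%:R * (smean (fun t => x t ^+ 2) n - smean x n ^+ 2)) @ \oo)).
  apply: near_eq_cvg; exists 2%N => // n /= n2; by rewrite sample_varE.
apply: cvgM; first exact: cvg_natr_pred.
by apply: cvgB => //; exact: cvgM.
Qed.

(** The limit of the covariances with y is written S b, the form given by the population normal
    equations; the inverse of S then cancels. *)
Lemma adj_coef_cvg y z x (S : 'M[R]_(q + k)) (b : 'cV[R]_(q + k)) :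
  cvgmx (sample_cov (regressor k z x) (regressor k z x)) S ->
  cvgmx (sample_cov (regressor k z x) (fun i => (y i)%:M)) (S *m b) ->
  \det S != 0 -> cvgmx (adj_coef y z x) b.
Proof.
move=> SS Sy dS; have uS : S \in unitmx by rewrite unitmxE unitfE.
rewrite -[b](mulKmx uS) /invmx uS -scalemxAl.
apply: cvgmx_scale; first by apply: cvgV => //; exact: cvgmx_det.
by apply: cvgmx_mul => //; exact: cvgmx_adj.
Qed.

End ols.

(** Inversion is continuous on the open complement of 0, and the single point left is harmless. *)
Lemma measurable_inv (R : realType) : measurable_fun setT (fun x : R => x^-1).
Proof.
have m0 : measurable [set (0 : R)] by exact: measurable_set1.
rewrite -(setvU [set (0 : R)]); apply/(measurable_funU _ (measurableC m0) m0).
split; last exact: measurable_fun_set1.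
apply: open_continuous_measurable_fun => [|x].
  by rewrite openC; exact: closed_eq.
by rewrite inE /= => /eqP x0; exact: inv_continuous.
Qed.

(** * Measurability of the predictor *)

Section measurable_predictor.
Context (R : realType) (q k : nat) d (T : measurableType d).
Variables (y x : nat -> T -> R) (z : nat -> T -> 'cV[R]_q).
Hypotheses (my : forall i, measurable_fun setT (y i)).
Hypotheses (mx : forall i, measurable_fun setT (x i)).
Hypotheses (mz : forall i, measmx (z i)).

Lemma measurable_sample_mean (u : nat -> T -> R) n :
  (forall i, measurable_fun setT (u i)) ->
  measurable_fun setT (fun w => sample_mean (fun i => u i w : R^o) n).
Proof.
by move=> mu; apply: measurable_funM => //; exact: measurable_sum.
Qed.

Lemma measmx_regressor i :
  measmx (fun w => regressor k (fun t => z t w) (fun t => x t w) i).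
Proof.
move=> a b; rewrite /regressor; under eq_fun do rewrite mxE.
case: (fintype.split a) => j; first exact: mz.
by under eq_fun do rewrite mxE; exact: measurable_funX.
Qed.

Lemma measmx_sample_cov l m (u : nat -> T -> 'cV[R]_l) (v : nat -> T -> 'cV[R]_m) n :
  (forall i, measmx (u i)) -> (forall i, measmx (v i)) ->
  measmx (fun w => sample_cov (u^~ w) (v^~ w) n).
Proof.
move=> mu mv i j; under eq_fun do rewrite sample_covE.
apply: measurable_funB; last apply: measurable_funM;
  apply: measurable_sample_mean => t; [|exact: mu|exact: mv].
by apply: measurable_funM; [exact: mu|exact: mv].
Qed.

Let S n w := sample_cov (regressor k (fun t => z t w) (fun t => x t w))
  (regressor k (fun t => z t w) (fun t => x t w)) n.

Let mS n : measmx (S n).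
Proof. by apply: measmx_sample_cov => i; exact: measmx_regressor. Qed.

Lemma measurable_det_cov n : measurable_fun setT (fun w => \det (S n w)).
Proof. by apply: measmx_det; exact: mS. Qed.

Lemma measurable_linear_predictor n s : measurable_fun setT (fun w =>
  linear_predictor (adj_coef k (y^~ w) (fun t => z t w) (fun t => x t w) n)
    (y^~ w) (fun t => z t w) (fun t => x t w) n s).
Proof.
have mV (f : T -> R) : measurable_fun setT f -> measurable_fun setT (fun w => (f w)^-1).
  by move=> mf; exact: (measurableT_comp (@measurable_inv R)).
have mcoef : measmx (fun w => adj_coef k (y^~ w) (fun t => z t w) (fun t => x t w) n).
  apply: measmx_scale; first by apply: mV; exact: measurable_det_cov.
  apply: measmx_mul; first by apply: measmx_adj; exact: mS.
  apply: measmx_sample_cov => i; first exact: measmx_regressor.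
  move=> a b; under eq_fun do rewrite mxE; rewrite !ord1 eqxx.
  exact: my.
apply: measurable_funB.
  apply: measurable_funD; last exact: measurable_sample_mean.
  apply: (measmx_mul (A := fun w => (adj_coef k (y^~ w) (fun t => z t w) (fun t => x t w) n)^T)).
    by move=> a b; under eq_fun do rewrite mxE; exact: mcoef.
  move=> a b.
  have entryB (u v : 'cV[R]_(q + k)) : (u - v) a b = u a b - v a b.
    by rewrite !mxE.
  under eq_fun do rewrite entryB sample_mean_mx.
  apply: measurable_funB; first exact: measmx_regressor.
  by apply: measurable_sample_mean => i; exact: measmx_regressor.
apply: measurable_funM.
  apply: measurable_funM => //; apply: mV; apply: measurable_funM => //.
  apply: measurable_sum => i; apply: measurable_funX; apply: measurable_funB => //.
  exact: measurable_sample_mean.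
by apply: measurable_funB => //; exact: measurable_sample_mean.
Qed.

End measurable_predictor.

(** * Conditional expectations and probabilities *)

Section integral_indic.
Import HBNNSimple.

(* E may be nonmeasurable: the integral of a nonnegative function is a supremum
   over the simple functions below it. *)
Lemma le_integral_indic d (T : measurableType d) (R : realType)
    (P : probability T R) (A E F : set T) : E `<=` F ->
  (\int[P]_(w in A) (\1_E w)%:E <= \int[P]_(w in A) (\1_F w)%:E)%E.
Proof.
move=> EF; rewrite ge0_integralE; last by move=> w _; rewrite lee_fin.
rewrite ge0_integralE; last by move=> w _; rewrite lee_fin.
apply: ereal_sup_le => _ [h hE <-].
exists h => // w; apply: le_trans (hE w) _; rewrite !patchE; case: ifPn => // _.
rewrite lee_fin !indicE; have [Ew|] := boolP (w \in E); last by rewrite ler0n.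
by rewrite (mem_set (EF _ (set_mem Ew))).
Qed.

End integral_indic.

Section conditional_expectation.
Context d (T : measurableType d) (R : realType) (P : probability T R).
Context d' (T' : measurableType d') (V : T -> T').
Hypothesis mV : measurable_fun setT V.

Lemma sigma_of_measurable A : sigma_of V A -> measurable A.
Proof. by move=> [B mB <-]; rewrite setTI; exact: measurable_preimage. Qed.

Lemma cond_expectation_meas (X Y : T -> R) :
  is_cond_expectation P (sigma_of V) X Y -> measurable_fun setT Y.
Proof. by move=> [Yi _ _]; exact: (intg_meas (Yi : intg P Y)). Qed.

(** For two versions f and g, the set {g < f} belongs to sigma(V). Testing both on it gives a null
    integral of the nonnegative variable (f - g) 1_{g < f}, so f <= g almost surely; the roles are
    then exchanged. *)
Lemma cond_expectation_unique (X Y D : T -> R) :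
  is_cond_expectation P (sigma_of V) X Y ->
  is_cond_expectation P (sigma_of V) X D -> {ae P, forall w, Y w = D w}.
Proof.
move=> [Yi GY eY] [Di GD eD].
have half (f g : T -> R) : intg P f -> intg P g ->
    preimage_set_system setT f measurable `<=` sigma_of V ->
    preimage_set_system setT g measurable `<=` sigma_of V ->
    (forall A, sigma_of V A ->
      (\int[P]_(w in A) (f w)%:E = \int[P]_(w in A) (g w)%:E)%E) ->
    {ae P, forall w, f w <= g w}.
  move=> fi gi Gf Gg fg.
  (* On T with the sigma-algebra of V as its measurable sets, {g < f} is measurable as an ordinary
     comparison set. *)
  have mf : measurable_fun (setT : set (g_sigma_algebra_preimageType V)) f.
    by move=> _ B mB; apply: Gf; exists B.
  have mg : measurable_fun (setT : set (g_sigma_algebra_preimageType V)) g.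
    by move=> _ B mB; apply: Gg; exists B.
  pose A := [set w | g w < f w].
  have GA : sigma_of V A.
    rewrite -[A]setTI.
    exact: (@measurable_fun_ltr _ (g_sigma_algebra_preimageType V) R setT g f).
  have mA := sigma_of_measurable GA.
  have hi : intg P (fun w => (f w - g w) * \1_A w).
    by apply: intg_indic => //; exact: intgB.
  have h0 w : 0 <= (f w - g w) * \1_A w.
    rewrite indicE; have [Aw|Aw] := boolP (w \in A); last by rewrite mulr0.
    by rewrite mulr1 subr_ge0 ltW//; exact: set_mem Aw.
  have hm : mean P (fun w => (f w - g w) * \1_A w) = 0.
    have := fg A GA; rewrite !integral_mean// => -[e].
    rewrite (eq_mean _ (g := fun w => f w * \1_A w - g w * \1_A w)); last first.
      by move=> w; rewrite mulrBl.
    by rewrite meanB ?e ?subrr//; exact: intg_indic.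
  apply: filterS (mean0_ae hi h0 hm) => w.
  rewrite indicE; have [Aw|Aw] := boolP (w \in A).
    have : g w < f w by exact: set_mem Aw.
    by rewrite mulr1 => /[swap] /eqP; rewrite subr_eq0 => /eqP -> //.
  by move=> _; rewrite leNgt; apply/negP => h; move: Aw; rewrite notin_setE; apply.
have YD := half _ _ Yi Di GY GD (fun A GA => etrans (eY A GA) (esym (eD A GA))).
have DY := half _ _ Di Yi GD GY (fun A GA => etrans (eD A GA) (esym (eY A GA))).
by apply: filterS2 YD DY => w h1 h2; apply/eqP; rewrite eq_le h1.
Qed.

(** The [p n] are arbitrary versions chosen separately for each n, so the argument is a maximal
    inequality rather than conditional dominated convergence. [E n] may fail to be measurable and
    enters only through the integral of its indicator, bounded by that of [F n]. *)
Lemma cond_probability_cvg0 (E F : nat -> set T) (p : nat -> T -> R) :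
  (forall n, (2 <= n)%N -> is_cond_probability P (sigma_of V) (E n) (p n)) ->
  (forall n, E n `<=` F n) -> (forall n, measurable (F n)) ->
  {ae P, forall w, \forall n \near \oo, ~ F n w} ->
  {ae P, forall w, p n w @[n --> \oo] --> 0}.
Proof.
move=> pE EF mF Fw.
pose A N := \bigcup_n F (N + n)%N.
have mA N : measurable (A N) by exact: bigcup_measurable.
have PA : P (A N) @[N --> \oo] --> 0%E.
  have A0 : P (\bigcap_N A N) = 0%E.
    have [M [mM M0 hM]] := Fw.
    apply/eqP; rewrite eq_le measure_ge0 andbT -M0; apply: le_measure.
    - by rewrite inE; exact: bigcapT_measurable.
    - by rewrite inE.
    move=> w Aw; apply: hM => -[N _ hN].
    by have [n _] := Aw N I; apply: hN; rewrite /= leq_addr.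
  rewrite -A0; apply: nonincreasing_cvg_mu => //.
  - by rewrite -ge0_fin_numE ?fin_num_measure.
  - exact: bigcapT_measurable.
  - move=> m n mn; apply/subsetPset => w [i _ Fi].
    by exists (n - m + i)%N => //; rewrite addnA subnKC.
have mp n : (2 <= n)%N -> measurable_fun setT (p n).
  by move=> /pE /cond_expectation_meas.
(* Tested on {p n < 0}, a set of sigma(V), where the integral of an indicator cannot be negative. *)
have p0 n : (2 <= n)%N -> {ae P, forall w, 0 <= p n w}.
  move=> n2; have [pi Gp ep] := pE n n2.
  pose C := [set w | p n w < 0].
  have GC : sigma_of V C.
    apply: Gp; exists (fun r => r < 0); last by rewrite setTI.
    by rewrite -[X in measurable X]setTI; exact: measurable_fun_ltr.
  have mC := sigma_of_measurable GC.
  have hi : intg P (fun w => - (p n w * \1_C w)).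
    apply: (eq_intg _ (intgZ (-1) (intg_indic mC pi))) => w; by rewrite mulN1r.
  have h0 w : 0 <= - (p n w * \1_C w).
    rewrite indicE; have [Cw|] := boolP (w \in C); last by rewrite mulr0 oppr0.
    by rewrite mulr1 oppr_ge0 ltW//; exact: set_mem Cw.
  have hm : mean P (fun w => - (p n w * \1_C w)) = 0.
    apply/eqP; rewrite eq_le; apply/andP; split; last first.
      by rewrite -(mean_cst P 0); apply: le_mean => //; exact: intg_cst.
    rewrite (eq_mean _ (g := fun w => -1 * (p n w * \1_C w))); last first.
      by move=> w; rewrite mulN1r.
    rewrite meanZ; last exact: intg_indic.
    rewrite mulN1r oppr_le0 -lee_fin -integral_mean// ep//.
    by apply: integral_ge0 => w _; rewrite lee_fin.
  apply: filterS (mean0_ae hi h0 hm) => w.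
  rewrite indicE; have [Cw|Cw] := boolP (w \in C).
    by rewrite mulr1 => /eqP; rewrite oppr_eq0 => /eqP ->.
  by move=> _; rewrite leNgt; apply/negP => h; move: Cw; rewrite notin_setE; apply.
(* Thresholds 1 / (j + 1) suffice, and there are countably many of them. *)
have up (j : nat) : {ae P, forall w, \forall n \near \oo, p n w <= j.+1%:R^-1}.
  set dl : R := j.+1%:R^-1.
  have dl0 : 0 < dl by rewrite invr_gt0.
  pose C N n := [set w | dl < p (N + n)%N w].
  pose B N := \bigcup_n C N n.
  have GC N n : (2 <= N)%N -> sigma_of V (C N n).
    move=> N2; have [_ Gp _] := pE (N + n)%N (leq_trans N2 (leq_addr _ _)).
    apply: Gp; exists (fun r => dl < r); last by rewrite setTI.
    by rewrite -[X in measurable X]setTI; exact: measurable_fun_ltr.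
  have mB N : (2 <= N)%N -> measurable (B N).
    by move=> N2; apply: bigcup_measurable => n _; exact: sigma_of_measurable (GC _ _ N2).
  have PB N : (2 <= N)%N -> (dl%:E * P (B N) <= P (A N))%E.
    move=> N2.
    (* seqDU (C N) n: the first index exceeding dl is N + n *)
    have GU n : sigma_of V (seqDU (C N) n).
      apply: (@seqDU_measurable _ (g_sigma_algebra_preimageType V)) => i.
      exact: GC.
    have mU n := sigma_of_measurable (GU n).
    have tU := trivIset_seqDU (C N).
    have BU : B N = \bigcup_n seqDU (C N) n by exact: seqDU_bigcup_eq.
    rewrite BU measure_bigcup//.
    rewrite -nneseriesZl => [|i _]; last exact: measure_ge0.
    apply: (@le_trans _ _ (\sum_(i <oo | i \in setT) P (A N `&` seqDU (C N) i)))%E.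
      apply: lee_nneseries => [i _ _|i _].
        by rewrite mule_ge0// lee_fin ltW.
      have n2 : (2 <= N + i)%N := leq_trans N2 (leq_addr _ _).
      have [pi Gp ep] := pE (N + i)%N n2.
      (* The piece lies in sigma(V) and p (N + i) exceeds [dl] there: dl P(piece) is at most the
         integral of p, equal to that of 1_E, which is at most P(F and piece). *)
      apply: (@le_trans _ _ (\int[P]_(w in seqDU (C N) i) (p (N + i)%N w)%:E)%E).
        rewrite -integral_cst//; apply: ge0_le_integral => //.
        - by move=> w _; rewrite lee_fin ltW.
        - by apply: measurable_funTS; apply/measurable_EFinP; exact: mp.
        - by move=> w Uw; rewrite lee_fin ltW//; exact: (subset_seqDU Uw).
      rewrite ep//; apply: (le_trans (le_integral_indic P _ (@EF _))).
      rewrite integral_indic//; apply: le_measure; rewrite ?inE//.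
      + exact: measurableI.
      + exact: measurableI.
      + by move=> w [Fi Ui]; split => //; exists i.
    rewrite -measure_bigcup => //; last 2 first.
    - by move=> i _; exact: measurableI.
    - exact: trivIset_setIl.
    apply: le_measure; rewrite ?inE//.
      by apply: bigcup_measurable => i _; exact: measurableI.
    by move=> w [i _ []].
  (* Indices start at 2, below which [p n] is unconstrained. *)
  have mBI : measurable (\bigcap_N B N.+2).
    by apply: bigcapT_measurable => N; exact: mB.
  exists (\bigcap_N B N.+2); split => //.
    have fin : P (\bigcap_N B N.+2) \is a fin_num by rewrite fin_num_measure.
    have h N : (dl%:E * P (\bigcap_N B N.+2) <= P (A N.+2))%E.
      apply: le_trans (PB _ _) => //; rewrite lee_pmul2l//.
      by apply: le_measure; rewrite ?inE//; [exact: mB|exact: bigcap_inf].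
    have : (dl%:E * P (\bigcap_N B N.+2) <= 0)%E.
      have PA2 : P (A N.+2) @[N --> \oo] --> 0%E.
        by have := PA; rewrite -(cvg_shiftn 2); under eq_fun do rewrite addn2.
      rewrite -(cvg_lim _ PA2)//; apply: lime_ge; first by apply/cvg_ex; exists 0%E.
      exact: nearW.
    rewrite pmule_rle0 ?lte_fin// => h0.
    by apply/eqP; rewrite eq_le h0 measure_ge0.
  move=> w nw N _; apply: contrapT => nB; apply: nw.
  exists N.+2 => // n /= Nn; rewrite leNgt; apply/negP => h; apply: nB.
  by exists (n - N.+2)%N => //; rewrite /C /= subnKC.
have H1 := ae_foralln up.
have H2 : {ae P, forall w, forall n, 0 <= p n.+2 w}.
  by apply: ae_foralln => n; exact: p0.
apply: filterS2 H1 H2 => w h1 h2.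
apply/cvgrPdist_le => e e0.
have [j je] : exists j : nat, j.+1%:R^-1 <= e.
  exists (Num.truncn e^-1); rewrite invf_ple ?posrE//.
  by rewrite ltW// truncnS_gt.
have [N _ hN] := h1 j.
exists (maxn N 2) => // n /=; rewrite geq_max => /andP[Nn n2].
rewrite sub0r normrN ger0_norm; first exact: le_trans (hN n Nn) je.
by rewrite -(subnK n2) addn2; exact: h2.
Qed.

End conditional_expectation.

(** * The errors-in-variables model *)

Section independence4.
Context d (T : measurableType d) (R : realType) (P : probability T R).
Context d1 d2 d3 d4 (T1 : measurableType d1) (T2 : measurableType d2)
  (T3 : measurableType d3) (T4 : measurableType d4).
Variables (X1 : T -> T1) (X2 : T -> T2) (X3 : T -> T3) (X4 : T -> T4).
Hypotheses (m1 : measurable_fun setT X1) (m2 : measurable_fun setT X2).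
Hypotheses (m3 : measurable_fun setT X3) (m4 : measurable_fun setT X4).
Hypothesis indep : mutually_independent P
  (tnth [tuple sigma_of X1; sigma_of X2; sigma_of X3; sigma_of X4]).

Lemma indep4 A1 A2 A3 A4 : measurable A1 -> measurable A2 -> measurable A3 ->
  measurable A4 ->
  P (X1 @^-1` A1 `&` (X2 @^-1` A2 `&` (X3 @^-1` A3 `&` X4 @^-1` A4))) =
  (P (X1 @^-1` A1) * (P (X2 @^-1` A2) * (P (X3 @^-1` A3) * P (X4 @^-1` A4))))%E.
Proof.
move=> mA1 mA2 mA3 mA4.
pose A (i : 'I_4) := tnth [tuple X1 @^-1` A1; X2 @^-1` A2; X3 @^-1` A3; X4 @^-1` A4] i.
have AS (i : 'I_4) : tnth [tuple sigma_of X1; sigma_of X2; sigma_of X3; sigma_of X4] i (A i).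
  by rewrite /A; case: i => -[|[|[|[|//]]]] i4; rewrite !(tnth_nth set0) /=;
    [exists A1|exists A2|exists A3|exists A4] => //; rewrite setTI.
transitivity (P (\bigcap_(i in [set` [fset i | i in 'I_4]%fset]) A i)).
  congr (P _); apply/seteqP; split => [w [w1 [w2 [w3 w4]]] i _|w h].
    by rewrite /A; case: i => -[|[|[|[|//]]]] i4; rewrite !(tnth_nth set0).
  have {}h i : A i w by apply: h; rewrite /= inE.
  have := h (inord 0); have := h (inord 1); have := h (inord 2); have := h (inord 3).
  by rewrite /A !(tnth_nth set0) !inordK.
rewrite indep => [|i _]; last exact: AS.
have JE : perm_eq [fset i | i in 'I_4]%fset (index_enum 'I_4).
  apply: uniq_perm => //; first exact: index_enum_uniq.
  by move=> i; rewrite mem_index_enum inE.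
rewrite (perm_big _ JE) /= !big_ord_recl big_ord0 mule1.
by rewrite /A !(tnth_nth set0).
Qed.

Let G w := (X1 w, X4 w).

Let mG : measurable_fun setT G.
Proof. exact: measurable_fun_pair. Qed.

Lemma indep4_14 : indep2 P X1 X4.
Proof.
move=> A B mA mB; have := indep4 mA measurableT measurableT mB.
by rewrite !preimage_setT !setTI probability_setT !mul1e.
Qed.

(** Positions 1 to 4 will be xi, e, z and (eps, delta): thus z is independent of everything that
    determines x and [eps]. *)
Lemma indep4_3_14 : indep2 P X3 (fun w => (X1 w, X4 w)).
Proof.
move=> A D mA mD; apply: (indep_event_pair (E := X3 @^-1` A)) => //.
  exact: measurable_preimage.
move=> B C mB mC; have := indep4 mB measurableT mA mC.
rewrite !preimage_setT !setTI probability_setT !mul1e setICA => ->.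
by rewrite indep4_14// muleCA.
Qed.

(** [indep_event_pair] is used twice: for the event on X2 against the pair (X3, (X1, X4)), then for
    the joint event on X2 and X3 against (X1, X4). *)
Lemma indep4_2_314 : indep2 P X2 (fun w => (X3 w, (X1 w, X4 w))).
Proof.
move=> A D mA mD; apply: (indep_event_pair (E := X2 @^-1` A) (Y := G)) => //.
  exact: measurable_preimage.
move=> B C mB mC; rewrite (indep4_3_14 mB mC) setIA.
rewrite (_ : G @^-1` C = [set w | C (X1 w, X4 w)])//.
have m23 : measurable (X2 @^-1` A `&` X3 @^-1` B).
  by apply: measurableI; exact: measurable_preimage.
rewrite (indep_event_pair (E := X2 @^-1` A `&` X3 @^-1` B) m23 m1 m4 _ mC).
  have := indep4 measurableT mA mB measurableT.
  rewrite !preimage_setT setTI setIT probability_setT mul1e mule1 => ->.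
  by rewrite muleA.
move=> A1 A4 mA1 mA4; have := indep4 mA1 mA mB mA4.
rewrite (indep4_14 mA1 mA4).
have := indep4 measurableT mA mB measurableT.
rewrite !preimage_setT setTI setIT probability_setT mul1e mule1 => ->.
rewrite setIA (setIC (X1 @^-1` A1)) -!setIA => h.
rewrite [X in P X](_ : _ = X2 @^-1` A `&` (X1 @^-1` A1 `&` (X3 @^-1` B `&` X4 @^-1` A4))).
  by rewrite {}h muleCA -muleA; congr (_ * _)%E; rewrite muleCA.
by congr (_ `&` _); rewrite setICA.
Qed.

End independence4.

Lemma measurable_horner d (T : measurableType d) (R : realType) (p : {poly R})
    (f : T -> R) : measurable_fun setT f -> measurable_fun setT (fun w => p.[f w]).
Proof.
move=> mf; under eq_fun do rewrite horner_coef.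
apply: measurable_sum => i; apply: measurable_funM => //.
exact: measurable_funX.
Qed.

(** Induction on the size, splitting off one real root at a time: a nondegenerate Gaussian variable
    hits each root with probability 0. *)
Lemma gaussian_poly_ae0 d (T : measurableType d) (R : realType)
    (P : probability T R) (X : T -> R) (p : {poly R}) :
  measurable_fun setT X -> gaussian P X ->
  mean P (fun w => (X w - mean P X) ^+ 2) != 0 ->
  {ae P, forall w, p.[X w] = 0} -> p = 0.
Proof.
move=> mX gX v0 pX; apply/eqP/negPn/negP => p0.
have mr (r : {poly R}) : measurable [set w | r.[X w] = 0].
  exact: (measurable_preimage (measurable_horner r mX) (measurable_set1 0)).
have root0 n (r : {poly R}) : (size r <= n)%N -> r != 0 ->
    P [set w | r.[X w] = 0] = 0%E.
  elim: n r => [|n IH] r rn r0.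
    by move: rn; rewrite leqn0 size_poly_eq0 (negbTE r0).
  have [[t rt]|nr] := pselect (exists t, root r t); last first.
    rewrite (_ : [set _ | _] = set0) ?measure0//.
    by apply/seteqP; split => // w /= /rootP rw; apply: nr; exists (X w).
  have /factor_theorem[s rs] := rt.
  have s0 : s != 0 by apply: contraNneq r0 => s0; rewrite rs s0 mul0r.
  have sn : (size s <= n)%N.
    by move: rn; rewrite rs size_Mmonic ?monicXsubC// size_XsubC addn2.
  have mt : measurable (X @^-1` [set t]).
    by apply: measurable_preimage => //; exact: measurable_set1.
  apply/eqP; rewrite eq_le measure_ge0 andbT.
  apply: (@le_trans _ _ (P ([set w | s.[X w] = 0] `|` X @^-1` [set t]))).
    apply: le_measure; rewrite ?inE//; first exact: measurableU.
    move=> w /= /eqP; rewrite rs hornerM mulf_eq0 hornerXsubC subr_eq0.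
    by move=> /orP[/eqP|/eqP]; [left|right].
  apply: (le_trans (measureU2 _ (mr s) mt)).
  rewrite [X in (X + _)%E](_ : _ = 0%E); last exact: IH.
  rewrite [X in (_ + X)%E](_ : _ = 0%E) ?adde0//.
  exact: gaussian_atomless.
have [N [mN N0 hN]] := pX.
pose Z := [set w | p.[X w] = 0].
have PZ : P Z = 0%E by exact: (root0 (size p)).
have mZ : measurable Z by exact: mr.
have : (P setT <= P Z + P N)%E.
  apply: le_trans (measureU2 _ mZ mN); apply: le_measure; rewrite ?inE//.
    exact: measurableU.
  by rewrite -(setUv Z); exact: setUS.
by rewrite probability_setT PZ N0 adde0 leNgt lte01.
Qed.

Lemma mean_centered d (T : measurableType d) (R : realType)
    (P : probability T R) (f g : T -> R) : intg2 P f -> intg2 P g ->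
  mean P (fun w => (f w - mean P f) * (g w - mean P g)) =
  mean P (fun w => f w * g w) - mean P f * mean P g.
Proof.
move=> f2 g2; have fi := intg2_intg f2; have gi := intg2_intg g2.
rewrite (eq_mean _ (g := fun w => f w * g w -
  (mean P g * f w + (mean P f * g w - mean P f * mean P g)))); last by move=> w; ring.
have i1 := intgZ (mean P g) fi; have i2 := intgZ (mean P f) gi.
have i3 := intg_cst P (mean P f * mean P g).
have i4 := intgB i2 i3.
rewrite meanB//; [|exact: intg2M|exact: intgD].
rewrite meanD// meanB// mean_cst !meanZ//; ring.
Qed.

(** Testing on rectangles is enough by [mean0_rectangles], and on a rectangle the independence of z
    from the other variables can be used. *)
Lemma cond_expectation_pair d (T : measurableType d) (R : realType)
    (P : probability T R) d1 d2 (T1 : measurableType d1) (T2 : measurableType d2)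
    (Z : T -> T1) (X : T -> T2) (F : T1 * T2 -> R) (Y : T -> R) :
  measurable_fun setT Z -> measurable_fun setT X -> measurable_fun setT F ->
  intg P Y -> intg P (fun w => F (Z w, X w)) ->
  (forall A B, measurable A -> measurable B ->
    mean P (fun w => (Y w - F (Z w, X w)) * (\1_A (Z w) * \1_B (X w))) = 0) ->
  is_cond_expectation P (sigma_of (fun w => (Z w, X w))) Y (fun w => F (Z w, X w)).
Proof.
move=> mZ mX mF Yi Fi h.
have mZX : measurable_fun setT (fun w => (Z w, X w)) by exact: measurable_fun_pair.
split=> // [|_ [D mD <-]]; first exact: (sigma_of_comp mF).
rewrite setTI; have mA := measurable_preimage mZX mD.
rewrite !integral_mean//; congr (_%:E); apply/eqP; rewrite eq_sym -subr_eq0.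
rewrite -meanB; [|exact: intg_indic|exact: intg_indic].
rewrite -(mean0_rectangles mZ mX (intgB Yi Fi) h mD); apply/eqP/eq_mean => w.
by rewrite mulrBl.
Qed.
Lemma covariance_mean d (T : measurableType d) (R : realType)
    (P : probability T R) (f g : T -> R) : intg P f -> intg P g ->
  intg P (fun w => (f w - mean P f) * (g w - mean P g)) ->
  covariance P f g = (mean P (fun w => (f w - mean P f) * (g w - mean P g)))%:E.
Proof. by move=> fi gi fgi; rewrite unlock -meanE// unlock. Qed.

(** * Population regression in the model *)

Section model.
Context (R : realType) d (T : measurableType d) (P : probability T R) (q k : nat).
Context (c : 'cV[R]_q) (beta0 : R) (beta : 'cV[R]_k) (sigma_ed : R).
Context (y : {RV P >-> R}) (z : {RV P >-> q.-tuple R})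
  (xi e eps x delta : {RV P >-> R}).
Hypothesis H : eiv_model c beta0 beta sigma_ed y z xi e eps x delta.

Let m_xi : measurable_fun setT xi. Proof. exact: measurable_funPT. Qed.
Let m_e : measurable_fun setT e. Proof. exact: measurable_funPT. Qed.
Let m_eps : measurable_fun setT eps. Proof. exact: measurable_funPT. Qed.
Let m_delta : measurable_fun setT delta. Proof. exact: measurable_funPT. Qed.
Let m_z : measurable_fun setT z. Proof. exact: measurable_funPT. Qed.
Let m_x : measurable_fun setT x. Proof. exact: measurable_funPT. Qed.
Let m_y : measurable_fun setT y. Proof. exact: measurable_funPT. Qed.
Let m_ed : measurable_fun setT (fun w => (eps w, delta w)).
Proof. exact: measurable_fun_pair. Qed.

Let z_ind_G : indep2 P z (fun w => (xi w, (eps w, delta w))).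
Proof. exact: (indep4_3_14 m_xi m_z m_ed (eiv_indep H)). Qed.

Let e_ind_zG : indep2 P e (fun w => (z w, (xi w, (eps w, delta w)))).
Proof. exact: (indep4_2_314 m_xi m_e m_z m_ed (eiv_indep H)). Qed.

Let xi_ind_ed : indep2 P xi (fun w => (eps w, delta w)).
Proof. exact: (indep4_14 (eiv_indep H)). Qed.

Let gauss_comb (a b s : R) : gaussian P (fun w => a * eps w + b * delta w + s * xi w).
Proof.
have := eiv_gauss H (fun i : 'I_3 => [tuple a; b; s]`_i).
have -> : (fun w => \sum_(j < 3) [tuple a; b; s]`_j
    * tnth [tuple eps w; delta w; xi w] j) =
    (fun w => a * eps w + b * delta w + s * xi w).
  apply/funext => w; rewrite !big_ord_recl big_ord0 /= addr0.
  by rewrite !(tnth_nth 0) /= addrA.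
exact: gaussian_lawP.
Qed.

(** Equal to x almost surely, but an exact function of xi and delta, which independence and joint
    normality require; [y'] below plays the same role for y. *)
Let x' w := xi w + delta w.

Let m_x' : measurable_fun setT x'. Proof. exact: measurable_funD. Qed.

Let xx' : {ae P, forall w, x w = x' w}. Proof. exact: eiv_x H. Qed.

Let g_xi : gaussian P xi.
Proof.
have := gauss_comb 0 0 1; rewrite (_ : (fun w => _) = xi)//.
by apply/funext => w; rewrite !mul0r !add0r mul1r.
Qed.

Let g_delta : gaussian P delta.
Proof.
have := gauss_comb 0 1 0; rewrite (_ : (fun w => _) = delta)//.
by apply/funext => w; rewrite !mul0r addr0 add0r mul1r.
Qed.

Let g_eps : gaussian P eps.
Proof.
have := gauss_comb 1 0 0; rewrite (_ : (fun w => _) = eps)//.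
by apply/funext => w; rewrite !mul0r !addr0 mul1r.
Qed.

Let g_x' : gaussian P x'.
Proof.
have := gauss_comb 0 1 1; rewrite (_ : (fun w => _) = x')//.
by apply/funext => w; rewrite !mul0r add0r !mul1r addrC.
Qed.

Let g_x'eps s : gaussian P (fun w => x' w + s * eps w).
Proof.
have := gauss_comb s 1 1; rewrite (_ : (fun w => _) = (fun w => x' w + s * eps w))//.
by apply/funext => w; rewrite !mul1r /x'; ring.
Qed.

Let expectation_mean (f : T -> R) (a : R) :
  intg P f -> ('E_P[f] = a%:E)%E -> mean P f = a.
Proof. by move=> fi; rewrite unlock meanE// => -[]. Qed.

Let e2 : intg2 P e. Proof. exact: (Lfun2_intg2 (eiv_L2_e H)). Qed.
Let eps2 : intg2 P eps. Proof. exact: (Lfun2_intg2 (eiv_L2_eps H)). Qed.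
Let delta2 : intg2 P delta. Proof. exact: (Lfun2_intg2 (eiv_L2_delta H)). Qed.
Let z2 j : intg2 P (fun w => tnth (z w) j).
Proof. exact: (Lfun2_intg2 (eiv_L2_z H j)). Qed.
Let x'2 n : intg2 P (fun w => x' w ^+ n). Proof. exact: gaussian_intg2. Qed.
Let xi2 n : intg2 P (fun w => xi w ^+ n). Proof. exact: gaussian_intg2. Qed.
Let mean_e : mean P e = 0.
Proof. by apply: expectation_mean (eiv_mean_e H); exact: intg2_intg. Qed.
Let mean_eps : mean P eps = 0.
Proof. by apply: expectation_mean (eiv_mean_eps H); exact: intg2_intg. Qed.

Let mu := mean P x'.
Let v := mean P (fun w => (x' w - mu) ^+ 2).

Let x'mu2 : intg2 P (fun w => x' w - mu).
Proof.
apply: intg2B; last exact: intg2_cst.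
by apply: eq_intg2 (x'2 1).
Qed.

Let v_gt0 : 0 < v.
Proof.
have x2 : intg2 P x.
  by apply: (ae_intg2 m_x xx'); apply: eq_intg2 (x'2 1).
have xi' := intg2_intg x2.
have xm2 : intg2 P (fun w => x w - mean P x) by apply: intg2B => //; exact: intg2_cst.
have := eiv_var_x H; rewrite /variance covariance_mean//; last exact: intg2M.
rewrite lte_fin (ae_mean (g := fun w => (x' w - mu) ^+ 2))//.
- by apply: measurable_funM; exact: intg2_meas xm2.
- by apply: measurable_funX; exact: measurable_funB.
have -> : mean P x = mu by exact: ae_mean.
by apply: filterS xx' => w ->; rewrite expr2.
Qed.

(** xi is independent of the centered [eps], so the covariance of x and [eps] comes from delta alone
    and is the known parameter. *)
Let mean_x'eps : mean P (fun w => x' w * eps w) = sigma_ed.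
Proof.
have [i1 m1] := indep2M (eq_intg (fun w => expr1 (xi w)) (intg2_intg (xi2 1)))
  (intg2_intg eps2) (indep2_comp (@measurable_id _ _ setT) measurable_fst xi_ind_ed).
rewrite (eq_mean _ (g := fun w => xi w * eps w + eps w * delta w)); last first.
  by move=> w; rewrite /x' mulrDl [delta w * _]mulrC.
rewrite meanD//; last exact: intg2M.
rewrite m1 mean_eps mulr0 add0r.
by apply: expectation_mean (eiv_sigma_ed H); exact: intg2M.
Qed.

Let regression_eps n : mean P (fun w =>
  (eps w - sigma_ed / v * (x' w - mu)) * x' w ^+ n) = 0.
Proof.
have h := gaussian_regression n m_x' m_eps g_x' g_eps g_x'eps mean_eps.
rewrite -/mu -/v mean_x'eps in h.
have i1 : intg P (fun w => x' w ^+ n * eps w) by exact: intg2M.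
have i2 : intg P (fun w => x' w ^+ n * (x' w - mu)) by exact: intg2M.
rewrite (eq_mean _ (g := fun w => x' w ^+ n * eps w
   - sigma_ed / v * (x' w ^+ n * (x' w - mu)))); last by move=> w; ring.
rewrite meanB//; last exact: intgZ.
rewrite meanZ//; apply/eqP; rewrite subr_eq0; apply/eqP.
have v0 : v != 0 by rewrite gt_eqF.
by apply: (mulIf v0); rewrite h mulrAC divfK.
Qed.

Let xi_ind_delta : indep2 P xi delta.
Proof. exact: (indep2_comp (@measurable_id _ _ setT) measurable_snd xi_ind_ed). Qed.

Section split.
Variable lam : R.
Let rho w := xi w - lam * x' w.
Hypothesis ilam : indep2 P rho x'.

Let m_rho : measurable_fun setT rho.
Proof. by apply: measurable_funB => //; exact: measurable_funM. Qed.

Let g_rho : gaussian P rho.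
Proof.
have := gauss_comb 0 (- lam) (1 - lam); rewrite (_ : (fun w => _) = rho)//.
by apply/funext => w; rewrite /rho /x'; ring.
Qed.

(* E[xi^j | x'], from the binomial expansion of xi = lam x' + rho. *)
Let hj j : {poly R} := \sum_(i < j.+1)
  (lam ^+ (j - i) * mean P (fun w => rho w ^+ i) *+ 'C(j, i)) *: 'X^(j - i).

(** After expansion each term is a centered power of [rho] times a function of x', and its mean
    vanishes by independence. General [g] is allowed, since indicators are needed for the
    conditional expectation. *)
Lemma regression_xi (g : R -> R) j : measurable_fun setT g ->
  intg2 P (g \o x') ->
  mean P (fun w => (xi w ^+ j - (hj j).[x' w]) * g (x' w)) = 0.
Proof.
move=> mg g2.
pose F (i : 'I_j.+1) w := (lam ^+ (j - i) *+ 'C(j, i)) *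
  ((rho w ^+ i - mean P (fun w => rho w ^+ i)) * (x' w ^+ (j - i) * g (x' w))).
have hF (i : 'I_j.+1) : intg P (F i) /\ mean P (F i) = 0.
  have ri := gaussian_intg i m_rho g_rho.
  have i1 : intg P (fun w => rho w ^+ i - mean P (fun w => rho w ^+ i)).
    by apply: intgB => //; exact: intg_cst.
  have i2 : intg P (fun w => x' w ^+ (j - i) * g (x' w)) by exact: intg2M.
  have m1 : measurable_fun setT (fun r : R => r ^+ i - mean P (fun w => rho w ^+ i)).
    by apply: measurable_funB => //; exact: measurable_funX.
  have m2 : measurable_fun setT (fun t : R => t ^+ (j - i) * g t).
    by apply: measurable_funM => //; exact: measurable_funX.
  have [i3 e3] := indep2M i1 i2 (indep2_comp m1 m2 ilam).
  split; first exact: intgZ.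
  rewrite meanZ// [X in _ * X]e3 meanB ?mean_cst ?subrr ?mul0r ?mulr0//.
  exact: intg_cst.
rewrite (eq_mean _ (g := fun w => \sum_(i <- index_enum 'I_j.+1) F i w)).
  rewrite mean_sum => [|i]; last by case: (hF i).
  by rewrite big1// => i _; case: (hF i).
move=> w; have -> : xi w = lam * x' w + rho w by rewrite /rho; ring.
rewrite exprDn /hj horner_sum -sumrB mulr_suml; apply: eq_bigr => i _.
rewrite hornerZ hornerXn exprMn /F -mulrnAl -!mulrnAl; ring.
Qed.

Hypothesis k_gt0 : (0 < k)%N.

Let pi_ : {poly R} := \sum_(j < k) beta j 0 *: hj j.+1.
Let a := sigma_ed / v.
(* c.z + Q(x') is the regression of y' on z and x', and V + e its residual. *)
Let Q : {poly R} := pi_ + a *: 'X + (beta0 - a * mu)%:P.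
Let b : 'cV[R]_(q + k) := col_mx c (\col_m Q`_m.+1).
(** [V0] is the error in predicting the polynomial in xi, orthogonal to all square-integrable
    functions of x'; it serves for the conditional expectation of eta. [V] adds the error for [eps],
    shown orthogonal to powers of x', and serves for the normal equations. *)
Let V0 w := \sum_(j < k) beta j 0 * (xi w ^+ j.+1 - (hj j.+1).[x' w]).
Let V w := V0 w + (eps w - a * (x' w - mu)).
Let regr w : 'cV[R]_(q + k) := col_mx (colv (z w)) (powers k (x' w)).
Let y' w := dotmx c (colv (z w)) + beta0 + dotmx beta (powers k (xi w)) + e w + eps w.

Let dotmxE m (f g : 'cV[R]_m) : dotmx f g = \sum_i f i 0 * g i 0.
Proof. by rewrite /dotmx mxE; apply: eq_bigr => i _; rewrite mxE. Qed.

Let size_hj j : (size (hj j) <= j.+1)%N.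
Proof.
apply: (leq_trans (size_sum _ _ _)); apply/bigmax_leqP => i _.
by rewrite (leq_trans (size_scale_leq _ _))// size_polyXn ltnS leq_subr.
Qed.

(** The degree is at most k, so Q is an intercept plus a combination of the regressors x, ..., x^k;
    the linear term from [eps] fits because k > 0. *)
Let size_Q : (size Q <= k.+1)%N.
Proof.
rewrite (leq_trans (size_polyD _ _))// geq_max; apply/andP; split; last first.
  by rewrite (leq_trans (size_polyC_leq1 _)).
rewrite (leq_trans (size_polyD _ _))// geq_max; apply/andP; split; last first.
  by rewrite (leq_trans (size_scale_leq _ _))// size_polyX ltnS.
apply: (leq_trans (size_sum _ _ _)); apply/bigmax_leqP => i _.
by rewrite (leq_trans (size_scale_leq _ _))// (leq_trans (size_hj _))// ltnS.
Qed.

Let Q_horner t : Q.[t] = Q`_0 + dotmx (\col_(m < k) Q`_m.+1) (powers k t).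
Proof.
rewrite (horner_coef_wide t size_Q) big_ord_recl expr0 mulr1 dotmxE; congr (_ + _).
by apply: eq_bigr => i _; rewrite !mxE.
Qed.

Let dotmx_b (u : 'cV[R]_q) t :
  dotmx b (col_mx u (powers k t)) + Q`_0 = dotmx c u + Q.[t].
Proof.
rewrite dotmx_col /b col_mxKu col_mxKd -addrA; congr (_ + _).
by rewrite addrC -Q_horner.
Qed.

Let pi_horner t : pi_.[t] = \sum_(j < k) beta j 0 * (hj j.+1).[t].
Proof. by rewrite horner_sum; apply: eq_bigr => j _; rewrite hornerZ. Qed.

Let V0E w : V0 w = dotmx beta (powers k (xi w)) - pi_.[x' w].
Proof.
rewrite pi_horner dotmxE -sumrB; apply: eq_bigr => j _.
by rewrite mulrBr mxE.
Qed.

Let Q_E t : Q.[t] = pi_.[t] + a * (t - mu) + beta0.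
Proof. by rewrite /Q !hornerD hornerZ hornerX hornerC; ring. Qed.

Let y'E w : y' w = dotmx b (regr w) + Q`_0 + (V w + e w).
Proof. rewrite dotmx_b Q_E /V V0E /y'; ring. Qed.

Let horner2 (p : {poly R}) : intg2 P (fun w => p.[x' w]).
Proof.
apply: (@eq_intg2 _ _ _ _ (fun w => \sum_(i <- index_enum 'I_(size p)) p`_i * x' w ^+ i)).
  by move=> w; rewrite horner_coef.
by apply: intg2_sum => i; exact: intg2Z.
Qed.

Let V0term2 (j : 'I_k) :
  intg2 P (fun w => beta j 0 * (xi w ^+ j.+1 - (hj j.+1).[x' w])).
Proof. by apply: intg2Z; apply: intg2B. Qed.

Let V02 : intg2 P V0. Proof. exact: intg2_sum. Qed.

Let epsx'2 : intg2 P (fun w => eps w - a * (x' w - mu)).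
Proof. by apply: intg2B => //; exact: intg2Z. Qed.

Let V2 : intg2 P V. Proof. exact: intg2D. Qed.

Let colv_z i w : colv (z w) i 0 = tnth (z w) i. Proof. by rewrite mxE. Qed.

Let regr_l w i : regr w (lshift k i) 0 = tnth (z w) i.
Proof. by rewrite col_mxEu colv_z. Qed.

Let regr_r w i : regr w (rshift q i) 0 = x' w ^+ i.+1.
Proof. by rewrite col_mxEd mxE. Qed.

Let regr2 i : intg2 P (fun w => regr w i 0).
Proof.
rewrite -(splitK i); case: (fintype.split i) => j /=.
  by apply: (eq_intg2 _ (z2 j)) => w; rewrite regr_l.
by apply: (eq_intg2 _ (x'2 j.+1)) => w; rewrite regr_r.
Qed.

Let mean_V0 (g : R -> R) : measurable_fun setT g -> intg2 P (g \o x') ->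
  mean P (fun w => V0 w * g (x' w)) = 0.
Proof.
move=> mg g2.
rewrite (eq_mean _ (g := fun w => \sum_(j <- index_enum 'I_k)
  beta j 0 * ((xi w ^+ j.+1 - (hj j.+1).[x' w]) * g (x' w)))); last first.
  by move=> w; rewrite mulr_suml; apply: eq_bigr => j _; rewrite mulrA.
have hi (j : 'I_k) : intg P (fun w => (xi w ^+ j.+1 - (hj j.+1).[x' w]) * g (x' w)).
  by apply: intg2M => //; exact: intg2B.
rewrite mean_sum => [|j]; last exact: intgZ.
by rewrite big1// => j _; rewrite meanZ// regression_xi// mulr0.
Qed.

Let mean_V n : mean P (fun w => V w * x' w ^+ n) = 0.
Proof.
rewrite (eq_mean _ (g := fun w => V0 w * x' w ^+ n
  + (eps w - a * (x' w - mu)) * x' w ^+ n)); last by move=> w; rewrite mulrDl.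
rewrite meanD; [|exact: intg2M|exact: intg2M].
rewrite regression_eps addr0 (mean_V0 (g := fun t => t ^+ n))//.
exact: (x'2 n).
Qed.

Let mean_V1 : mean P V = 0.
Proof. by rewrite -[RHS](mean_V 0); apply: eq_mean => w; rewrite mulr1. Qed.

(* FV0 and FV express V0 and V through (xi, (eps, delta)), which is independent
   of z. *)
Let FV0 (g : R * (R * R)) : R :=
  \sum_(j < k) beta j 0 * (g.1 ^+ j.+1 - (hj j.+1).[g.1 + g.2.2]).
Let FV (g : R * (R * R)) : R := FV0 g + (g.2.1 - a * (g.1 + g.2.2 - mu)).

Let m_sum : measurable_fun setT (fun g : R * (R * R) => g.1 + g.2.2).
Proof.
apply: measurable_funD => //.
exact: (measurableT_comp measurable_snd measurable_snd).
Qed.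

Let m_FV0 : measurable_fun setT FV0.
Proof.
apply: measurable_sum => j; apply: measurable_funM => //; apply: measurable_funB.
  exact: measurable_funX.
exact: measurable_horner.
Qed.

Let m_FV : measurable_fun setT FV.
Proof.
apply: measurable_funD => //; apply: measurable_funB.
  exact: (measurableT_comp measurable_fst measurable_snd).
by apply: measurable_funM => //; exact: measurable_funB.
Qed.

Let z_ind_V i : indep2 P (fun w => tnth (z w) i) V.
Proof. exact: (indep2_comp (measurable_tnth i) m_FV z_ind_G). Qed.

Let e_ind_z i : indep2 P e (fun w => tnth (z w) i).
Proof.
apply: (indep2_comp (@measurable_id _ _ setT)
  (g := fun g : q.-tuple R * (R * (R * R)) => tnth g.1 i) _ e_ind_zG).
exact: (measurableT_comp (measurable_tnth i) measurable_fst).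
Qed.

Let e_ind_x' : indep2 P e x'.
Proof.
apply: (indep2_comp (@measurable_id _ _ setT)
  (g := fun g : q.-tuple R * (R * (R * R)) => g.2.1 + g.2.2.2) _ e_ind_zG).
exact: (measurableT_comp m_sum measurable_snd).
Qed.

Let mean_indep_eq0 (f g : T -> R) : intg P f -> intg P g -> indep2 P f g ->
  mean P f = 0 -> mean P (fun w => f w * g w) = 0.
Proof. by move=> fi gi fg f0; have [_ ->] := indep2M fi gi fg; rewrite f0 mul0r. Qed.

Let mean_Ve : mean P (fun w => V w + e w) = 0.
Proof. by rewrite meanD ?mean_V1 ?mean_e ?addr0//; exact: intg2_intg. Qed.

(** Coordinates of z are independent of the centered variables V and e; for powers of x', [mean_V]
    handles V and independence handles e. *)
Let normal_equation i : mean P (fun w => (V w + e w) * regr w i 0) = 0.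
Proof.
rewrite (eq_mean _ (g := fun w => V w * regr w i 0 + e w * regr w i 0)); last first.
  by move=> w; rewrite mulrDl.
rewrite meanD; [|exact: intg2M|exact: intg2M].
rewrite -(splitK i); case: (fintype.split i) => j /=.
  rewrite (eq_mean _ (g := fun w => V w * tnth (z w) j)); last by move=> w; rewrite regr_l.
  rewrite [X in _ + X](eq_mean _ (g := fun w => e w * tnth (z w) j)); last by move=> w; rewrite regr_l.
  rewrite mean_indep_eq0 ?mean_indep_eq0 ?addr0//; try exact: intg2_intg.
  exact/indep2_sym.
rewrite (eq_mean _ (g := fun w => V w * x' w ^+ j.+1)); last by move=> w; rewrite regr_r.
rewrite mean_V add0r.
rewrite (eq_mean _ (g := fun w => e w * x' w ^+ j.+1)); last by move=> w; rewrite regr_r.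
apply: mean_indep_eq0 => //; try exact: intg2_intg.
have mpow : measurable_fun setT (fun t : R => t ^+ j.+1) by exact: measurable_funX.
exact: (indep2_comp (@measurable_id _ _ setT) mpow e_ind_x').
Qed.

Let y'2 : intg2 P y'.
Proof.
apply: (@eq_intg2 _ _ _ _ (fun w => (\sum_(i <- index_enum 'I_(q + k)) b i 0 * regr w i 0)
   + Q`_0 + (V w + e w))).
  by move=> w; rewrite y'E dotmxE.
apply: intg2D; last exact: intg2D.
by apply: intg2D; [apply: intg2_sum => i; exact: intg2Z|exact: intg2_cst].
Qed.

Let S : 'M[R]_(q + k) := \matrix_(i, j)
  (mean P (fun w => regr w i 0 * regr w j 0)
   - mean P (fun w => regr w i 0) * mean P (fun w => regr w j 0)).

Let centered i w := regr w i 0 - mean P (fun w => regr w i 0).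

Let centered2 i : intg2 P (centered i).
Proof. by apply: intg2B => //; exact: intg2_cst. Qed.

Let centered_mean i : mean P (centered i) = 0.
Proof.
by rewrite meanB ?mean_cst ?subrr//; [exact: intg2_intg|exact: intg_cst].
Qed.

Let SE i j : S i j = mean P (fun w => centered i w * centered j w).
Proof. by rewrite mxE mean_centered. Qed.

(** If u S = 0, the combination W = u . (r - E r) has variance 0. Its z-part and x-part are
    independent and centered, so both vanish almost surely, and the two blocks of u are killed
    separately. *)
Let det_S : \det S != 0.
Proof.
apply/det0P => -[u u0 uS].
pose W w := \sum_(i < q + k) u 0 i * centered i w.
have W2 : intg2 P W by apply: intg2_sum => i; exact: intg2Z.
(* E[W (r_j - E r_j)] is the j-th entry of u S; summing against u gives E W^2 = 0. *)
have WC j : mean P (fun w => W w * centered j w) = 0.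
  rewrite (eq_mean _ (g := fun w => \sum_(i <- index_enum 'I_(q + k))
     u 0 i * (centered i w * centered j w))); last first.
    by move=> w; rewrite mulr_suml; apply: eq_bigr => i _; rewrite mulrA.
  have ci i : intg P (fun w => centered i w * centered j w) by exact: intg2M.
  rewrite mean_sum => [|i]; last exact: intgZ.
  transitivity ((u *m S) 0 j); last by rewrite uS mxE.
  by rewrite mxE; apply: eq_bigr => i _; rewrite SE meanZ.
have WW : mean P (fun w => W w * W w) = 0.
  rewrite (eq_mean _ (g := fun w => \sum_(j <- index_enum 'I_(q + k))
     u 0 j * (W w * centered j w))); last first.
    by move=> w; rewrite {2}/W mulr_sumr; apply: eq_bigr => i _; rewrite mulrCA.
  rewrite mean_sum => [|i]; last by apply: intgZ; exact: intg2M.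
  by rewrite big1// => j _; rewrite meanZ ?WC ?mulr0//; exact: intg2M.
pose Z w := \sum_(i < q) u 0 (lshift k i) * centered (lshift k i) w.
pose X w := \sum_(i < k) u 0 (rshift q i) * centered (rshift q i) w.
have WE w : W w = Z w + X w by rewrite /W big_split_ord.
have Z2 : intg2 P Z by apply: intg2_sum => i; exact: intg2Z.
have X2 : intg2 P X by apply: intg2_sum => i; exact: intg2Z.
have Z0 : mean P Z = 0.
  rewrite mean_sum => [|i]; last by apply: intgZ; exact: intg2_intg.
  rewrite big1// => i _; rewrite meanZ ?centered_mean ?mulr0//.
  exact: intg2_intg.
pose FZ (t : q.-tuple R) : R := \sum_(i < q) u 0 (lshift k i)
  * (tnth t i - mean P (fun w => regr w (lshift k i) 0)).
pose FX (g : R * (R * R)) : R := \sum_(i < k) u 0 (rshift q i)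
  * ((g.1 + g.2.2) ^+ i.+1 - mean P (fun w => regr w (rshift q i) 0)).
have mFZ : measurable_fun setT FZ.
  apply: measurable_sum => i; apply: measurable_funM => //.
  by apply: measurable_funB => //; exact: measurable_tnth.
have mFX : measurable_fun setT FX.
  apply: measurable_sum => i; apply: measurable_funM => //.
  by apply: measurable_funB => //; exact: measurable_funX.
have ZE : FZ \o z = Z.
  by apply/funext => w; apply: eq_bigr => i _; rewrite /centered regr_l.
have XE : FX \o (fun w => (xi w, (eps w, delta w))) = X.
  by apply/funext => w; apply: eq_bigr => i _; rewrite /centered regr_r.
have iZX : indep2 P Z X by rewrite -ZE -XE; exact: indep2_comp.
have ZX0 : mean P (fun w => Z w * X w) = 0.
  by apply: mean_indep_eq0 => //; exact: intg2_intg.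
have ZZi : intg P (fun w => Z w ^+ 2) by case: Z2.
have XXi : intg P (fun w => X w ^+ 2) by case: X2.
(* Z and X are independent and centered, so E W^2 = E Z^2 + E X^2. *)
have sum0 : mean P (fun w => Z w ^+ 2) + mean P (fun w => X w ^+ 2) = 0.
  rewrite -[RHS]WW (@eq_mean _ _ _ _ (fun w => W w * W w)
    (fun w => (Z w ^+ 2 + X w ^+ 2) + 2 * (Z w * X w))); last first.
    by move=> w; rewrite WE; ring.
  have ZXi : intg P (fun w => Z w * X w) by exact: intg2M.
  have ZXi2 := intgZ 2 ZXi; have ZZXX := intgD ZZi XXi.
  by rewrite meanD// meanZ// ZX0 mulr0 addr0 meanD.
have ge0 (f : T -> R) : intg P (fun w => f w ^+ 2) -> 0 <= mean P (fun w => f w ^+ 2).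
  move=> fi; rewrite -(mean_cst P 0); apply: le_mean => // [|w].
    exact: intg_cst.
  exact: sqr_ge0.
have mZ0 : mean P (fun w => Z w ^+ 2) = 0.
  by have := ge0 _ ZZi; have := ge0 _ XXi; lra.
have mX0 : mean P (fun w => X w ^+ 2) = 0.
  by have := ge0 _ XXi; lra.
have Zae : {ae P, forall w, Z w = 0}.
  apply: filterS (mean0_ae ZZi (fun w => sqr_ge0 _) mZ0) => w /eqP.
  by rewrite sqrf_eq0 => /eqP.
have Xae : {ae P, forall w, X w = 0}.
  apply: filterS (mean0_ae XXi (fun w => sqr_ge0 _) mX0) => w /eqP.
  by rewrite sqrf_eq0 => /eqP.
(* The entries of [lsubmx u *m cov_mx P z] are E[Z (z_j - E z_j)] = 0, and the covariance of z is
   invertible. *)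
have ul0 : lsubmx u = 0.
  rewrite -[LHS](mulmxK (eiv_cov_z H)) (_ : _ *m cov_mx P z = 0) ?mul0mx//.
  apply/rowP => j; rewrite mxE [RHS]mxE.
  have zi i : intg P (fun w => tnth (z w) i) by exact: intg2_intg.
  have zc2 i : intg2 P (fun w => tnth (z w) i - mean P (fun w => tnth (z w) i)).
    by apply: intg2B => //; exact: intg2_cst.
  have -> : \sum_j0 lsubmx u 0 j0 * cov_mx P z j0 j =
      mean P (fun w => Z w * (tnth (z w) j - mean P (fun w => tnth (z w) j))).
    rewrite (eq_mean _ (g := fun w => \sum_(i <- index_enum 'I_q)
      u 0 (lshift k i) * ((tnth (z w) i - mean P (fun w => tnth (z w) i)) *
        (tnth (z w) j - mean P (fun w => tnth (z w) j))))); last first.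
      move=> w; rewrite mulr_suml; apply: eq_bigr => i _; rewrite -mulrA /centered regr_l.
      by congr (_ * (_ * _)); congr (_ - _); apply: eq_mean => w'; rewrite regr_l.
    rewrite mean_sum => [|i]; last by apply: intgZ; exact: intg2M.
    apply: eq_bigr => i _; rewrite meanZ; last exact: intg2M.
    rewrite !mxE; congr (_ * _); rewrite covariance_mean//.
    exact: intg2M.
  rewrite (ae_mean (g := fun=> 0)) ?mean_cst//.
    apply: measurable_funM; [exact: intg2_meas Z2|exact: intg2_meas (zc2 j)].
  by apply: filterS Zae => w ->; rewrite mul0r.
have ur0 : rsubmx u = 0.
  (* X is this polynomial evaluated at x'; its coefficients of positive degree are the entries of
     [rsubmx u]. *)
  pose p : {poly R} := \sum_(i < k) u 0 (rshift q i) *: 'X^(i.+1)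
    - (\sum_(i < k) u 0 (rshift q i) * mean P (fun w => regr w (rshift q i) 0))%:P.
  have p0 : p = 0.
    apply: (gaussian_poly_ae0 m_x' g_x'); first by rewrite -/mu -/v gt_eqF.
    apply: filterS Xae => w; rewrite /X /p hornerD hornerN hornerC horner_sum => X0.
    rewrite -[RHS]X0 -sumrB; apply: eq_bigr => i _.
    by rewrite hornerZ hornerXn /centered mulrBr regr_r.
  apply/rowP => i; rewrite mxE [RHS]mxE.
  have : p`_i.+1 = 0 by rewrite p0 coef0.
  rewrite /p coefB coefC subr0 coef_sum (bigD1 i)//= big1 => [|j ji].
    by rewrite coefZ coefXn eqxx mulr1 addr0.
  by rewrite coefZ coefXn eqSS eq_sym val_eqE (negbTE ji) mulr0.
by move: u0; rewrite -[u]hsubmxK ul0 ur0 row_mx0 eqxx.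
Qed.

Let mean_y' : mean P y' = \sum_j b j 0 * mean P (fun w => regr w j 0) + Q`_0.
Proof.
rewrite (eq_mean _ (g := fun w => (\sum_(i <- index_enum 'I_(q + k)) b i 0 * regr w i 0)
   + Q`_0 + (V w + e w))); last by move=> w; rewrite y'E dotmxE.
have ri i : intg P (fun w => regr w i 0) by exact: intg2_intg.
have bi : intg P (fun w => \sum_(i <- index_enum 'I_(q + k)) b i 0 * regr w i 0).
  by apply: intg_sum => i; exact: intgZ.
have ci := intg_cst P Q`_0.
rewrite meanD; [|exact: intgD|by apply: intgD; exact: intg2_intg].
rewrite mean_Ve addr0 meanD// mean_cst mean_sum => [|i]; last exact: intgZ.
by congr (_ + _); apply: eq_bigr => i _; rewrite meanZ.
Qed.

(** The population normal equations: the residual drops out by [normal_equation] and the intercept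
    cancels in the covariance, which identifies b as the limit of least squares. *)
Let cov_regr_y' i : mean P (fun w => regr w i 0 * y' w)
    - mean P (fun w => regr w i 0) * mean P y' = (S *m b) i 0.
Proof.
rewrite (@eq_mean _ _ _ _ (fun w => regr w i 0 * y' w)
  (fun w => (\sum_(j <- index_enum 'I_(q + k)) b j 0 * (regr w i 0 * regr w j 0))
   + Q`_0 * regr w i 0 + (V w + e w) * regr w i 0)); last first.
  move=> w; rewrite y'E dotmxE mulrDr [_ * (V w + _)]mulrC; congr (_ + _).
  rewrite mulrDr [_ * Q`_0]mulrC; congr (_ + _).
  by rewrite mulr_sumr; apply: eq_bigr => j _; rewrite mulrCA.
have ri : intg P (fun w => regr w i 0) by exact: intg2_intg.
have rri j : intg P (fun w => regr w i 0 * regr w j 0) by exact: intg2M.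
have bi : intg P (fun w => \sum_(j <- index_enum 'I_(q + k)) b j 0 * (regr w i 0 * regr w j 0)).
  by apply: intg_sum => j; exact: intgZ.
have ci := intgZ Q`_0 ri.
rewrite meanD; [|exact: intgD|by apply: intg2M => //; exact: intg2D].
rewrite normal_equation addr0 meanD// meanZ// mean_sum => [|j]; last exact: intgZ.
rewrite mean_y' mulrDr [_ * Q`_0]mulrC opprD addrACA subrr addr0 mulr_sumr -sumrB.
rewrite [RHS]mxE; apply: eq_bigr => j _; rewrite meanZ// [S i j]mxE; ring.
Qed.

Let D1 w := dotmx c (colv (z w)) + beta0 + dotmx beta (powers k (xi w)).

Let m_dotc : measurable_fun setT (fun t : q.-tuple R => dotmx c (colv t)).
Proof.
under eq_fun do rewrite dotmxE.
apply: measurable_sum => i; apply: measurable_funM => //.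
under eq_fun do rewrite mxE.
exact: measurable_tnth.
Qed.

Let dotc2 : intg2 P (fun w => dotmx c (colv (z w))).
Proof.
apply: (@eq_intg2 _ _ _ _ (fun w => \sum_(i <- index_enum 'I_q) c i 0 * tnth (z w) i)).
  by move=> w; rewrite dotmxE; apply: eq_bigr => i _; rewrite colv_z.
by apply: intg2_sum => i; exact: intg2Z.
Qed.

Let D12 : intg2 P D1.
Proof.
apply: intg2D; first by apply: intg2D => //; exact: intg2_cst.
apply: (@eq_intg2 _ _ _ _ (fun w => \sum_(i <- index_enum 'I_k) beta i 0 * xi w ^+ i.+1)).
  by move=> w; rewrite dotmxE; apply: eq_bigr => i _; rewrite mxE.
by apply: intg2_sum => i; exact: intg2Z.
Qed.

Let yy' : {ae P, forall w, y w = y' w}. Proof. exact: eiv_y H. Qed.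

Let indic_measurable d' (T' : measurableType d') (A : set T') :
  measurable A -> measurable_fun setT (\1_A : T' -> R).
Proof. exact: measurable_indic. Qed.

(** On a rectangle, e is independent of both indicators; [eps] is independent of xi, and [eps]
    1_B(xi) is in turn independent of z. Both errors are centered, so they leave no trace. *)
Let cond_y :
  is_cond_expectation P (sigma_of (fun w => (z w, xi w))) y D1.
Proof.
pose F (t : q.-tuple R * R) := dotmx c (colv t.1) + beta0 + dotmx beta (powers k t.2).
have mF : measurable_fun setT F.
  apply: measurable_funD.
    apply: measurable_funD => //; exact: (measurableT_comp m_dotc measurable_fst).
  under eq_fun do rewrite dotmxE.
  apply: measurable_sum => i; apply: measurable_funM => //.
  under eq_fun do rewrite mxE.
  by apply: measurable_funX; exact: measurable_snd.
have y2 : intg2 P y by exact: (ae_intg2 m_y yy').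
apply: (@cond_expectation_pair _ _ _ _ _ _ _ _ z xi F) => //.
- exact: intg2_intg.
- exact: (intg2_intg D12).
move=> A B mA mB.
have mAz : measurable_fun setT (fun w => \1_A (z w) : R).
  exact: (measurableT_comp (indic_measurable mA)).
have mBx : measurable_fun setT (fun w => \1_B (xi w) : R).
  exact: (measurableT_comp (indic_measurable mB)).
have iA : intg P (fun w => \1_A (z w) : R).
  apply: (intg_le mAz (intg_cst P 1)) => w; rewrite indicE.
  by case: (_ \in _); rewrite ?normr1 ?normr0.
have iB : intg P (fun w => \1_B (xi w) : R).
  apply: (intg_le mBx (intg_cst P 1)) => w; rewrite indicE.
  by case: (_ \in _); rewrite ?normr1 ?normr0.
have mAB : measurable_fun setT (fun w => \1_A (z w) * \1_B (xi w) : R).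
  exact: measurable_funM.
have iAB : intg P (fun w => \1_A (z w) * \1_B (xi w) : R).
  apply: (intg_le mAB (intg_cst P 1)) => w; rewrite !indicE.
  by case: (_ \in _); case: (_ \in _); rewrite ?(mul0r, mulr0, mulr1, normr1, normr0).
have ei := intg2_intg e2; have epsi := intg2_intg eps2.
have e_AB : indep2 P e (fun w => \1_A (z w) * \1_B (xi w) : R).
  apply: (indep2_comp (@measurable_id _ _ setT)
    (g := fun g : q.-tuple R * (R * (R * R)) => \1_A g.1 * \1_B g.2.1 : R) _ e_ind_zG).
  apply: measurable_funM.
    exact: (measurableT_comp (indic_measurable mA) measurable_fst).
  apply: (measurableT_comp (indic_measurable mB)).
  exact: (measurableT_comp measurable_fst measurable_snd).
have [eABi eAB0] := indep2M ei iAB e_AB; rewrite mean_e mul0r in eAB0.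
have eps_B : indep2 P eps (fun w => \1_B (xi w) : R).
  apply/indep2_sym.
  exact: (indep2_comp (indic_measurable mB) measurable_fst xi_ind_ed).
have [eBi eB0] := indep2M epsi iB eps_B; rewrite mean_eps mul0r in eB0.
have epsB_A : indep2 P (fun w => eps w * \1_B (xi w) : R) (fun w => \1_A (z w) : R).
  apply/indep2_sym; apply: (indep2_comp (indic_measurable mA)
    (g := fun g : R * (R * R) => g.2.1 * \1_B g.1 : R) _ z_ind_G).
  apply: measurable_funM.
    exact: (measurableT_comp measurable_fst measurable_snd).
  exact: (measurableT_comp (indic_measurable mB) measurable_fst).
have [eBAi eBA0] := indep2M eBi iA epsB_A; rewrite eB0 mul0r in eBA0.
rewrite (@ae_mean _ _ _ _ _ (fun w => e w * (\1_A (z w) * \1_B (xi w))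
  + eps w * \1_B (xi w) * \1_A (z w))).
- by rewrite meanD// eAB0 eBA0 addr0.
- apply: measurable_funM => //; apply: measurable_funB => //.
  exact: (intg2_meas D12).
- by apply: measurable_funD; [exact: intg_meas eABi|exact: intg_meas eBAi].
- apply: filterS yy' => w ->; rewrite /F /y' /=; ring.
Qed.

Let D2 w := dotmx c (colv (z w)) + beta0 + pi_.[x w].

(** eta contains no [eps], so [D2] involves [pi_] and not Q; the two differ by the intercept beta0
    and the term a (x - mu) that the corrected predictor subtracts. *)
Let cond_eta eta0 :
  is_cond_expectation P (sigma_of (fun w => (z w, xi w))) y eta0 ->
  is_cond_expectation P (sigma_of (fun w => (z w, x w))) eta0 D2.
Proof.
move=> heta; have mzxi : measurable_fun setT (fun w => (z w, xi w)).
  exact: measurable_fun_pair.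
have etaD1 := cond_expectation_unique mzxi heta cond_y.
have m_eta := cond_expectation_meas heta.
have eta_i : intg P eta0 := let: And3 h _ _ := heta in h.
pose F (t : q.-tuple R * R) := dotmx c (colv t.1) + beta0 + pi_.[t.2].
have mF : measurable_fun setT F.
  apply: measurable_funD.
    apply: measurable_funD => //; exact: (measurableT_comp m_dotc measurable_fst).
  by apply: measurable_horner; exact: measurable_snd.
have mD2 : measurable_fun setT D2.
  have mzx : measurable_fun setT (fun w => (z w, x w)) by exact: measurable_fun_pair.
  exact: (measurableT_comp mF mzx).
have D22 : intg2 P D2.
  apply: (@ae_intg2 _ _ _ _ _ (fun w => dotmx c (colv (z w)) + beta0 + pi_.[x' w])) => //.
    by apply: filterS xx' => w xw; rewrite /D2 xw.
  by apply: intg2D => //; apply: intg2D => //; exact: intg2_cst.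
apply: (@cond_expectation_pair _ _ _ _ _ _ _ _ z x F) => //.
  exact: (intg2_intg D22).
move=> A B mA mB.
have mAz : measurable_fun setT (fun w => \1_A (z w) : R).
  exact: (measurableT_comp (indic_measurable mA)).
have mBx : measurable_fun setT (fun w => \1_B (x w) : R).
  exact: (measurableT_comp (indic_measurable mB)).
have mBx' : measurable_fun setT (fun w => \1_B (x' w) : R).
  exact: (measurableT_comp (indic_measurable mB)).
have iA : intg P (fun w => \1_A (z w) : R).
  apply: (intg_le mAz (intg_cst P 1)) => w; rewrite indicE.
  by case: (_ \in _); rewrite ?normr1 ?normr0.
have B2 : intg2 P (\1_B \o x' : T -> R).
  split=> //; apply: (intg_le _ (intg_cst P 1)) => [|w /=].
    exact: measurable_funX.
  by rewrite indicE; case: (_ \in _); rewrite ?expr1n ?expr0n ?normr1 ?normr0.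
have VB0 : mean P (fun w => V0 w * \1_B (x' w)) = 0.
  exact: (mean_V0 (indic_measurable mB) B2).
have VBi : intg P (fun w => V0 w * \1_B (x' w)) by exact: intg2M.
have V_A : indep2 P (fun w => V0 w * \1_B (x' w)) (fun w => \1_A (z w) : R).
  apply/indep2_sym; apply: (indep2_comp (indic_measurable mA)
    (g := fun g : R * (R * R) => FV0 g * \1_B (g.1 + g.2.2)) _ z_ind_G).
  apply: measurable_funM => //.
  exact: (measurableT_comp (indic_measurable mB)).
have [VAi VA0] := indep2M VBi iA V_A; rewrite VB0 mul0r in VA0.
rewrite (@ae_mean _ _ _ _ _ (fun w => V0 w * \1_B (x' w) * \1_A (z w)))//.
- by apply: measurable_funM; [exact: measurable_funB|exact: measurable_funM].
- exact: intg_meas VAi.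
- apply: filterS2 etaD1 xx' => w -> ->; rewrite V0E /D1 /F /=; ring.
Qed.

(** Transfer from x' and y' back to x and y. Everything is written with raw moments, the limits of
    the empirical moments in [sample_covE] and [sample_varE]. *)
Lemma regression_population :
  let r w : 'cV[R]_(q + k) := col_mx (colv (z w)) (powers k (x w)) in
  let mr := \col_i mean P (fun w => r w i 0) in
  let Sr : 'M[R]_(q + k) := \matrix_(i, j) (mean P (fun w => r w i 0 * r w j 0)
     - mean P (fun w => r w i 0) * mean P (fun w => r w j 0)) in
  let vx := mean P (fun w => x w ^+ 2) - mean P x ^+ 2 in
  [/\ intg2 P y, forall i, intg2 P (fun w => r w i 0),
      \det Sr != 0 /\ vx != 0,
      forall i, mean P (fun w => r w i 0 * y w)
        - mean P (fun w => r w i 0) * mean P y = (Sr *m b) i 0 &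
      forall eta0 hat_eta0,
        is_cond_expectation P (sigma_of (fun w => (z w, xi w))) y eta0 ->
        is_cond_expectation P (sigma_of (fun w => (z w, x w))) eta0 hat_eta0 ->
        {ae P, forall w, hat_eta0 w =
          dotmx b (r w - mr) + mean P y - sigma_ed * vx^-1 * (x w - mean P x)}].
Proof.
move=> r mr Sr vx.
have y2 : intg2 P y by exact: (ae_intg2 m_y yy').
have rr' : {ae P, forall w, r w = regr w}.
  by apply: filterS xx' => w xw; rewrite /r xw.
have mri i : measurable_fun setT (fun w => r w i 0).
  rewrite -(splitK i); case: (fintype.split i) => j /=.
    under eq_fun do rewrite col_mxEu colv_z.
    exact: intg2_meas (z2 j).
  by under eq_fun do rewrite col_mxEd mxE; exact: measurable_funX.
have mregr i : measurable_fun setT (fun w => regr w i 0) by exact: intg2_meas (regr2 i).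
have m_y' := intg2_meas y'2.
have rE i : mean P (fun w => r w i 0) = mean P (fun w => regr w i 0).
  by apply: ae_mean => //; apply: filterS rr' => w ->.
have rrE i j : mean P (fun w => r w i 0 * r w j 0) = mean P (fun w => regr w i 0 * regr w j 0).
  apply: ae_mean; [exact: measurable_funM|exact: measurable_funM|].
  by apply: filterS rr' => w ->.
have ryE i : mean P (fun w => r w i 0 * y w) = mean P (fun w => regr w i 0 * y' w).
  apply: ae_mean; [exact: measurable_funM|exact: measurable_funM|].
  by apply: filterS2 rr' yy' => w -> ->.
have yE : mean P y = mean P y' by exact: ae_mean.
have xE : mean P x = mu by exact: ae_mean.
have SrE : Sr = S by apply/matrixP => i j; rewrite [LHS]mxE [RHS]mxE !rE rrE.
have vxE : vx = v.
  have x'1 : intg2 P x' by apply: eq_intg2 (x'2 1).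
  rewrite /vx xE (@ae_mean _ _ _ _ _ (fun w => x' w * x' w)).
  - by rewrite expr2 -mean_centered//; apply: eq_mean => w; rewrite expr2.
  - exact: measurable_funX.
  - exact: measurable_funM.
  - by apply: filterS xx' => w ->; rewrite expr2.
split; first exact: y2.
- move=> i; apply: (ae_intg2 (mri i) _ (regr2 i)).
  by apply: filterS rr' => w ->.
- by rewrite SrE vxE; split; [exact: det_S|rewrite gt_eqF].
- by move=> i; rewrite ryE rE yE cov_regr_y' SrE.
move=> eta0 hat heta hhat.
have mzx : measurable_fun setT (fun w => (z w, x w)) by exact: measurable_fun_pair.
apply: filterS (cond_expectation_unique mzx hhat (cond_eta heta)) => w ->.
rewrite dotmxB yE mean_y' vxE xE.
have -> : dotmx b mr = \sum_j b j 0 * mean P (fun w => regr w j 0).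
  by rewrite dotmxE; apply: eq_bigr => j _; rewrite -rE; congr (_ * _); exact: mxE.
have := dotmx_b (colv (z w)) (x w); rewrite Q_E -/(r w) /D2 /a => h.
by rewrite (_ : dotmx b (r w) = dotmx c (colv (z w))
  + (pi_.[x w] + sigma_ed / v * (x w - mu) + beta0) - Q`_0); [ring|rewrite -h addrK].
Qed.

End split.

(** The splitting coefficient [lam] is hidden inside b, so that the sampling argument depends on the
    normal equations and the predictor formula only. *)
Lemma eiv_regression : (0 < k)%N ->
  let r w : 'cV[R]_(q + k) := col_mx (colv (z w)) (powers k (x w)) in
  let mr := \col_i mean P (fun w => r w i 0) in
  let Sr : 'M[R]_(q + k) := \matrix_(i, j) (mean P (fun w => r w i 0 * r w j 0)
     - mean P (fun w => r w i 0) * mean P (fun w => r w j 0)) in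
  let vx := mean P (fun w => x w ^+ 2) - mean P x ^+ 2 in
  exists b : 'cV[R]_(q + k),
  [/\ intg2 P y, forall i, intg2 P (fun w => r w i 0),
      \det Sr != 0 /\ vx != 0,
      forall i, mean P (fun w => r w i 0 * y w)
        - mean P (fun w => r w i 0) * mean P y = (Sr *m b) i 0 &
      forall eta0 hat_eta0,
        is_cond_expectation P (sigma_of (fun w => (z w, xi w))) y eta0 ->
        is_cond_expectation P (sigma_of (fun w => (z w, x w))) eta0 hat_eta0 ->
        {ae P, forall w, hat_eta0 w =
          dotmx b (r w - mr) + mean P y - sigma_ed * vx^-1 * (x w - mean P x)}].
Proof.
move=> k_gt0; have [lam ilam] := gaussian_indep_split m_xi m_delta g_xi g_delta xi_ind_delta.
by eexists; exact: regression_population ilam k_gt0.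
Qed.

End model.

Lemma sample_cov_cvg (R : realType) l m (u : nat -> 'cV[R]_l) (v : nat -> 'cV[R]_m)
    (U : 'I_l -> R) (V : 'I_m -> R) (UV : 'I_l -> 'I_m -> R) :
  (forall i, sample_mean (fun t => u t i 0 : R^o) n @[n --> \oo] --> U i) ->
  (forall j, sample_mean (fun t => v t j 0 : R^o) n @[n --> \oo] --> V j) ->
  (forall i j, sample_mean (fun t => u t i 0 * v t j 0 : R^o) n @[n --> \oo] --> UV i j) ->
  cvgmx (sample_cov u v) (\matrix_(i, j) (UV i j - U i * V j)).
Proof.
move=> uU vV uvUV i j; rewrite mxE; under eq_fun do rewrite sample_covE.
by apply: cvgB; [exact: uvUV|apply: cvgM; [exact: uU|exact: vV]].
Qed.

(** * Convergence of the corrected predictor *)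

Section main.
Context (R : realType) d (T : measurableType d) (P : probability T R).
Context (q k : nat) (hk : (2 <= k)%N).
Context (c : 'cV[R]_q) (beta0 : R) (beta : 'cV[R]_k) (sigma_ed : R).
Context (y : nat -> {RV P >-> R}) (z : nat -> {RV P >-> q.-tuple R})
  (xi e eps x delta : nat -> {RV P >-> R}).
Hypothesis hmodel : forall i, eiv_model c beta0 beta sigma_ed
       (y i) (z i) (xi i) (e i) (eps i) (x i) (delta i).
Let obs i := observation (y i) (z i) (xi i) (e i) (eps i) (x i) (delta i).
Hypothesis hindep : mutually_independent P (fun i => sigma_of (obs i)).
Hypothesis hlaw : forall i, same_law P (obs i) (obs 0%N).
Context (eta0 hat_eta0 : T -> R).
Hypothesis heta0 : is_cond_expectation P (sigma_of (fun w => (z 0%N w, xi 0%N w)))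
       (y 0%N) eta0.
Hypothesis hhat_eta0 : is_cond_expectation P (sigma_of (fun w => (z 0%N w, x 0%N w)))
       eta0 hat_eta0.

Let Z w i := colv (z i w).
Let S n w := sample_cov (regressor k (Z w) (fun i => x i w))
  (regressor k (Z w) (fun i => x i w)) n.
(** Measurable for every n, and equal to the corrected predictor wherever the sample covariance
    matrix is nonsingular. *)
Let lp n w := linear_predictor (adj_coef k (fun i => y i w) (Z w) (fun i => x i w) n)
  (fun i => y i w) (Z w) (fun i => x i w) n sigma_ed.

Let mobs i : measurable_fun setT (obs i).
Proof. by do 6 apply: measurable_fun_pair => //. Qed.

Let corrected_lp n w : \det (S n w) != 0 ->
  corrected_predictor k (fun i => y i w) (fun i => colv (z i w))
    (fun i => x i w) n sigma_ed = lp n w.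
Proof. by move=> dS; rewrite corrected_predictorE ols_coef_adj. Qed.

Let Obs := ((((((R * q.-tuple R) * R) * R) * R) * R) * R)%type.
Let obs_y (o : Obs) : R := o.1.1.1.1.1.1.
Let obs_z (o : Obs) : q.-tuple R := o.1.1.1.1.1.2.
Let obs_x (o : Obs) : R := o.1.2.

Let m_fst5 : measurable_fun setT (fun o : Obs => o.1.1.1.1.1).
Proof.
do 4 apply: (measurableT_comp measurable_fst).
exact: measurable_fst.
Qed.

Let m_obs_y : measurable_fun setT obs_y.
Proof. exact: (measurableT_comp measurable_fst m_fst5). Qed.

Let m_obs_z : measurable_fun setT obs_z.
Proof. exact: (measurableT_comp measurable_snd m_fst5). Qed.

Let m_obs_x : measurable_fun setT obs_x.
Proof. exact: (measurableT_comp measurable_snd measurable_fst). Qed.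

(** Regressors are viewed as functions of the whole observation, the variable whose copies are
    independent and identically distributed. *)
Let obs_r (o : Obs) : 'cV[R]_(q + k) := col_mx (colv (obs_z o)) (powers k (obs_x o)).

Let m_obs_r i : measurable_fun setT (fun o => obs_r o i 0).
Proof.
rewrite -(splitK i); case: (fintype.split i) => j /=.
  under eq_fun do rewrite col_mxEu mxE.
  exact: (measurableT_comp (measurable_tnth j) m_obs_z).
by under eq_fun do rewrite col_mxEd mxE; exact: measurable_funX.
Qed.

Let slln (f : Obs -> R) : measurable_fun setT f -> intg P (f \o obs 0%N) ->
  {ae P, forall w, sample_mean (fun i => f (obs i w) : R^o) n @[n --> \oo] -->
    mean P (f \o obs 0%N)}.
Proof. exact: strong_law. Qed.

(** The strong law is applied to the finitely many first and second moments of r, x and y; on the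
    resulting event the rest is continuity, the determinant being nonzero in the limit and hence
    eventually. *)
Lemma linear_predictor_ae : {ae P, forall w,
  (\forall n \near \oo, \det (S n w) != 0) /\ lp n w @[n --> \oo] --> hat_eta0 w}.
Proof.
have k_gt0 : (0 < k)%N by exact: ltnW.
have [b [y2 r2 [dS vx] Sb hat_ae]] := eiv_regression (hmodel 0) k_gt0.
have x2 : intg2 P (x 0%N).
  apply: (eq_intg2 _ (r2 (rshift q (Ordinal k_gt0)))) => w.
  by rewrite col_mxEd mxE.
have yi := intg2_intg y2; have xi' := intg2_intg x2.
have ri i := intg2_intg (r2 i).
have sy := slln m_obs_y yi.
have sx := slln m_obs_x xi'.
have sxx := slln (measurable_funX 2 m_obs_x) (proj2 x2).
(* Entries i and j range over finite sets, so the almost sure events can be intersected. *)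
have FP : Filter (nbhs (almost_everywhere P)) by exact: ae_filter_ringOfSetsType.
have sr := filter_forall FP (fun i => slln (m_obs_r i) (ri i)).
have srr := filter_forall FP (fun i => filter_forall FP (fun j =>
  slln (measurable_funM (m_obs_r i) (m_obs_r j)) (intg2M (r2 i) (r2 j)))).
have sry := filter_forall FP (fun i =>
  slln (measurable_funM (m_obs_r i) m_obs_y) (intg2M (r2 i) y2)).
have ae_and (A B : T -> Prop) : {ae P, forall w, A w} -> {ae P, forall w, B w} ->
    {ae P, forall w, A w /\ B w} := @filterI _ _ FP A B.
have all_ae := ae_and _ _ (hat_ae _ _ heta0 hhat_eta0) (ae_and _ _ sy (ae_and _ _ sx
  (ae_and _ _ sxx (ae_and _ _ sr (ae_and _ _ srr sry))))).
apply: filterS all_ae.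
move=> w [hat_w [{}sy [{}sx [{}sxx [{}sr [{}srr {}sry]]]]]].
pose rw i := regressor k (Z w) (fun i => x i w) i.
pose Sr := \matrix_(i, j) (mean P ((fun o => obs_r o i 0 * obs_r o j 0) \o obs 0%N)
  - mean P ((fun o => obs_r o i 0) \o obs 0%N) * mean P ((fun o => obs_r o j 0) \o obs 0%N)).
have cS : cvgmx (fun n => S n w) Sr := @sample_cov_cvg _ _ _ rw rw _ _ _ sr sr srr.
(* The limiting covariances with y are rewritten as [Sr *m b] by the normal equations. *)
have cSy : cvgmx (sample_cov rw (fun i => (y i w)%:M)) (Sr *m b).
  have syM : forall j : 'I_1, sample_mean (fun t => ((y t w)%:M : 'cV[R]_1) j 0 : R^o) n
      @[n --> \oo] --> mean P (y 0%N).
    by move=> j; rewrite (ord1 j); under eq_fun do under eq_fun do rewrite mxE eqxx.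
  have sryM : forall i (j : 'I_1), sample_mean (fun t => rw t i 0
      * ((y t w)%:M : 'cV[R]_1) j 0 : R^o) n @[n --> \oo] -->
      mean P ((fun o => obs_r o i 0 * obs_y o) \o obs 0%N).
    move=> i j; rewrite (ord1 j).
    by under eq_fun do under eq_fun do rewrite [_%:M _ _]mxE eqxx; exact: sry.
  have := sample_cov_cvg sr syM sryM => h i j; have := h i j.
  by rewrite mxE (ord1 j) -Sb.
split; first by have /cvgr_neq0 := cvgmx_det cS; apply.
rewrite hat_w; apply: (linear_predictor_cvg _ _ sy sx sxx vx) => [|i].
  exact: (adj_coef_cvg cS cSy dS).
by rewrite mxE; exact: sr.
Qed.

Lemma corrected_predictor_ae : {ae P, forall w,
  corrected_predictor k (fun i => y i w) (fun i => colv (z i w))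
    (fun i => x i w) n sigma_ed @[n --> \oo] --> hat_eta0 w}.
Proof.
apply: filterS linear_predictor_ae => w [dS]; apply: cvg_trans.
apply: near_eq_cvg; apply: filterS dS => n dS.
by rewrite corrected_lp.
Qed.

(** The majorizing events [F n] ask for a singular sample covariance or a deviation of [lp] above
    [tau]; almost surely both stop occurring, by [linear_predictor_ae]. *)
Lemma corrected_predictor_cond_probability tau p : 0 < tau ->
  (forall n, (2 <= n)%N ->
    is_cond_probability P (sigma_of (fun w => (z 0%N w, x 0%N w)))
      [set w | tau < `|corrected_predictor k (fun i => y i w)
         (fun i => colv (z i w)) (fun i => x i w) n sigma_ed - hat_eta0 w|] (p n)) ->
  {ae P, forall w, p n w @[n --> \oo] --> 0}.
Proof.
move=> tau0 hp.
have mzx : measurable_fun setT (fun w => (z 0%N w, x 0%N w)).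
  exact: measurable_fun_pair.
have mZ i : measmx (Z^~ i).
  by move=> a b; under eq_fun do rewrite mxE; exact: (measurableT_comp (measurable_tnth a)).
have mhat := cond_expectation_meas hhat_eta0.
have my i : measurable_fun setT (y i) by exact: measurable_funPT.
have mx i : measurable_fun setT (x i) by exact: measurable_funPT.
(* The events of the conclusion are not known to be measurable: off
   [\det S = 0] the pseudo-inverse is the adjugate formula, which is. *)
apply: (cond_probability_cvg0 mzx (F := fun n =>
  (fun w => \det (S n w)) @^-1` [set 0] `|`
  (fun w => `|lp n w - hat_eta0 w|) @^-1` [set t | tau < t]) hp).
- move=> n w /=; have [->|dS] := eqVneq (\det (S n w)) 0; first by left.
  by rewrite corrected_lp//; right.
- move=> n; apply: measurableU; apply: measurable_preimage => //.
  + exact: measurable_det_cov.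
  + apply: measurableT_comp => //; apply: measurable_funB => //.
    exact: measurable_linear_predictor.
  + rewrite (_ : [set t | tau < t] = `]tau, +oo[%classic)//.
    by apply/seteqP; split => t; rewrite /= in_itv/= andbT.
apply: filterS linear_predictor_ae => w [dS lw].
have lw0 : (lp n w - hat_eta0 w) @[n --> \oo] --> (0 : R).
  by rewrite -(subrr (hat_eta0 w)); apply: cvgB => //; exact: cvg_cst.
have near_tau : \forall n \near \oo, `|lp n w - hat_eta0 w| < tau.
  by apply: cvgr0_norm_lt.
apply: filterS2 dS near_tau => n /eqP dS lt_tau [//|/= tau_lt].
by have := lt_trans tau_lt lt_tau; rewrite ltxx.
Qed.

End main.
Theorem theorem5 (R : realType) (d : measure_display) (T : measurableType d)
    (P : probability T R) (q k : nat) (hk : (2 <= k)%N)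
    (c : 'cV[R]_q) (beta0 : R) (beta : 'cV[R]_k) (sigma_ed : R)
    (y : nat -> {RV P >-> R}) (z : nat -> {RV P >-> q.-tuple R})
    (xi e eps x delta : nat -> {RV P >-> R})
    (hmodel : forall i, eiv_model c beta0 beta sigma_ed
       (y i) (z i) (xi i) (e i) (eps i) (x i) (delta i))
    (hindep : mutually_independent P (fun i => sigma_of
       (observation (y i) (z i) (xi i) (e i) (eps i) (x i) (delta i))))
    (hlaw : forall i, same_law P
       (observation (y i) (z i) (xi i) (e i) (eps i) (x i) (delta i))
       (observation (y 0%N) (z 0%N) (xi 0%N) (e 0%N) (eps 0%N) (x 0%N) (delta 0%N)))
    (eta0 hat_eta0 : T -> R)
    (heta0 : is_cond_expectation P (sigma_of (fun w => (z 0%N w, xi 0%N w)))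
       (y 0%N) eta0)
    (hhat_eta0 : is_cond_expectation P (sigma_of (fun w => (z 0%N w, x 0%N w)))
       eta0 hat_eta0) :
  let tilde_eta0 (n : nat) (w : T) : R :=
    corrected_predictor k (fun i => y i w) (fun i => colv (z i w))
      (fun i => x i w) n sigma_ed in
  {ae P, forall w, tilde_eta0 n w @[n --> \oo] --> hat_eta0 w} /\
  forall tau : R, 0 < tau ->
  forall p : nat -> T -> R,
    (forall n, (2 <= n)%N ->
       is_cond_probability P (sigma_of (fun w => (z 0%N w, x 0%N w)))
         [set w | tau < `|tilde_eta0 n w - hat_eta0 w|] (p n)) ->
    {ae P, forall w, p n w @[n --> \oo] --> 0}.
Proof.
move=> tilde_eta0; split; first exact: corrected_predictor_ae heta0 hhat_eta0.
move=> tau tau0 p; exact: corrected_predictor_cond_probability heta0 hhat_eta0 _ _ tau0.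
Qed.
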